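(* Let $k$ be an algebraically closed field of characteristic zero, $G$ a finite group and $A\subseteq G$ an abelian subgroup. Let $D$ be the map sending the gauge equivalence class of a dynamical twist $J:A^*\to k[G]\otimes k[G]$ to the isomorphism class of the dynamical data for $(G,A)$ associated with $J$ (construction D of the context), and let $T$ be the map sending the isomorphism class of a dynamical datum $(K,\{V_\lambda\mid\lambda\in A^*\})$ for $(G,A)$ to the gauge equivalence class of the dynamical twists obtained from it by the exchange construction (construction T of the context). Then $D$ and $T$ are inverses of each other, i.e., they define a bijective correspondence between (i) gauge equivalence classes of dynamical twists $J:A^*\to k[G]\otimes k[G]$, and (ii) isomorphism classes of dynamical data $(K,\{V_\lambda\mid\lambda\in A^*\})$ for $(G,A)$.
   Context: Conventions. $A^*=\mathrm{Hom}(A,k^\times)$ is written additively, with $0$ the trivial character. For $\mu\in A^*$ let $P_\mu=\frac1{|A|}\sum_{a\in A}\mu(a)^{-1}a\in k[A]$, and for a left $k[G]$-module $X$ let $X[\mu]=\{x\in X\mid ax=\mu(a)x \text{ for all } a\in A\}$. $\Delta,\varepsilon$ are the comultiplication $g\mapsto g\otimes g$ and counit $g\mapsto 1$ of $k[G]$. An element of $k[G]^{\otimes n}$ has zero weight if it commutes with $a\otimes\cdots\otimes a$ for all $a\in A$. Functions on $G$ are extended linearly to $k[G]$. Dynamical twists. A dynamical twist is a function $J:A^*\to k[G]\otimes k[G]$ with invertible zero weight values such that for all $\lambda\in A^*$: $(\Delta\otimes\mathrm{id})(J(\lambda))\cdot\sum_{\mu\in A^*}J(\lambda-\mu)\otimes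 P_\mu=(\mathrm{id}\otimes\Delta)(J(\lambda))\cdot(1\otimes J(\lambda))$ and $(\varepsilon\otimes\mathrm{id})J(\lambda)=(\mathrm{id}\otimes\varepsilon)J(\lambda)=1$. A gauge transformation is a function $t:A^*\to k[G]$ with invertible zero weight values and $\varepsilon(t(\lambda))=1$ for all $\lambda$; then $J^t(\lambda)=\Delta(t(\lambda)^{-1})J(\lambda)\bigl(\sum_{\mu}t(\lambda-\mu)\otimes P_\mu\bigr)(1\otimes t(\lambda))$ is again a dynamical twist, said to be gauge equivalent to $J$. Projective representations and dynamical data. A projective representation of a group $K$ on a vector space $V\neq0$ with 2-cocycle $c:K\times K\to k^\times$ is a map $\pi:K\to GL(V)$ with $\pi(g)\pi(h)=c(g,h)\pi(gh)$. It is linear if $c\equiv1$, and irreducible if $\pi(K)$ spans $\mathrm{End}_kV$. Tensor products are formed in the obvious way and $V^*$ carries the dual projective representation $g\mapsto(\pi(g)^{-1})^*$. A projective isomorphism from $\pi:K\to GL(V)$ to $\pi':K\to GL(V')$ is a linear isomorphism $\phi:V\to V'$ with $\pi'(g)\phi=\alpha(g)\phi\pi(g)$ for a function $\alpha:K\to k^\times$, called its multiplier function. A dynamical datum for $(G,A)$ is a subgroup $K\subseteq G$ with a family of irreducible projective representations $\pi_\lambda:K\to GL(V_\lambda)$, $\lambda\in A^*$, such that for all $\lambda,\mu\in A^*$ the projective representation $V_{\lambda-\mu}\otimes V_\lambda^*$ is linear and $\mathrm{Ind}_K^G(V_\lambda\otimes V_{\lambda-\mu}^* )\cong\mathrm{Ind}_A^G\mu$.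 An isomorphism of dynamical data $(K,\{V_\lambda\})\to(K',\{V'_\lambda\})$ is an element $g\in G$ with $gKg^{-1}=K'$ together with projective isomorphisms $\phi_\lambda:V_\lambda\to V'_\lambda$ ($\lambda\in A^*$) from $\pi_\lambda$ to $\pi'_\lambda\circ\mathrm{Ad}_g$ all having the same multiplier function. Construction D. Let $J$ be a dynamical twist. For $\mu\in A^*$ let $F_\mu[G]=\{f:G\to k\mid f(ha)=\mu(a)f(h),\ a\in A,h\in G\}$, with $G$ acting by $(h\circ f)(g)=f(h^{-1}g)$. Let $B_\lambda$ be $F_0[G]$ with the product $(f_1*_\lambda f_2)(g)=(f_1\otimes f_2)((g\otimes g)J(\lambda))$; it is a semisimple associative algebra on which $G$ acts by automorphisms. $F_\mu[G]$ is a $G$-equivariant $B_{\lambda-\mu}$-$B_\lambda$ bimodule via $(f\circ f_\mu)(g)=(f\otimes f_\mu)((g\otimes g)J(\lambda))$ and $(f_\mu\circ f')(g)=(f_\mu\otimes f')((g\otimes g)J(\lambda))$. Let $\mathcal I_\lambda$ be the $G$-set of minimal two-sided ideals of $B_\lambda$. The decomposition of the $B_\lambda$-$B_\mu$ bimodule $F_{\mu-\lambda}[G]$ into simple bimodules gives $G$-set isomorphisms $\mathcal I_\lambda\to\mathcal I_\mu$ (sending $I$ to the unique $I'$ with $I\,F_{\mu-\lambda}[G]\,I'\ne0$), compatible with composition, and thereby all $\mathcal I_\lambda$ are identified with one $G$-set $\mathcal I$. Fix $i\in\mathcal I$, let $K$ be its stabilizer in $G$, $B_\lambda^i$ the corresponding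 minimal ideal of $B_\lambda$, $V_\lambda$ a simple $B_\lambda^i$-module, and $F^i_{\lambda\mu}=B^i_\lambda F_{\mu-\lambda}[G]B^i_\mu$, which is isomorphic to $V_\lambda\otimes V_\mu^*$ as a $B_\lambda^i$-$B_\mu^i$ bimodule. One can choose irreducible projective representations $\pi_\lambda:K\to GL(V_\lambda)$ such that each $g\in K$ acts on $B_\lambda^i\cong\mathrm{End}_kV_\lambda$ by $\mathrm{Ad}_{\pi_\lambda(g)}$ and, for all $\lambda,\mu$, the bimodule isomorphisms $F^i_{\lambda\mu}\cong V_\lambda\otimes V_\mu^*$ are $K$-equivariant. Any $(K,\{V_\lambda\})$ so obtained is a dynamical datum for $(G,A)$, said to be associated with $J$; its isomorphism class depends only on the gauge equivalence class of $J$. Construction T. Let $(K,\{V_\lambda\})$ be a dynamical datum. All $\pi_\lambda$ have the same 2-cocycle $c$; let $\widehat K$ be the corresponding central extension of $K$ by a subgroup $L\subset k^\times$ containing the values of $c$, with product $(g,x)(h,y)=(gh,c(g,h)xy)$, so that each $V_\lambda$ is a linear representation of $\widehat K$ via $(g,x)\mapsto x\pi_\lambda(g)$, and every $G$-module is a $\widehat K$-module with $L$ acting trivially. Choose $G$-isomorphisms $\epsilon_{\lambda\mu}:\mathrm{Ind}_K^G(V_\lambda\otimes V_{\lambda-\mu}^* )\cong\mathrm{Ind}_A^G\mu$. For every $G$-module $X$ they give isomorphisms $\mathrm{Hom}_{\widehat K}(V_\lambda,V_{\lambda-\mu}\otimes X)\cong\mathrm{Hom}_K(V_\lambda\otimes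 V_{\lambda-\mu}^*,X)\cong\mathrm{Hom}_G(\mathrm{Ind}_A^G\mu,X)\cong X[\mu]$ (first and third canonical, second via Frobenius reciprocity and $\epsilon_{\lambda\mu}$); let $\Psi(\lambda,x)\in\mathrm{Hom}_{\widehat K}(V_\lambda,V_{\lambda-\mu}\otimes X)$ correspond to $x\in X[\mu]$. The $\epsilon_{\lambda0}$ are normalized so that for the trivial module $X=k$ one has $\Psi(\lambda,1)=\mathrm{id}_{V_\lambda}$. For $G$-modules $X,Y$ let $J_{Y,X}(\lambda):Y\otimes X\to Y\otimes X$ be the linear operator with $(\Psi(\lambda-\mu,y)\otimes\mathrm{id})\circ\Psi(\lambda,x)=\Psi(\lambda,J_{Y,X}(\lambda)(y\otimes x))$ for all $x\in X[\mu],\,y\in Y[\nu]$, $\mu,\nu\in A^*$. These operators are natural in $X,Y$, hence given by the action of an element $J(\lambda)\in k[G]\otimes k[G]$. The function $\lambda\mapsto J(\lambda)$ is a dynamical twist whose gauge equivalence class depends only on the isomorphism class of the datum. *)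

(* Defs.v *)
From HB Require Import structures.
From mathcomp Require Import all_boot all_order all_algebra all_fingroup.
From mathcomp Require Import all_solvable all_field mxrepresentation.
From mathcomp.real_closed Require Import mxtens.

Set Implicit Arguments.
Unset Strict Implicit.
Unset Printing Implicit Defensive.

Import GroupScope GRing.Theory.
Local Open Scope ring_scope.

(* The ambient finite group G is the whole type gT : finGroupType.            *)

(* u : galg k H stands for \sum_h (u h) h.  The tensor powers of k[gT] are    *)
(* the group algebras k[gT x gT] and k[(gT x gT) x gT].  This is an alias of  *)
(* {ffun H -> k^o} because the latter carries the pointwise product.          *)
Definition galg (k : fieldType) (H : finGroupType) := {ffun H -> k^o}.

Section GroupAlgebra.
Variables (k : fieldType) (H : finGroupType).

HB.instance Definition _ := Vector.copy (galg k H) {ffun H -> k^o}.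

Definition gcoef (u : galg k H) (h : H) : k := (u : {ffun H -> k^o}) h.
Definition gfun (f : H -> k) : galg k H := [ffun h => f h] : {ffun H -> k^o}.
Definition gel (g : H) : galg k H := gfun (fun h => (h == g)%:R).
Definition gmul (u v : galg k H) : galg k H :=
  gfun (fun g => \sum_h gcoef u h * gcoef v (h^-1 * g)%g).

Lemma gcoefE f h : gcoef (gfun f) h = f h.
Proof. by rewrite /gcoef /gfun ffunE. Qed.

Lemma galgP (u v : galg k H) : gcoef u =1 gcoef v <-> u = v.
Proof. by split=> [e|->] //; apply/ffunP=> h; apply: e. Qed.

Lemma gcoefD u v h : gcoef (u + v) h = gcoef u h + gcoef v h.
Proof. by rewrite /gcoef ffunE. Qed.

Lemma gcoefZ a u h : gcoef (a *: u) h = a * gcoef u h.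
Proof. by rewrite /gcoef ffunE. Qed.

Fact gmulA : associative gmul.
Proof.
move=> u v w; apply/galgP=> g; rewrite !gcoefE.
under eq_bigr => h _ do rewrite gcoefE mulr_sumr.
under [RHS]eq_bigr => h _ do rewrite gcoefE mulr_suml.
rewrite [RHS]exchange_big /=; apply: eq_bigr => h _.
rewrite (reindex_inj (mulgI h^-1%g)) /=; apply: eq_bigr => x _.
by rewrite mulrA invMg invgK -!mulgA mulKVg.
Qed.

Fact gmul1 : left_id (gel 1%g) gmul.
Proof.
move=> u; apply/galgP=> g; rewrite gcoefE (bigD1 1%g) //= gcoefE eqxx mul1r.
rewrite invg1 mul1g big1 ?addr0 // => h /negPf nh.
by rewrite gcoefE nh mul0r.
Qed.

Fact gmulr1 : right_id (gel 1%g) gmul.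
Proof.
move=> u; apply/galgP=> g; rewrite gcoefE (bigD1 g) //= gcoefE mulVg eqxx mulr1.
rewrite big1 ?addr0 // => h nh; rewrite gcoefE.
by rewrite -eq_invg_mul invgK (negPf nh) mulr0.
Qed.

Fact gmulDl : left_distributive gmul +%R.
Proof.
move=> u v w; apply/galgP=> g; rewrite gcoefD !gcoefE -big_split /=.
by apply: eq_bigr => h _; rewrite gcoefD mulrDl.
Qed.

Fact gmulDr : right_distributive gmul +%R.
Proof.
move=> u v w; apply/galgP=> g; rewrite gcoefD !gcoefE -big_split /=.
by apply: eq_bigr => h _; rewrite gcoefD mulrDr.
Qed.

Fact gel1_neq0 : gel 1%g != 0.
Proof.
apply/eqP=> /galgP /(_ 1%g) /eqP.
by rewrite gcoefE eqxx /gcoef ffunE (negPf (oner_neq0 k)).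
Qed.

HB.instance Definition _ := GRing.Zmodule_isNzRing.Build (galg k H)
  gmulA gmul1 gmulr1 gmulDl gmulDr gel1_neq0.

Fact gscaleAl (a : k) (u v : galg k H) : a *: (u * v) = (a *: u) * v.
Proof.
apply/galgP=> g; rewrite gcoefZ !gcoefE mulr_sumr.
by apply: eq_bigr => h _; rewrite gcoefZ mulrA.
Qed.

HB.instance Definition _ := GRing.Lmodule_isLalgebra.Build k (galg k H) gscaleAl.

Fact gscaleAr (a : k) (u v : galg k H) : a *: (u * v) = u * (a *: v).
Proof.
apply/galgP=> g; rewrite gcoefZ !gcoefE mulr_sumr.
by apply: eq_bigr => h _; rewrite gcoefZ mulrCA.
Qed.

HB.instance Definition _ := GRing.Lalgebra_isAlgebra.Build k (galg k H) gscaleAr.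
HB.instance Definition _ := Algebra_isFalgebra.Build k (galg k H).

(* The linear extension to k[H] of a function on H.                           *)
Definition gev (f : H -> k) (u : galg k H) : k := \sum_h gcoef u h * f h.

End GroupAlgebra.

(* The linear map k[H] -> k[H'] extending phi : H -> H'.                      *)
Definition gmap (k : fieldType) (H H' : finGroupType) (phi : H -> H')
  (u : galg k H) : galg k H' := \sum_h gcoef u h *: gel k (phi h).

Definition gtens (k : fieldType) (H H' : finGroupType)
    (u : galg k H) (v : galg k H') : galg k [the finGroupType of (H * H')%type] :=
  gfun (fun p => gcoef u p.1 * gcoef v p.2).

Section Dual.
Variables (k : closedFieldType) (gT : finGroupType) (A : {group gT}).

(* A character of A is extended by 0 outside A.                               *)
Definition is_dual (f : {ffun gT -> k}) :=
  [&& f 1%g == 1,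
      [forall a in A, forall b in A, f (a * b)%g == f a * f b]
    & [forall g, (g \notin A) ==> (f g == 0)]].

Record dual := Dual { dual_fun :> {ffun gT -> k}; _ : is_dual dual_fun }.

HB.instance Definition _ := [isSub for dual_fun].
HB.instance Definition _ := [Choice of dual by <:].

Lemma is_dualP (f : {ffun gT -> k}) :
  reflect [/\ f 1%g = 1, {in A &, {morph f : a b / (a * b)%g >-> a * b}}
            & forall g, g \notin A -> f g = 0] (is_dual f).
Proof.
apply: (iffP and3P) => [] [f1 fM f0]; split.
- exact/eqP.
- by move=> a b Aa Ab; apply/eqP; apply: (forall_inP (forall_inP fM a Aa)).
- by move=> g Ag; apply/eqP; apply: (implyP (forallP f0 g)).
- exact/eqP.
- by apply/forall_inP=> a Aa; apply/forall_inP=> b Ab; rewrite fM.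
- by apply/forallP=> g; apply/implyP=> Ag; rewrite f0.
Qed.

Lemma dualE (m : dual) :
  [/\ m 1%g = 1, {in A &, {morph m : a b / (a * b)%g >-> a * b}}
    & forall g, g \notin A -> m g = 0].
Proof. exact/is_dualP/(valP m). Qed.

Lemma dual_expr (m : dual) a : a \in A -> m a ^+ #|A| = 1.
Proof.
case: (dualE m) => m1 mM _ Aa.
have mX n : m (a ^+ n)%g = m a ^+ n.
  by elim: n => // n IHn; rewrite expgS mM ?groupX // IHn exprS.
by rewrite -mX expg_cardG.
Qed.

Definition dual_roots : seq k :=
  sval (closed_field_poly_normal ('X^#|A| - 1 : {poly k})).

Lemma dual_rootsP (m : dual) a : a \in A -> m a \in dual_roots.
Proof.
move=> Aa; rewrite /dual_roots; case: closed_field_poly_normal => r /= Dp.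
have: root ('X^#|A| - 1) (m a).
  by rewrite rootE !hornerE dual_expr ?subrr.
rewrite Dp rootZ ?root_prod_XsubC //.
by rewrite lead_coef_eq0 -size_poly_eq0 size_XnsubC.
Qed.

Definition dual_code (m : dual) : {ffun gT -> option (seq_sub dual_roots)} :=
  [ffun g => insub (m g)].

Definition dual_decode (c : {ffun gT -> option (seq_sub dual_roots)}) :
  option dual := insub [ffun g => oapp val 0 (c g)].

Fact dual_codeK : pcancel dual_code dual_decode.
Proof.
move=> m; rewrite /dual_decode -[RHS](valK m); congr insub.
apply/ffunP=> g; rewrite !ffunE; case: insubP => [u _ e|] /=.
  by rewrite -e.
case: (boolP (g \in A)) => [Ag|nAg _]; first by rewrite dual_rootsP.
by case: (dualE m) => _ _ ->.
Qed.

HB.instance Definition _ := PCanIsCountable dual_codeK.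
HB.instance Definition _ : isFinite dual := PCanIsFinite dual_codeK.

Fact dual0_subproof : is_dual [ffun g => (g \in A)%:R].
Proof.
apply/is_dualP; split=> [|a b Aa Ab|g Ag]; rewrite !ffunE ?group1 //.
  by rewrite groupM // Aa Ab mulr1.
by rewrite (negPf Ag).
Qed.
Definition dual0 := Dual dual0_subproof.

Fact dualN_subproof (m : dual) : is_dual [ffun g => (m g)^-1].
Proof.
case: (dualE m) => m1 mM m0; apply/is_dualP.
split=> [|a b Aa Ab|g Ag]; rewrite !ffunE.
- by rewrite m1 invr1.
- by rewrite mM // invfM.
- by rewrite m0 // invr0.
Qed.
Definition dualN m := Dual (dualN_subproof m).

Fact dualD_subproof (m n : dual) : is_dual [ffun g => m g * n g].
Proof.
case: (dualE m) => m1 mM m0; case: (dualE n) => n1 nM n0; apply/is_dualP.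
split=> [|a b Aa Ab|g Ag]; rewrite !ffunE.
- by rewrite m1 n1 mulr1.
- by rewrite mM // nM // mulrACA.
- by rewrite m0 // mul0r.
Qed.
Definition dualD m n := Dual (dualD_subproof m n).

Fact dualDA : associative dualD.
Proof. by move=> m n p; apply/val_inj/ffunP=> g; rewrite !ffunE mulrA. Qed.

Fact dualDC : commutative dualD.
Proof. by move=> m n; apply/val_inj/ffunP=> g; rewrite !ffunE mulrC. Qed.

Fact dual0D : left_id dual0 dualD.
Proof.
move=> m; apply/val_inj/ffunP=> g; rewrite !ffunE.
case: (boolP (g \in A)) => Ag; first by rewrite mul1r.
by case: (dualE m) => _ _ ->; rewrite // mulr0.
Qed.

Fact dualND : left_inverse dual0 dualN dualD.
Proof.
move=> m; apply/val_inj/ffunP=> g; rewrite !ffunE.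
case: (boolP (g \in A)) => Ag; last first.
  by case: (dualE m) => _ _ ->; rewrite // mulr0.
rewrite mulVf //; apply: contra_eq_neq (dual_expr m Ag) => ->.
by rewrite expr0n gtn_eqF ?cardG_gt0 // eq_sym oner_neq0.
Qed.

HB.instance Definition _ := GRing.isZmodule.Build dual dualDA dualDC dual0D dualND.

End Dual.

Section Twists.
Variables (k : closedFieldType) (gT : finGroupType) (A : {group gT}).

Notation dualA := (dual k A).
Notation kG := (galg k gT).
Notation kGG := (galg k [the finGroupType of (gT * gT)%type]).

Definition idem (mu : dualA) : kG :=
  (#|A|%:R : k)^-1 *: \sum_(a in A) (mu a)^-1 *: gel k a.

Definition zero_weight1 (u : kG) :=
  forall a, a \in A -> u * gel k a = gel k a * u.
Definition zero_weight2 (u : kGG) :=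
  forall a, a \in A -> u * gel k (a, a) = gel k (a, a) * u.

Definition is_twist (J : dualA -> kGG) :=
  forall lam : dualA,
  [/\ J lam \is a GRing.unit,
      zero_weight2 (J lam),
      gmap (fun p => ((p.1, p.1), p.2)) (J lam)
        * (\sum_(mu : dualA) gtens (J (lam - mu)) (idem mu))
      = gmap (fun p => ((p.1, p.2), p.2)) (J lam)
        * gmap (fun p => ((1%g, p.1), p.2)) (J lam),
      gmap (fun p => p.2) (J lam) = 1
    & gmap (fun p => p.1) (J lam) = 1].

Record twist := Twist { twist_fun :> dualA -> kGG; _ : is_twist twist_fun }.

Definition is_gauge (t : dualA -> kG) :=
  forall lam : dualA,
  [/\ t lam \is a GRing.unit, zero_weight1 (t lam)
    & gev (fun=> 1) (t lam) = 1].

Definition gauge_transform (t : dualA -> kG) (J : dualA -> kGG) (lam : dualA) :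
    kGG :=
  gmap (fun g => (g, g)) (t lam)^-1 * J lam
    * (\sum_(mu : dualA) gtens (t (lam - mu)) (idem mu)) * gtens 1 (t lam).

Definition gauge_equiv (J J' : twist) : Prop :=
  exists2 t, is_gauge t & forall lam, J' lam = gauge_transform t J lam.

End Twists.

(* A nonzero finite-dimensional space is k^n = 'cV_n with n > 0; matrices act *)
(* on the left of columns, so that `mx_representation k [set: gT] d' encodes  *)
(* a left k[gT]-module structure on 'cV_d.  Only the values pi g, g \in K, of *)
(* a map pi : gT -> 'M_n are ever used.  Tensor products are Kronecker        *)
(* products, and a dual space k^n is written in the dual basis.               *)

Section Representations.
Variables (k : fieldType) (gT : finGroupType).

Definition projective_rep (K : {group gT}) (n : nat) (pi : gT -> 'M[k]_n) :=
  [/\ (0 < n)%N, forall g, g \in K -> pi g \in unitmx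
    & exists2 c : gT -> gT -> k,
        forall g h, g \in K -> h \in K -> c g h != 0
      & forall g h, g \in K -> h \in K ->
          pi g *m pi h = c g h *: pi (g * h)%g].

Definition linear_rep (K : {group gT}) (n : nat) (pi : gT -> 'M[k]_n) :=
  forall g h, g \in K -> h \in K -> pi g *m pi h = pi (g * h)%g.

Definition irreducible_rep (K : {group gT}) (n : nat) (pi : gT -> 'M[k]_n) :=
  (<<[seq pi g | g in K]>> = fullv :> {vspace 'M[k]_n})%VS.

Definition tens_rep m n (pi : gT -> 'M[k]_m) (pi' : gT -> 'M[k]_n) :
  gT -> 'M[k]_(m * n) := fun g => tensmx (pi g) (pi' g).

Definition dual_rep n (pi : gT -> 'M[k]_n) : gT -> 'M[k]_n :=
  fun g => (invmx (pi g))^T.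

(* Ind_K W = {F : gT -> k^n | F (g x) = W(x)^-1 F(g) for x \in K}, with gT    *)
(* acting by left translation.  The tensor 1 (x) w of k[gT] (x)_k[K] W is the *)
(* function ind_gen, supported on K.                                          *)
Definition in_Ind (K : {group gT}) n (W : gT -> 'M[k]_n)
    (F : {ffun gT -> 'cV[k]_n}) :=
  forall g x, x \in K -> F (g * x)%g = W x^-1%g *m F g.

Definition translate (V : Type) (h : gT) (F : {ffun gT -> V}) : {ffun gT -> V} :=
  [ffun g => F (h^-1 * g)%g].

Definition ind_gen (K : {group gT}) n (W : gT -> 'M[k]_n) (w : 'cV[k]_n) :
    {ffun gT -> 'cV[k]_n} :=
  [ffun g => if g \in K then W g^-1%g *m w else 0].

(* The map Ind_K W -> X, g (x) w |-> g (h w), attached by Frobenius           *)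
(* reciprocity to h : W -> X; F is |K|^-1 times the sum of the g (x) F(g).    *)
Definition ind_ext (K : {group gT}) n d (X : gT -> 'M[k]_d)
    (h : 'cV[k]_n -> 'cV[k]_d) (F : {ffun gT -> 'cV[k]_n}) : 'cV[k]_d :=
  (#|K|%:R : k)^-1 *: \sum_g X g *m h (F g).

(* E restricts to an isomorphism of gT-modules Ind_K W -> Ind_K' W'.          *)
Definition Ind_iso (K K' : {group gT}) n n' (W : gT -> 'M[k]_n)
    (W' : gT -> 'M[k]_n')
    (E : 'Hom({ffun gT -> 'cV[k]_n}, {ffun gT -> 'cV[k]_n'})) :=
  [/\ forall F, in_Ind K W F -> in_Ind K' W' (E F),
      forall F, in_Ind K W F -> E F = 0 -> F = 0,
      forall F', in_Ind K' W' F' -> exists2 F, in_Ind K W F & E F = F'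
    & forall h F, in_Ind K W F -> E (translate h F) = translate h (E F)].

End Representations.

Section Data.
Variables (k : closedFieldType) (gT : finGroupType) (A : {group gT}).

Notation dualA := (dual k A).

Definition dual_mx (mu : dualA) : gT -> 'M[k]_1 := fun a => (mu a)%:M.

Record datum := Datum {
  stab : {group gT};
  vdim : dualA -> nat;
  rep : forall lam : dualA, gT -> 'M[k]_(vdim lam);
  _ : forall lam, projective_rep stab (rep lam);
  _ : forall lam, irreducible_rep stab (rep lam);
  _ : forall lam mu,
      linear_rep stab (tens_rep (rep (lam - mu)) (dual_rep (rep lam)));
  _ : forall lam mu, exists E,
      Ind_iso stab A (tens_rep (rep lam) (dual_rep (rep (lam - mu))))
        (dual_mx mu) E
}.

(* K :^ g^-1 is g K g^-1.                                                     *)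
Definition datum_iso (d d' : datum) : Prop :=
  exists (g : gT) (phi : forall lam : dualA, 'M[k]_(vdim d' lam, vdim d lam))
         (alpha : gT -> k),
  [/\ stab d' = stab d :^ g^-1%g :> {set gT},
      forall x, x \in stab d -> alpha x != 0,
      forall lam, exists2 psi : 'M[k]_(vdim d lam, vdim d' lam),
        psi *m phi lam = 1%:M & phi lam *m psi = 1%:M
    & forall lam x, x \in stab d ->
        rep d' lam (g * x * g^-1)%g *m phi lam
        = alpha x *: (phi lam *m rep d lam x)].

End Data.

Section FromTwist.
Variables (k : closedFieldType) (gT : finGroupType) (A : {group gT}).
Variable (J : twist k A).

Notation dualA := (dual k A).
Notation fn := {ffun gT -> k^o}.

Definition in_F (mu : dualA) (f : fn) :=
  forall h a, a \in A -> f (h * a)%g = mu a * f h.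

(* (f1 (x) f2)((g (x) g) J(lam)): the product of B_lam when f1, f2 \in F_0,   *)
(* and the left action of B_(lam - mu) (resp. right action of B_lam) on F_mu  *)
(* when f1 \in F_0, f2 \in F_mu (resp. f1 \in F_mu, f2 \in F_0).              *)
Definition star (lam : dualA) (f1 f2 : fn) : fn :=
  [ffun g => gev (fun p => f1 p.1 * f2 p.2) (gel k (g, g) * J lam)].

Definition two_sided_ideal (lam : dualA) (I : {vspace fn}) :=
  (forall f, f \in I -> in_F 0 f) /\
  (forall b f, in_F 0 b -> f \in I -> star lam b f \in I /\ star lam f b \in I).

Definition minimal_ideal (lam : dualA) (I : {vspace fn}) :=
  [/\ two_sided_ideal lam I, I <> 0%VS
    & forall I', two_sided_ideal lam I' -> (I' <= I)%VS -> I' <> 0%VS -> I' = I].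

(* Membership in the product I F_(mu - lam) I', where F_(mu - lam) is viewed  *)
(* as a B_lam-B_mu bimodule.                                                  *)
Definition in_IFI (lam mu : dualA) (I I' : {vspace fn}) (f : fn) :=
  exists2 s : seq (fn * fn * fn),
    forall t, t \in s -> [/\ t.1.1 \in I, in_F (mu - lam) t.1.2 & t.2 \in I']
  & f = \sum_(t <- s) star mu (star mu t.1.1 t.1.2) t.2.

(* An element i of the common G-set of minimal ideals: its incarnations I lam *)
(* in B_lam correspond to each other under the identifications.               *)
Definition ideal_family (I : dualA -> {vspace fn}) :=
  (forall lam, minimal_ideal lam (I lam)) /\
  (forall lam mu, exists2 f, in_IFI lam mu (I lam) (I mu) f & f <> 0).

Definition stabilizes (g : gT) (I : {vspace fn}) :=
  forall f, (translate g f \in I) = (f \in I).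

(* rho makes k^n a simple (unital) left module over the ideal I of B_lam.     *)
Definition simple_module (lam : dualA) (I : {vspace fn}) n
    (rho : 'Hom(fn, 'M[k]_n)) :=
  [/\ (0 < n)%N,
      {in I &, forall f f', rho (star lam f f') = rho f *m rho f'},
      exists e, [/\ e \in I,
        {in I, forall f, star lam e f = f /\ star lam f e = f} & rho e = 1%:M]
    & forall U : {vspace 'cV[k]_n},
        (forall f u, f \in I -> u \in U -> rho f *m u \in U) ->
        U = 0%VS \/ U = fullv].

(* theta restricts to a K-equivariant isomorphism of I-I' bimodules           *)
(* I F_(mu - lam) I' -> V (x) V'^*.                                           *)
Definition equivariant_bimodule_iso (K : {group gT}) (lam mu : dualA)
    (I I' : {vspace fn}) n n'
    (rho : 'Hom(fn, 'M[k]_n)) (rho' : 'Hom(fn, 'M[k]_n'))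
    (pi : gT -> 'M[k]_n) (pi' : gT -> 'M[k]_n')
    (theta : 'Hom(fn, 'cV[k]_(n * n'))) :=
  [/\ forall f, in_IFI lam mu I I' f -> theta f = 0 -> f = 0,
      forall v, exists2 f, in_IFI lam mu I I' f & theta f = v,
      forall b f, b \in I -> in_IFI lam mu I I' f ->
        theta (star mu b f) = tensmx (rho b) 1%:M *m theta f,
      forall f b, in_IFI lam mu I I' f -> b \in I' ->
        theta (star mu f b) = tensmx 1%:M (rho' b)^T *m theta f
    & forall g f, g \in K -> in_IFI lam mu I I' f ->
        theta (translate g f) = tens_rep pi (dual_rep pi') g *m theta f].

Definition associated_datum (d : datum k A) : Prop :=
  exists (I : dualA -> {vspace fn})
         (rho : forall lam : dualA, 'Hom(fn, 'M[k]_(vdim d lam))),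
  [/\ ideal_family I,
      forall g, g \in stab d <-> forall lam, stabilizes g (I lam),
      forall lam, simple_module lam (I lam) (rho lam),
      forall lam g f, g \in stab d -> f \in I lam ->
        rho lam (translate g f)
        = rep d lam g *m rho lam f *m invmx (rep d lam g)
    & forall lam mu, exists theta,
        equivariant_bimodule_iso (stab d) lam mu (I lam) (I mu)
          (rho lam) (rho mu) (rep d lam) (rep d mu) theta].

End FromTwist.

Section FromDatum.
Variables (k : closedFieldType) (gT : finGroupType) (A : {group gT}).
Variable (d : datum k A).

Notation dualA := (dual k A).
Notation V := (rep d).

Definition ind_hom (lam mu : dualA) :=
  'Hom({ffun gT -> 'cV[k]_(vdim d lam * vdim d (lam - mu))},
       {ffun gT -> 'cV[k]_1}).

Variable eps : forall lam mu : dualA, ind_hom lam mu.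

Definition in_weight n (X : gT -> 'M[k]_n) (mu : dualA) (x : 'cV[k]_n) :=
  forall a, a \in A -> X a *m x = mu a *: x.

(* The K-morphism V_lam (x) V_(lam - mu)^* -> X attached to x \in X[mu]:      *)
(* restrict to 1 (x) w the composite of eps lam mu with the morphism          *)
(* Ind_A mu -> X sending the generator to x.                                  *)
Definition hom_of_weight (lam mu : dualA) n (X : gT -> 'M[k]_n) (x : 'cV[k]_n)
    (w : 'cV[k]_(vdim d lam * vdim d (lam - mu))) : 'cV[k]_n :=
  ind_ext A X (fun c : 'cV[k]_1 => c 0 0 *: x)
    (eps lam mu (ind_gen (stab d) (tens_rep (V lam) (dual_rep (V (lam - mu)))) w)).

(* Psi(lam, x) : V_lam -> V_(lam - mu) (x) X intertwines the actions of the   *)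
(* elements of K, equivalently those of the central extension of K defined by *)
(* the common cocycle, whose kernel acts on both sides by the same scalars:   *)
(* v |-> \sum_j e_j (x) h(v (x) e_j^* ), with h = hom_of_weight lam mu X x.   *)
Definition Psi (lam mu : dualA) n (X : gT -> 'M[k]_n) (x : 'cV[k]_n) :
    'M[k]_(vdim d (lam - mu) * n, vdim d lam) :=
  \matrix_(r, i)
    @hom_of_weight lam mu n X x
      (tensmx (delta_mx i 0 : 'cV[k]_(vdim d lam))
              (delta_mx (mxtens_unindex r).1 0 : 'cV[k]_(vdim d (lam - mu))))
      (mxtens_unindex r).2 0.

Lemma vdim_tens0 (lam : dualA) : (vdim d (lam - 0)%R * 1)%N = vdim d lam.
Proof. by rewrite subr0 muln1. Qed.

Lemma vdim_tensA (lam mu nu : dualA) p q :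
  (vdim d (lam - (mu + nu))%R * (p * q))%N
  = (vdim d (lam - mu - nu)%R * p * q)%N.
Proof. by rewrite opprD addrA mulnA. Qed.

(* The operator by which an element of k[gT x gT] acts on Y (x) X.            *)
Definition act2 p q (Y : gT -> 'M[k]_p) (X : gT -> 'M[k]_q)
    (u : galg k [the finGroupType of (gT * gT)%type]) : 'M[k]_(p * q) :=
  \sum_h gcoef u h *: tensmx (Y h.1) (X h.2).

(* mxtens_index (i, j) has value i * n + j, so the casts below preserve the   *)
(* standard bases: they identify V_(lam - 0) (x) k with V_lam, and            *)
(* V_(lam - (mu + nu)) (x) (Y (x) X) with (V_(lam - mu - nu) (x) Y) (x) X.    *)
Definition normalized :=
  forall lam : dualA,
    castmx (vdim_tens0 lam, erefl) (Psi lam 0 (fun=> 1%:M) (1%:M : 'cV[k]_1))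
    = 1%:M.

Definition exchange_equation (J : dualA -> galg k [the finGroupType of (gT * gT)%type]) :=
  forall p q (Y : mx_representation k [set: gT] p)
    (X : mx_representation k [set: gT] q) (lam mu nu : dualA)
    (x : 'cV[k]_q) (y : 'cV[k]_p),
  in_weight X mu x -> in_weight Y nu y ->
    tensmx (Psi (lam - mu) nu Y y) (1%:M : 'M[k]_q) *m Psi lam mu X x
    = castmx (vdim_tensA lam mu nu p q, erefl)
        (Psi lam (mu + nu) (tens_rep Y X) (act2 Y X (J lam) *m tensmx y x)).

End FromDatum.

Definition exchange_twist (k : closedFieldType) (gT : finGroupType)
    (A : {group gT}) (d : datum k A) (J : twist k A) : Prop :=
  exists eps : forall lam mu : dual k A, ind_hom d lam mu,
  [/\ forall lam mu,
        Ind_iso (stab d) A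
          (tens_rep (rep d lam) (dual_rep (rep d (lam - mu)))) (dual_mx mu)
          (eps lam mu),
      normalized eps
    & exchange_equation eps J].

Definition eq_classes (T : Type) (R : T -> T -> Prop) :=
  {C : T -> Prop | exists x, C = R x}.

Definition class_of (T : Type) (R : T -> T -> Prop) (x : T) : eq_classes R :=
  exist _ (R x) (ex_intro _ x erefl).

Definition twist_classes (k : closedFieldType) (gT : finGroupType)
  (A : {group gT}) := eq_classes (@gauge_equiv k gT A).

Definition datum_classes (k : closedFieldType) (gT : finGroupType)
  (A : {group gT}) := eq_classes (@datum_iso k gT A).

(* Main.v *)
Require Import Defs.
From HB Require Import structures.
From mathcomp Require Import all_boot all_order all_algebra all_fingroup.
From mathcomp Require Import all_solvable all_field mxrepresentation.
From mathcomp.real_closed Require Import mxtens.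
From mathcomp Require Import boolp ring.

Set Implicit Arguments.
Unset Strict Implicit.
Unset Printing Implicit Defensive.

Import GroupScope GRing.Theory.
Local Open Scope ring_scope.

(* The functions F_(mu - lam)[G] form, with the products J(mu), a category with
   objects A^* on which G acts; the spaces Hom(V_mu, V_lam) of a dynamical datum
   form another one, on which K acts by conjugation.  Both constructions say that
   there is a K-equivariant functor T from the first category to the second such
   that f |-> (g |-> T(g^-1 f)) identifies F_(mu - lam)[G] with the functions
   induced from Hom(V_mu, V_lam).  In construction T it is the transpose of the
   isomorphisms epsilon; in construction D it is the projection to the component i.
   Two functors with the same datum differ by right translations by t(lam) in k[G],
   a gauge transformation; two functors with the same twist differ by translation
   by an element of G followed by conjugation, by a Skolem-Noether argument.
   Given the datum, the isomorphisms of induced representations yield T, and J is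
   the transported composition; it is invertible since the V_mu are pairwise
   projectively non-isomorphic.  Given J, a minimal graded module over the category
   of the F_(mu - lam)[G] yields T, and K is the stabilizer of its kernel. *)

(** * Right translations and characters *)

(** Neither composite of D and T is computed. Both constructions are shown to define the same
    relation [realizable J d]; the two maps are then mutually inverse because this relation is total
    on both sides and its fibres are exactly the gauge classes and the isomorphism classes. Elements
    of the group algebras are handled through their faithful action on functions by right
    translations. Zero weight becomes compatibility with the grading, the twist equation becomes
    associativity (the shift of lam being the weight of the right factor), and the counit conditions
    make the constant function 1 a unit. Invertibility of J has no such translation. Starting from a
    datum it is a conclusion, drawn from orthogonality of matrix coefficients; starting from a twist
    it is what makes the functor faithful, since it forces every nonzero graded left ideal stable
    under G to contain 1. A datum only asserts that some isomorphism of induced modules exists, so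
    bijectivity of the maps in use comes from injectivity and a comparison of dimensions. *)

Section RightAction.
Variables (k : fieldType) (H : finGroupType).
Implicit Types (u v : galg k H) (f : H -> k) (g h : H).

(** The linear extension of f evaluated at gu. Functions on H thus form a faithful left k[H]-module,
    in which identities of k[H] are tested. *)
Definition ract u f g : k := \sum_x gcoef u x * f (g * x)%g.

Lemma gcoefM u v g : gcoef (u * v) g = \sum_h gcoef u h * gcoef v (h^-1 * g)%g.
Proof. by rewrite -[u * v]/(gmul u v) gcoefE. Qed.

Lemma gcoef0 g : gcoef (0 : galg k H) g = 0.
Proof. by rewrite /gcoef ffunE. Qed.

Lemma gcoef_sum I r (P : pred I) (F : I -> galg k H) g :
  gcoef (\sum_(i <- r | P i) F i) g = \sum_(i <- r | P i) gcoef (F i) g.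
Proof. by elim/big_rec2: _ => [|i y x _ <-]; rewrite ?gcoef0 ?gcoefD. Qed.

Lemma eq_ract u f f' : f =1 f' -> ract u f =1 ract u f'.
Proof. by move=> e g; apply: eq_bigr => x _; rewrite e. Qed.

Lemma ractM u v f g : ract (u * v) f g = ract u (ract v f) g.
Proof.
rewrite /ract; under eq_bigr => x _ do rewrite gcoefM mulr_suml.
rewrite exchange_big /=; apply: eq_bigr => y _.
rewrite (reindex_inj (mulgI y)) /= mulr_sumr; apply: eq_bigr => x _.
by rewrite mulKg mulrA mulgA.
Qed.

Lemma ract_gel h f g : ract (gel k h) f g = f (g * h)%g.
Proof.
rewrite /ract (bigD1 h) //= gcoefE eqxx mul1r big1 ?addr0 // => x /negPf nx.
by rewrite gcoefE nx mul0r.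
Qed.

Lemma ract1 f g : ract 1 f g = f g.
Proof. by rewrite -[1]/(gel k 1%g) ract_gel mulg1. Qed.

Lemma ractZ c u f g : ract (c *: u) f g = c * ract u f g.
Proof. by rewrite /ract mulr_sumr; apply: eq_bigr => x _; rewrite gcoefZ mulrA. Qed.

Lemma ract_sum I r (P : pred I) (F : I -> galg k H) f g :
  ract (\sum_(i <- r | P i) F i) f g = \sum_(i <- r | P i) ract (F i) f g.
Proof.
rewrite exchange_big; apply: eq_bigr => x _.
by rewrite gcoef_sum mulr_suml.
Qed.

Lemma ract_sumr I r (P : pred I) u (F : I -> H -> k) g :
  ract u (fun x => \sum_(i <- r | P i) F i x) g
  = \sum_(i <- r | P i) ract u (F i) g.
Proof.
rewrite exchange_big; apply: eq_bigr => x _.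
by rewrite mulr_sumr.
Qed.

Lemma ractZr c u f g : ract u (fun x => c * f x) g = c * ract u f g.
Proof. by rewrite /ract mulr_sumr; apply: eq_bigr => x _; rewrite mulrCA. Qed.

Lemma ract_delta u h g : ract u (fun x => (x == h)%:R) g = gcoef u (g^-1 * h)%g.
Proof.
rewrite /ract (bigD1 (g^-1 * h)%g) //= mulKVg eqxx mulr1 big1 ?addr0 // => x nx.
by rewrite -(inj_eq (mulgI g^-1%g)) mulKg (negPf nx) mulr0.
Qed.

Lemma ract_inj u v :
  (forall h, ract u (fun x => (x == h)%:R) 1%g = ract v (fun x => (x == h)%:R) 1%g)
  -> u = v.
Proof. by move=> e; apply/galgP=> h; have := e h; rewrite !ract_delta invg1 mul1g. Qed.

Lemma gev_gelM f g u : gev f (gel k g * u) = ract u f g.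
Proof.
rewrite /gev (reindex_inj (mulgI g)); apply: eq_bigr => x _ /=; congr (_ * _).
rewrite gcoefM (bigD1 g) //= gcoefE eqxx mul1r mulKg big1 ?addr0 // => y /negPf ny.
by rewrite gcoefE ny mul0r.
Qed.

Lemma gev_ract f u : gev f u = ract u f 1%g.
Proof. by apply: eq_bigr => x _; rewrite mul1g. Qed.

Lemma gelM g h : gel k (g * h)%g = gel k g * gel k h.
Proof.
by apply: ract_inj => x; rewrite ractM !ract_gel mulgA.
Qed.

(** In finite dimension an injective left multiplication is onto, so uw = 1 for some w; then u(wu -
    1) = 0 gives wu = 1. *)
Lemma galg_unit u : (forall w, u * w = 0 -> w = 0) -> u \is a GRing.unit.
Proof.
move=> inj; have k0 : lker (amull u) == 0%VS.
  apply/eqP/vspaceP=> w; rewrite memv_ker memv0 lfunE /=.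
  by apply/eqP/eqP=> [/inj|->]; rewrite ?mulr0.
have [w uw] : exists w, u * w = 1.
  exists ((amull u)^-1%VF 1); have := lker0_lfunVK k0 1.
  by rewrite lfunE.
apply/unitrP; exists w; split=> //.
by apply/eqP; rewrite -subr_eq0; apply/eqP/inj; rewrite mulrBr mulrA uw mulr1 mul1r subrr.
Qed.

End RightAction.

Section MapTensor.
Variables (k : fieldType) (H H' : finGroupType).

Lemma ract_gmap (phi : H -> H') (u : galg k H) (f : H' -> k) g :
  ract (gmap phi u) f g = \sum_x gcoef u x * f (g * phi x)%g.
Proof.
by rewrite ract_sum; apply: eq_bigr => x _; rewrite ractZ ract_gel.
Qed.

Lemma ract_gtens (u : galg k H) (v : galg k H') f g g' :
  ract (gtens u v) f (g, g')
  = ract u (fun x => ract v (fun y => f (x, y)) g') g.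
Proof.
rewrite /ract; under [RHS]eq_bigr => x _ do rewrite mulr_sumr.
rewrite pair_bigA; apply: eq_bigr => -[x y] _ /=.
by rewrite gcoefE /= mulrA.
Qed.

End MapTensor.

Section Characters.
Variables (k : closedFieldType) (gT : finGroupType) (A : {group gT}).
Hypotheses (char0 : [pchar k] =i pred0) (abelA : abelian A).

Notation dualA := (dual k A).
Notation kG := (galg k gT).
Implicit Types (m n : dualA) (a b g h : gT).

Lemma natf0 (i : nat) : (i%:R == 0 :> k) = (i == 0)%N.
Proof. exact: (pcharf0P k).1. Qed.

Lemma cardG_neq0 (K : {group gT}) : #|K|%:R != 0 :> k.
Proof. by rewrite natf0 -lt0n cardG_gt0. Qed.

Lemma dual1 m : m 1%g = 1.
Proof. by case: (dualE m). Qed.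

Lemma dualM m : {in A &, {morph m : a b / (a * b)%g >-> a * b}}.
Proof. by case: (dualE m). Qed.

Lemma dual_out m g : g \notin A -> m g = 0.
Proof. by case: (dualE m) => _ _; apply. Qed.

Lemma dual_neq0 m a : a \in A -> m a != 0.
Proof.
move=> Aa; apply: contra_eq_neq (dual_expr m Aa) => ->.
by rewrite expr0n gtn_eqF ?cardG_gt0 // eq_sym oner_neq0.
Qed.

Lemma dualV m a : a \in A -> m a^-1%g = (m a)^-1.
Proof.
move=> Aa; apply: (mulfI (dual_neq0 m Aa)).
by rewrite -dualM ?groupV // mulgV dual1 divff // dual_neq0.
Qed.

Lemma dual_add m n a : (m + n) a = m a * n a.
Proof. by rewrite -[m + n]/(dualD m n) ffunE. Qed.

Lemma dual_opp m a : (- m) a = (m a)^-1.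
Proof. by rewrite -[- m]/(dualN m) ffunE. Qed.

Lemma dual_zero a : (0 : dualA) a = (a \in A)%:R.
Proof. by rewrite -[0]/(dual0 k A) ffunE. Qed.

Lemma dual_eqP m n : {in A, m =1 n} -> m = n.
Proof.
move=> e; apply/val_inj/ffunP=> g; case: (boolP (g \in A)) => Ag; first exact: e.
by rewrite !dual_out.
Qed.

Lemma dual_sum m : m != 0 -> \sum_(a in A) m a = 0.
Proof.
move=> nz; have [b Ab nb] : exists2 b, b \in A & m b != 1.
  case: (pickP [pred b in A | m b != 1]) => [b /andP[Ab nb]|e]; first by exists b.
  case/eqP: nz; apply: dual_eqP => a Aa; rewrite dual_zero Aa.
  by apply/eqP; move/(_ a): e; rewrite /= Aa /= => /negbFE.
have: m b * (\sum_(a in A) m a) = \sum_(a in A) m a.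
  rewrite [RHS](reindex_inj (mulgI b)) mulr_sumr /=.
  by apply: eq_big => [a|a Aa]; rewrite ?groupMl // dualM.
move/eqP; rewrite -subr_eq0 -[X in _ - X]mul1r -mulrBl mulf_eq0 subr_eq0.
by rewrite (negPf nb) /= => /eqP.
Qed.

Lemma ract_idem m f g :
  ract (idem m) f g = (#|A|%:R)^-1 * \sum_(a in A) (m a)^-1 * f (g * a)%g.
Proof.
by rewrite ractZ ract_sum; congr (_ * _); apply: eq_bigr => a _; rewrite ractZ ract_gel.
Qed.

Lemma gel_idem m a : a \in A -> gel k a * idem m = m a *: idem m.
Proof.
move=> Aa; rewrite -scalerAr mulr_sumr scalerA mulrC -scalerA; congr (_ *: _).
rewrite [in RHS](reindex_inj (mulgI a)) scaler_sumr /=.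
apply: eq_big => [b|b Ab]; rewrite ?groupMl //.
by rewrite -scalerAr -gelM scalerA dualM // invfM mulVKf // dual_neq0.
Qed.

Lemma idem_orth m n : m != n -> idem m * idem n = 0 :> kG.
Proof.
move=> mn; rewrite -scalerAl mulr_suml.
under eq_bigr => a Aa do rewrite -scalerAl (gel_idem _ Aa) scalerA mulrC.
rewrite -scaler_suml (eq_bigr (n - m)) ?dual_sum ?scale0r ?scaler0 //.
  by rewrite subr_eq0 eq_sym.
by move=> a _; rewrite dual_add dual_opp.
Qed.

Lemma idem_eigen m (h : kG) :
  (forall a, a \in A -> gel k a * h = m a *: h) -> idem m * h = h.
Proof.
move=> e; rewrite -scalerAl mulr_suml (eq_bigr (fun=> h)) => [|a Aa].
  by rewrite sumr_const -scaler_nat scalerA mulVf ?scale1r // cardG_neq0.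
by rewrite -scalerAl e // scalerA mulVf ?scale1r // dual_neq0.
Qed.

(** The element a is a root of the split polynomial X^#|A| - 1. Applying its linear factors to h one
    by one, the last nonzero vector is an eigenvector. The predicate P, stable under the factors,
    allows the eigenvector to keep properties obtained for other elements of A. *)
Lemma gel_eigen a (P : kG -> Prop) (h : kG) : a \in A -> P h -> h != 0 ->
  (forall u z, P u -> P (gel k a * u - z *: u)) ->
  exists z u, [/\ P u, u != 0 & gel k a * u = z *: u].
Proof.
move=> Aa Ph nh stP.
have [r Dr] : exists r : seq k, 'X^#|A| - 1 = \prod_(z <- r) ('X - z%:P).
  case: (closed_field_poly_normal ('X^#|A| - 1 : {poly k})) => r Dr; exists r.
  by rewrite {1}Dr (monicP _) ?scale1r // monicXnsubC // cardG_gt0.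
have: (\prod_(z <- r) (gel k a - z%:A)) * h = 0.
  have -> : \prod_(z <- r) (gel k a - z%:A) = horner_alg (gel k a) ('X^#|A| - 1).
    rewrite Dr rmorph_prod; apply: eq_bigr => z _.
    by rewrite rmorphB /= horner_algX horner_algC.
  rewrite rmorphB rmorphXn rmorph1 /= horner_algX.
  suff -> : gel k a ^+ #|A| = 1 by rewrite subrr mul0r.
  have X i : gel k a ^+ i = gel k (a ^+ i)%g.
    by elim: i => // i IH; rewrite exprS expgS gelM IH.
  by rewrite X expg_cardG.
elim: r {Dr} => [|z r IH]; first by rewrite big_nil mul1r => /eqP; rewrite (negPf nh).
rewrite big_cons -mulrA; set u := _ * h => e.
have Pu : P u.
  rewrite /u; elim: {IH e u} r => [|y r IH]; first by rewrite big_nil mul1r.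
  by rewrite big_cons -mulrA mulrBl -scalerAl mul1r; apply: stP.
case: (eqVneq u 0) => [/IH//|nu]; exists z, u; split=> //.
by apply/eqP; rewrite -subr_eq0 -{2}[u]mul1r scalerAl -mulrBl e.
Qed.

(* A common eigenvector of A in the complement of all the isotypic parts would
   belong to one of them. *)
Lemma sum_idem : \sum_(m : dualA) idem m = 1.
Proof.
apply/eqP; rewrite eq_sym -subr_eq0; apply/negPn/negP=> nz.
pose P (s : seq gT) (u : kG) := (forall m : dualA, idem m * u = 0) /\
  forall a, a \in s -> exists z, gel k a * u = z *: u.
have idC a m : a \in A -> idem m * gel k a = gel k a * idem m.
  move=> Aa; rewrite -scalerAl -scalerAr mulr_suml mulr_sumr; congr (_ *: _).
  apply: eq_bigr => b Ab; rewrite -scalerAl -scalerAr -!gelM.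
  by rewrite (centsP abelA _ Ab _ Aa).
have idm m : idem m * idem m = idem m.
  by apply: idem_eigen => a Aa; apply: gel_idem.
have [u [[u0 eu] nu]] : exists u, P (enum A) u /\ u != 0.
  have: {subset enum A <= A} by move=> a; rewrite mem_enum.
  elim: (enum A) => [_|a s IH sA].
    exists (1 - \sum_(m : dualA) idem m); split=> //; split=> // m.
    rewrite mulrBr mulr1 mulr_sumr (bigD1 m) //= idm big1 ?addr0 ?subrr //.
    by move=> n nm; rewrite idem_orth // eq_sym.
  have Aa : a \in A by apply: sA; rewrite mem_head.
  have [|u [Pu nu]] := IH; first by move=> b sb; apply: sA; rewrite inE sb orbT.
  have [|z [w [[w0 ew] nw e]]] := gel_eigen (P := P s) Aa Pu nu; last first.
    exists w; split=> //; split=> // b; rewrite inE => /predU1P[->|/ew//].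
    by exists z.
  move=> {u Pu nu} u z [u0 eu]; split=> [m|b sb].
    by rewrite mulrBr mulrA idC // -mulrA -scalerAr u0 mulr0 scaler0 subr0.
  have [y ey] := eu b sb; exists y.
  have Ab : b \in A by apply: sA; rewrite inE sb orbT.
  rewrite mulrBr -scalerAr mulrA -gelM (centsP abelA _ Ab _ Aa) gelM -mulrA ey.
  by rewrite -scalerAr scalerBr !scalerA mulrC.
have /choice[z ez] a : exists z, a \in A -> gel k a * u = z *: u.
  case: (boolP (a \in A)) => [Aa|_]; last by exists 0.
  by have [|z] := eu a; rewrite ?mem_enum //; exists z.
have dz : is_dual A [ffun a => if a \in A then z a else 0].
  have zi x y : x *: u = y *: u -> x = y.
    by move/eqP; rewrite -subr_eq0 -scalerBl scaler_eq0 (negPf nu) orbF subr_eq0 => /eqP.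
  apply/is_dualP; split=> [|a b Aa Ab|g nAg]; rewrite !ffunE ?group1.
  - by apply: zi; rewrite -ez ?group1 // -[gel k 1%g]/(1 : kG) mul1r scale1r.
  - rewrite groupM // Aa Ab; apply: zi.
    by rewrite -ez ?groupM // gelM -mulrA (ez b) // -scalerAr (ez a) // scalerA mulrC.
  - by rewrite (negPf nAg).
case/eqP: nu; rewrite -(u0 (Dual dz)) idem_eigen // => a Aa.
by rewrite ez //= ffunE Aa.
Qed.

End Characters.

(** * The products on functions defined by a twist *)

Section Functions.
Variables (k : closedFieldType) (gT : finGroupType).

Notation fn := {ffun gT -> k^o}.
Notation kGG := (galg k [the finGroupType of (gT * gT)%type]).
Implicit Types (f h : fn) (g x y : gT) (u : kGG).

Lemma fnZ (c : k) f g : (c *: f) g = c * (f g : k) :> k. Proof. by rewrite ffunE. Qed.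

Lemma fnD f h g : (f + h) g = (f g : k) + (h g : k) :> k. Proof. by rewrite ffunE. Qed.

Lemma fn0 g : (0 : fn) g = 0 :> k. Proof. by rewrite ffunE. Qed.

Lemma fn_sum I r (P : pred I) (F : I -> fn) g :
  (\sum_(i <- r | P i) F i) g = \sum_(i <- r | P i) (F i g : k) :> k.
Proof. by rewrite sum_ffunE. Qed.

Definition delta g : fn := [ffun x => (x == g)%:R].
Definition cst1 : fn := [ffun=> 1].

Lemma fn_delta f : f = \sum_g f g *: delta g.
Proof.
apply/ffunP=> x; rewrite fn_sum (bigD1 x) //= fnZ ffunE eqxx mulr1 big1 ?addr0 //.
by move=> y /negPf nxy; rewrite fnZ ffunE eq_sym nxy mulr0.
Qed.

Lemma translateE (V : Type) x (f : {ffun gT -> V}) g :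
  translate x f g = f (x^-1 * g)%g.
Proof. by rewrite ffunE. Qed.

Lemma translateM (V : Type) x y (f : {ffun gT -> V}) :
  translate (x * y)%g f = translate x (translate y f).
Proof. by apply/ffunP=> g; rewrite !translateE invMg mulgA. Qed.

Lemma translate1 (V : Type) (f : {ffun gT -> V}) : translate 1%g f = f.
Proof. by apply/ffunP=> g; rewrite translateE invg1 mul1g. Qed.

Lemma translateK (V : Type) x : cancel (@translate gT V x) (translate x^-1%g).
Proof. by move=> f; rewrite -translateM mulVg translate1. Qed.

Lemma translateKV (V : Type) x : cancel (@translate gT V x^-1%g) (translate x).
Proof. by move=> f; rewrite -translateM mulgV translate1. Qed.

Lemma translate_linear (V : lmodType k) x (c : k) (f f' : {ffun gT -> V}) :
  translate x (c *: f + f') = c *: translate x f + translate x f'.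
Proof. by apply/ffunP=> g; rewrite !ffunE. Qed.

Lemma translateD (V : lmodType k) x (f f' : {ffun gT -> V}) :
  translate x (f + f') = translate x f + translate x f'.
Proof. by apply/ffunP=> g; rewrite !ffunE. Qed.

Lemma translateZ (V : lmodType k) x (c : k) (f : {ffun gT -> V}) :
  translate x (c *: f) = c *: translate x f.
Proof. by apply/ffunP=> g; rewrite !ffunE. Qed.

Lemma translate0 (V : lmodType k) x : translate x (0 : {ffun gT -> V}) = 0.
Proof. by apply/ffunP=> g; rewrite !ffunE. Qed.

Lemma translate_sum (V : lmodType k) x I r (P : pred I) (F : I -> {ffun gT -> V}) :
  translate x (\sum_(i <- r | P i) F i) = \sum_(i <- r | P i) translate x (F i).
Proof. by elim/big_rec2: _ => [|i y z _ <-]; rewrite ?translate0 ?translateD. Qed.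

Lemma translate_delta x g : translate x (delta g) = delta (x * g)%g.
Proof. by apply/ffunP=> y; rewrite !ffunE -(inj_eq (mulgI x)) mulKVg. Qed.

Lemma translate_cst1 x : translate x cst1 = cst1.
Proof. by apply/ffunP=> y; rewrite !ffunE. Qed.

(** The product [star] for an arbitrary element u and arbitrary functions; weights are brought in
    afterwards as properties of u. *)
Definition op u f h : fn :=
  [ffun g => ract u (fun p => (f p.1 : k) * (h p.2 : k)) (g, g)].

Lemma opE u f h g :
  op u f h g = \sum_p gcoef u p * ((f (g * p.1)%g : k) * (h (g * p.2)%g : k)).
Proof. by rewrite ffunE. Qed.

Lemma opDl u f f' h : op u (f + f') h = op u f h + op u f' h.
Proof.
apply/ffunP=> g; rewrite fnD !opE -big_split; apply: eq_bigr => p _ /=.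
by rewrite fnD mulrDl mulrDr.
Qed.

Lemma opDr u f h h' : op u f (h + h') = op u f h + op u f h'.
Proof.
apply/ffunP=> g; rewrite fnD !opE -big_split; apply: eq_bigr => p _ /=.
by rewrite fnD !mulrDr.
Qed.

Lemma opZl u c f h : op u (c *: f) h = c *: op u f h.
Proof.
apply/ffunP=> g; rewrite fnZ !opE mulr_sumr; apply: eq_bigr => p _ /=.
by rewrite fnZ -mulrA mulrCA.
Qed.

Lemma opZr u c f h : op u f (c *: h) = c *: op u f h.
Proof.
apply/ffunP=> g; rewrite fnZ !opE mulr_sumr; apply: eq_bigr => p _ /=.
by rewrite fnZ mulrCA [LHS]mulrCA [in RHS]mulrCA; congr (_ * _); rewrite mulrCA.
Qed.

Lemma op0l u h : op u 0 h = 0.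
Proof. by rewrite -[0 in LHS](scale0r (0 : fn)) opZl scale0r. Qed.

Lemma op0r u f : op u f 0 = 0.
Proof. by rewrite -[0 in LHS](scale0r (0 : fn)) opZr scale0r. Qed.

Lemma op_suml u I r (P : pred I) (F : I -> fn) h :
  op u (\sum_(i <- r | P i) F i) h = \sum_(i <- r | P i) op u (F i) h.
Proof. by elim/big_rec2: _ => [|i y z _ <-]; rewrite ?op0l ?opDl. Qed.

Lemma op_sumr u I r (P : pred I) f (F : I -> fn) :
  op u f (\sum_(i <- r | P i) F i) = \sum_(i <- r | P i) op u f (F i).
Proof. by elim/big_rec2: _ => [|i y z _ <-]; rewrite ?op0r ?opDr. Qed.

Lemma translate_op u x f h :
  translate x (op u f h) = op u (translate x f) (translate x h).
Proof.
apply/ffunP=> g; rewrite translateE !opE; apply: eq_bigr => p _.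
by rewrite !translateE !mulgA.
Qed.

Lemma op_delta u x y : op u (delta x) (delta y) 1%g = gcoef u (x, y).
Proof.
rewrite opE (bigD1 (x, y)) //= !ffunE !mul1g !eqxx !mulr1 big1 ?addr0 //.
by case=> a b; rewrite !ffunE !mul1g xpair_eqE /= -natrM mulnb => /negPf ->; rewrite mulr0.
Qed.

Lemma op_inj u v : (forall f h, op u f h = op v f h) -> u = v.
Proof. by move=> e; apply/galgP => -[x y]; rewrite -!op_delta e. Qed.

End Functions.

Arguments cst1 {k gT}.
Arguments delta {k gT} g.

Section Weights.
Variables (k : closedFieldType) (gT : finGroupType) (A : {group gT}).
Hypotheses (char0 : [pchar k] =i pred0) (abelA : abelian A).

Notation dualA := (dual k A).
Notation fn := {ffun gT -> k^o}.
Notation kGG := (galg k [the finGroupType of (gT * gT)%type]).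
Implicit Types (m n lam mu nu : dualA) (f h : fn) (g x y : gT).

(** The projection onto F_m[G] along the other weight spaces, that is, right translation by P_m. *)
Definition pr m f : fn := [ffun g => ract (idem m) f g].

Lemma prE m f g : pr m f g = (#|A|%:R)^-1 * \sum_(a in A) (m a)^-1 * (f (g * a)%g : k) :> k.
Proof. by rewrite ffunE ract_idem. Qed.

Lemma pr_in m f : in_F m (pr m f).
Proof.
move=> g a Aa; rewrite !ffunE.
have := ractM (gel k a) (idem m) f g; rewrite gel_idem // ractZ ract_gel => <-.
by [].
Qed.

Lemma prD m f h : pr m (f + h) = pr m f + pr m h.
Proof.
apply/ffunP=> g; rewrite fnD !ffunE -big_split; apply: eq_bigr => y _.
by rewrite fnD mulrDr.
Qed.

Lemma prZ m c f : pr m (c *: f) = c *: pr m f.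
Proof.
apply/ffunP=> g; rewrite fnZ !ffunE -ractZr.
by apply: eq_ract => y; rewrite fnZ.
Qed.

Lemma pr_id m f : in_F m f -> pr m f = f.
Proof.
move=> Ff; apply/ffunP=> g; rewrite prE (eq_bigr (fun=> f g)) => [|a Aa].
  by rewrite sumr_const -[f g *+ _]mulr_natl mulKf // cardG_neq0.
by rewrite Ff // mulKf // dual_neq0.
Qed.

Lemma pr_out m n f : in_F n f -> m != n -> pr m f = 0.
Proof.
move=> Ff mn; apply/ffunP=> g; rewrite prE fn0.
rewrite (eq_bigr (fun a => (f g : k) * (n - m) a)) => [|a Aa].
  by rewrite -mulr_sumr dual_sum ?mulr0 // subr_eq0 eq_sym.
by rewrite Ff // dual_add dual_opp mulrA [LHS]mulrC; congr (_ * _); rewrite mulrC.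
Qed.

Lemma pr_sum f : \sum_m pr m f = f.
Proof.
apply/ffunP=> g; rewrite fn_sum; under eq_bigr do rewrite ffunE.
by rewrite -ract_sum sum_idem // ract1.
Qed.

Lemma translate_pr x m f : translate x (pr m f) = pr m (translate x f).
Proof.
apply/ffunP=> g; rewrite translateE !prE; congr (_ * _).
by apply: eq_bigr => a _; rewrite translateE mulgA.
Qed.

Lemma in_FD m f h : in_F m f -> in_F m h -> in_F m (f + h).
Proof. by move=> Ff Fh g a Aa; rewrite !fnD Ff // Fh // mulrDr. Qed.

Lemma in_FZ m c f : in_F m f -> in_F m (c *: f).
Proof. by move=> Ff g a Aa; rewrite !fnZ Ff // mulrCA. Qed.

Lemma in_F0 m : in_F m (0 : fn).
Proof. by move=> g a Aa; rewrite !fn0 mulr0. Qed.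

Lemma in_F_sum m I r (P : pred I) (F : I -> fn) :
  (forall i, P i -> in_F m (F i)) -> in_F m (\sum_(i <- r | P i) F i).
Proof.
by move=> FF; elim/big_rec: _ => [|i y Pi]; [apply: in_F0 | apply/in_FD/FF].
Qed.

Lemma in_F_translate m x f : in_F m f -> in_F m (translate x f).
Proof. by move=> Ff g a Aa; rewrite !translateE mulgA Ff. Qed.

Lemma in_F_cst1 : in_F (0 : dualA) cst1.
Proof. by move=> g a Aa; rewrite !ffunE Aa mul1r. Qed.

Lemma in_F_inv f : (forall x, translate x f = f) -> forall g, f g = f 1%g.
Proof. by move=> e g; rewrite -[in RHS](e g^-1%g) translateE invgK mulg1. Qed.

Section OneElement.
Variable u : kGG.

(** Commuting with a ⊗ a means that the product commutes with right translation by a, which is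
    multiplication by m(a) on F_m; the F_m span all functions. *)
Lemma zero_weightP :
  zero_weight2 A u <-> forall m n f h, in_F m f -> in_F n h -> in_F (m + n) (op u f h).
Proof.
have zwE a : a \in A -> u * gel k (a, a) = gel k (a, a) * u <->
    forall f h g, op u f h (g * a)%g = op u [ffun g => f (g * a)%g] [ffun g => h (g * a)%g] g.
  move=> Aa; split=> [e f h g|e].
    rewrite !ffunE; have := congr1 (fun v => ract v (fun p => (f p.1 : k) * (h p.2 : k)) (g, g)) e.
    rewrite !ractM ract_gel => <-; apply: eq_ract => -[x y].
    by rewrite ract_gel !ffunE.
  apply/ract_inj => -[x y]; rewrite !ractM ract_gel.
  have := e (delta x) (delta y) 1%g; rewrite !ffunE => E.
  transitivity (ract u (fun p => (delta x p.1 : k) * (delta y p.2 : k)) ((1 : gT) * a, (1 : gT) * a)%g).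
    rewrite E; apply: eq_ract => -[p q].
    by rewrite ract_gel !ffunE /= -natrM mulnb.
  by apply: eq_ract => -[p q]; rewrite !ffunE /= -natrM mulnb.
split=> [zw m n f h Ff Fh g a Aa|wt a Aa].
  have [e _] := zwE a Aa; rewrite (e (zw a Aa)) dual_add -mulrA mulrCA mulrA.
  have -> : [ffun g => f (g * a)%g] = m a *: f by apply/ffunP=> y; rewrite ffunE fnZ Ff.
  have -> : [ffun g => h (g * a)%g] = n a *: h by apply/ffunP=> y; rewrite ffunE fnZ Fh.
  by rewrite opZl opZr !fnZ mulrA [n a * _]mulrC.
apply/zwE => // f h g; rewrite -[f]pr_sum -[h]pr_sum.
have rt (F : fn) : [ffun g => (\sum_m pr m F) (g * a)%g] = \sum_(m : dualA) m a *: pr m F :> fn.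
  apply/ffunP=> y; rewrite ffunE !fn_sum; apply: eq_bigr => m _.
  by rewrite fnZ pr_in.
rewrite !rt !op_suml !fn_sum; apply: eq_bigr => m _.
rewrite !op_sumr !fn_sum; apply: eq_bigr => n _.
by rewrite opZl opZr !fnZ (wt m n) ?dual_add -?mulrA //; apply: pr_in.
Qed.

(** Pairing a leg of u with the constant function 1 applies the counit to that leg. *)
Lemma op_counitl : gmap (fun p : gT * gT => p.2) u = 1 <-> forall h, op u cst1 h = h.
Proof.
split=> [e h|e]; last apply: ract_inj => x.
  apply/ffunP=> g; have := congr1 (fun v => ract v h g) e.
  rewrite ract1 ract_gmap => <-; rewrite opE; apply: eq_bigr => p _.
  by rewrite ffunE mul1r.
have /ffunP/(_ 1%g) := e (delta x); rewrite opE ffunE => E.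
rewrite ract1 -E ract_gmap; apply: eq_bigr => p _.
by rewrite !ffunE mul1r.
Qed.

Lemma op_counitr : gmap (fun p : gT * gT => p.1) u = 1 <-> forall f, op u f cst1 = f.
Proof.
split=> [e h|e]; last apply: ract_inj => x.
  apply/ffunP=> g; have := congr1 (fun v => ract v h g) e.
  rewrite ract1 ract_gmap => <-; rewrite opE; apply: eq_bigr => p _.
  by rewrite ffunE mulr1.
have /ffunP/(_ 1%g) := e (delta x); rewrite opE ffunE => E.
rewrite ract1 -E ract_gmap; apply: eq_bigr => p _.
by rewrite !ffunE mulr1.
Qed.

End OneElement.

Section TwistEquation.
Variables (J : dualA -> kGG) (lam : dualA).

Let tens3 f1 f2 f3 (p : gT * gT * gT) : k := (f1 p.1.1 : k) * (f2 p.1.2 : k) * (f3 p.2 : k).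

(** P_mu acts on the third factor, so among the terms J(lam - mu) ⊗ P_mu only mu = m survives: the
    dynamical shift is the weight of f3. *)
Lemma ract_twist_lhs m f1 f2 f3 g : in_F m f3 ->
  ract (gmap (fun p => ((p.1, p.1), p.2)) (J lam)
        * (\sum_(mu : dualA) gtens (J (lam - mu)) (idem mu)))
    (tens3 f1 f2 f3) ((g, g), g) = op (J lam) (op (J (lam - m)) f1 f2) f3 g.
Proof.
move=> F3; rewrite ractM ract_gmap opE; apply: eq_bigr => -[x y] _ /=; congr (_ * _).
have -> : ((g, g, g) * (x, x, y))%g = (((g * x, g * x), g * y)%g : gT * gT * gT) by [].
rewrite ract_sum (bigD1 m) //= big1 => [|n nm]; rewrite ract_gtens.
  rewrite addr0 ffunE mulrC -ractZr; apply: eq_ract => -[p q] /=.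
  by rewrite /tens3 /= ractZr -[f3 in RHS](pr_id F3) [in RHS]ffunE mulrC.
rewrite (@eq_ract _ _ _ _ (fun=> 0)) => [|[p q]].
  by rewrite /ract big1 // => p _; rewrite mulr0.
rewrite /tens3 /= ractZr; have /ffunP/(_ (g * y)%g) := pr_out F3 nm.
by rewrite !ffunE => ->; rewrite mulr0.
Qed.

Lemma ract_twist_rhs f1 f2 f3 g :
  ract (gmap (fun p => ((p.1, p.2), p.2)) (J lam)
        * gmap (fun p => ((1%g, p.1), p.2)) (J lam))
    (tens3 f1 f2 f3) ((g, g), g) = op (J lam) f1 (op (J lam) f2 f3) g.
Proof.
rewrite ractM ract_gmap opE; apply: eq_bigr => -[x y] _ /=; congr (_ * _).
rewrite ract_gmap opE mulr_sumr; apply: eq_bigr => -[p q] _ /=.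
by rewrite /tens3 /= mulg1 -mulrA mulrCA.
Qed.

Lemma twist_equationP :
  gmap (fun p => ((p.1, p.1), p.2)) (J lam)
        * (\sum_(mu : dualA) gtens (J (lam - mu)) (idem mu))
      = gmap (fun p => ((p.1, p.2), p.2)) (J lam)
        * gmap (fun p => ((1%g, p.1), p.2)) (J lam)
  <-> forall m f1 f2 f3, in_F m f3 ->
    op (J lam) (op (J (lam - m)) f1 f2) f3 = op (J lam) f1 (op (J lam) f2 f3).
Proof.
split=> [e m f1 f2 f3 F3|e].
  by apply/ffunP=> g; rewrite -ract_twist_lhs // e ract_twist_rhs.
apply/ract_inj => -[[x y] z].
have E u : ract u (fun p => (p == (x, y, z))%:R) 1%g
    = \sum_m ract u (tens3 (delta x) (delta y) (pr m (delta z))) ((1, 1), 1)%g.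
  rewrite -ract_sumr; apply: eq_ract => -[[p q] r]; rewrite /tens3 /=.
  rewrite -mulr_sumr -fn_sum pr_sum !ffunE !xpair_eqE -!natrM !mulnb //.
rewrite !E; apply: eq_bigr => m _.
by rewrite (ract_twist_lhs (m := m)) ?ract_twist_rhs ?e //; apply: pr_in.
Qed.

End TwistEquation.

(** The form of the axioms used from here on: grading, associativity and unit of the composition
    F_(mu - lam) x F_(nu - mu) -> F_(nu - lam) given by J(nu). *)
Lemma is_twistP (J : dualA -> kGG) : is_twist J <-> forall lam,
  [/\ J lam \is a GRing.unit,
      forall m n f h, in_F m f -> in_F n h -> in_F (m + n) (op (J lam) f h),
      forall m f1 f2 f3, in_F m f3 ->
        op (J lam) (op (J (lam - m)) f1 f2) f3 = op (J lam) f1 (op (J lam) f2 f3),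
      forall h, op (J lam) cst1 h = h
    & forall f, op (J lam) f cst1 = f].
Proof.
split=> tw lam; have [uJ zw te c1 c2] := tw lam; split=> //.
- exact/zero_weightP.
- exact/twist_equationP.
- exact/op_counitl.
- exact/op_counitr.
- exact/zero_weightP.
- exact/twist_equationP.
- exact/op_counitl.
- exact/op_counitr.
Qed.

End Weights.

(** * Linear algebra *)

Section LinearAlgebra.
Variable k : fieldType.

Definition lin_hom (V W : vectType k) (f : V -> W) (lf : linear f) : 'Hom(V, W) :=
  linfun (HB.pack_for {linear V -> W} f (GRing.isLinear.Build _ _ _ _ f lf)).

Lemma lin_homE (V W : vectType k) (f : V -> W) (lf : linear f) v : lin_hom lf v = f v.
Proof. by rewrite lfunE. Qed.

Lemma hom_of_linear (V W : vectType k) (f : V -> W) :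
  linear f -> exists h : 'Hom(V, W), forall v, h v = f v.
Proof. by move=> lf; exists (lin_hom lf) => v; rewrite lin_homE. Qed.

(** Classical argument replacing decidability of P: if no subspace has P as its set of elements, any
    subspace contained in P can be enlarged inside P, and dimensions would grow without bound. *)
Lemma vspace_of_closed (V : vectType k) (P : V -> Prop) :
  P 0 -> (forall (c : k) u v, P u -> P v -> P (c *: u + v)) ->
  exists U : {vspace V}, forall v, v \in U <-> P v.
Proof.
move=> P0 PL; apply/not_existsP => noU.
suff grow i : exists2 U : {vspace V}, forall v, v \in U -> P v & (i <= \dim U)%N.
  have [U _] := grow (\dim {:V}).+1.
  by rewrite ltnNge dimvS ?subvf.
elim: i => [|i [U UP leU]].
  by exists 0%VS => // v; rewrite memv0 => /eqP ->.
have [v [Pv nUv]] : exists v, P v /\ v \notin U.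
  apply: contra_notP (noU U) => nov v; split=> [/UP//|Pv].
  by apply/negPn/negP => nUv; apply: nov; exists v.
exists (U + <[v]>)%VS.
  move=> w /memv_addP[u Uu [_ /vlineP[c ->] ->]].
  by rewrite addrC; apply: PL => //; apply: UP.
apply: leq_ltn_trans leU _; rewrite ltn_neqAle dimvS ?addvSl // andbT.
apply: contra nUv => e.
have -> : U = (U + <[v]>)%VS by apply/eqP; rewrite eqEdim addvSl (eqP e) /=.
exact: subvP (addvSr _ _) _ (memv_line v).
Qed.

(** S(P) lies in Q, which lies in E(P), and both images have the dimension of P. *)
Lemma inj_same_surj (V W : vectType k) (P : V -> Prop) (Q : W -> Prop)
    (E S : V -> W) :
  P 0 -> (forall (c : k) u v, P u -> P v -> P (c *: u + v)) ->
  linear E -> linear S ->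
  (forall v, P v -> E v = 0 -> v = 0) ->
  (forall w, Q w -> exists2 v, P v & E v = w) ->
  (forall v, P v -> Q (S v)) -> (forall v, P v -> S v = 0 -> v = 0) ->
  forall w, Q w -> exists2 v, P v & S v = w.
Proof.
move=> P0 PL lE lS iE oE PQ iS w Qw.
have [U UP] := vspace_of_closed P0 PL.
have [e eE] := hom_of_linear lE; have [s sE] := hom_of_linear lS.
have dimf (f : 'Hom(V, W)) : (forall v, P v -> f v = 0 -> v = 0) ->
    \dim (f @: U) = \dim U.
  move=> inj; apply: limg_dim_eq; apply/eqP; rewrite -subv0; apply/subvP => v.
  by rewrite memv_cap memv_ker memv0 => /andP[/UP Pv /eqP /(inj _ Pv) ->].
have sub : (s @: U <= e @: U)%VS.
  apply/subvP => _ /memv_imgP[v /UP Pv ->]; rewrite sE.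
  by have [u /UP Uu <-] := oE _ (PQ _ Pv); rewrite -eE memv_img.
have eU : (s @: U)%VS = (e @: U)%VS.
  apply/eqP; rewrite eqEdim sub !dimf ?leqnn // => v Pv; rewrite ?eE ?sE; [exact: iS | exact: iE].
have : w \in (s @: U)%VS.
  by rewrite eU; have [u /UP Uu <-] := oE _ Qw; rewrite -eE memv_img.
by move=> /memv_imgP[v /UP Pv ->]; exists v.
Qed.

Lemma mxtrace_inj m n (Y Z : 'M[k]_(m, n)) :
  (forall M, \tr (M *m Y) = \tr (M *m Z)) -> Y = Z.
Proof.
move=> e; apply/matrixP => i j; have := e (delta_mx j i).
have E (X : 'M[k]_(m, n)) : \tr (delta_mx j i *m X) = X i j.
  rewrite /mxtrace (bigD1 j) //= big1 ?addr0 => [|l /negPf nl].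
    rewrite mxE (bigD1 i) //= mxE !eqxx mul1r big1 ?addr0 // => l /negPf nl.
    by rewrite mxE nl andbF mul0r.
  by rewrite mxE big1 // => l' _; rewrite mxE nl mul0r.
by rewrite !E.
Qed.

Lemma scalar_mx_center n (Y : 'M[k]_n) :
  (forall M, Y *m M = M *m Y) -> exists c, Y = c%:M.
Proof.
case: n Y => [|n] Y e; first by exists 0; rewrite [Y]flatmx0 [RHS]flatmx0.
exists (Y 0 0); apply/matrixP => i j; rewrite !mxE.
have := congr1 (fun M : 'M_n.+1 => M i 0) (e (delta_mx j 0)).
rewrite !mxE (bigD1 j) //= !mxE !eqxx mulr1 big1 => [|l /negPf nl]; last first.
  by rewrite !mxE nl mulr0.
rewrite addr0 => ->; rewrite (bigD1 0) //= !mxE big1 => [|l /negPf nl]; last first.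
  by rewrite !mxE nl andbF mul0r.
by rewrite eqxx andbT addr0 mulr_natl.
Qed.

Lemma span_center n (S : seq 'M[k]_n) (Y : 'M[k]_n) : (<<S>> = fullv)%VS ->
  (forall M, M \in S -> Y *m M = M *m Y) -> exists c, Y = c%:M.
Proof.
move=> fS e; apply: scalar_mx_center => M.
have : M \in <<in_tuple S>>%VS by rewrite fS memvf.
move/coord_span => ->; rewrite mulmx_suml mulmx_sumr; apply: eq_bigr => i _.
by rewrite -scalemxAr -scalemxAl e // mem_nth.
Qed.

Lemma mxtrace_delta n (i j : 'I_n) : \tr (delta_mx i j : 'M[k]_n) = (i == j)%:R.
Proof.
rewrite /mxtrace (bigD1 i) //= mxE eqxx big1 ?addr0 // => l /negPf nl.
by rewrite mxE nl.
Qed.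

(** Identifies matrices with columns so that [tensmx P Q] becomes Y ↦ P Y Q^T; the action on V_lam
    tensored with the dual of V_mu is then conjugation of matrices. *)
Definition vec m n (Y : 'M[k]_(m, n)) : 'cV[k]_(m * n) :=
  \col_r Y (mxtens_unindex r).1 (mxtens_unindex r).2.

Definition unvec m n (v : 'cV[k]_(m * n)) : 'M[k]_(m, n) :=
  \matrix_(i, j) v (mxtens_index (i, j)) 0.

Lemma vecK m n : cancel (@vec m n) (@unvec m n).
Proof. by move=> Y; apply/matrixP => i j; rewrite !mxE mxtens_indexK. Qed.

Lemma unvecK m n : cancel (@unvec m n) (@vec m n).
Proof.
move=> v; apply/matrixP => r c; rewrite !mxE (ord1 c).
by case: (mxtens_indexP r) => i j; rewrite mxtens_indexK.
Qed.

Lemma vec_is_linear m n : linear (@vec m n).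
Proof. by move=> c Y Z; apply/matrixP => r s; rewrite !mxE. Qed.

Lemma unvec_is_linear m n : linear (@unvec m n).
Proof. by move=> c Y Z; apply/matrixP => r s; rewrite !mxE. Qed.

Lemma vec0 m n : vec (0 : 'M[k]_(m, n)) = 0.
Proof. by apply/matrixP => r s; rewrite !mxE. Qed.

Lemma vec_inj m n : injective (@vec m n).
Proof. exact: can_inj (@vecK m n). Qed.

Lemma tens_vec m n p q (P : 'M[k]_(p, m)) (Q : 'M[k]_(q, n)) (Y : 'M[k]_(m, n)) :
  tensmx P Q *m vec Y = vec (P *m Y *m Q^T).
Proof.
apply/matrixP => r c; rewrite !mxE; case: (mxtens_indexP r) => i j.
rewrite mxtens_indexK /= (reindex (@mxtens_index m n)) /=; last first.
  exists (@mxtens_unindex m n) => ? _; [exact: mxtens_indexK | exact: mxtens_unindexK].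
under [RHS]eq_bigr => b _ do rewrite !mxE mulr_suml.
rewrite exchange_big pair_bigA /=; apply: eq_bigr => -[a b] _.
by rewrite tensmxE !mxE mxtens_indexK /= mulrAC.
Qed.

Lemma tens_delta m n (i : 'I_m) (j : 'I_n) :
  tensmx (delta_mx i 0 : 'cV[k]_m) (delta_mx j 0 : 'cV[k]_n) = vec (delta_mx i j).
Proof.
apply/matrixP => r c; case: (mxtens_indexP r) => i' j'.
have -> : c = mxtens_index (ord0, ord0) by apply/val_inj; case: c => -[].
by rewrite tensmxE !mxE mxtens_indexK /= !andbT -natrM mulnb.
Qed.

End LinearAlgebra.

(** * Equivariant functors *)

Section DatumFacts.
Variables (k : closedFieldType) (gT : finGroupType) (A : {group gT}).
Variable d : datum k A.

Notation dualA := (dual k A).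
Notation K := (stab d).
Notation n_ := (vdim d).
Implicit Types (lam mu nu kap : dualA) (x y : gT).

Lemma vdim_gt0 lam : (0 < n_ lam)%N.
Proof. by case: d => K n V proj irr lin ind; case: (proj lam). Qed.

Lemma rep_unit lam x : x \in K -> rep d lam x \in unitmx.
Proof. by case: d => K n V proj irr lin ind; case: (proj lam) => _ u _; apply: u. Qed.

Lemma rep_span lam : (<<[seq rep d lam g | g in K]>> = fullv)%VS.
Proof. by case: d => K n V proj irr lin ind; apply: (irr lam). Qed.

Lemma rep_tens_linear lam mu :
  linear_rep K (tens_rep (rep d lam) (dual_rep (rep d mu))).
Proof.
case: d => K n V proj irr lin ind /=; have := lin mu (mu - lam).
by rewrite subKr.
Qed.

Lemma rep_ind lam mu : exists E,
  Ind_iso K A (tens_rep (rep d lam) (dual_rep (rep d mu))) (dual_mx (lam - mu)) E.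
Proof.
case: d => K n V proj irr lin ind /=; have := ind lam (lam - mu).
by rewrite subKr.
Qed.

(** The action of x on Hom(V_mu, V_lam). The cocycles of the two projective representations cancel,
    so this is a genuine action of K. *)
Definition cj lam mu x (Y : 'M[k]_(n_ lam, n_ mu)) :=
  rep d lam x *m Y *m invmx (rep d mu x).

Lemma tens_cj lam mu x Y :
  tens_rep (rep d lam) (dual_rep (rep d mu)) x *m vec Y = vec (cj x Y).
Proof. by rewrite tens_vec trmxK. Qed.

Lemma cjM lam mu x y (Y : 'M[k]_(n_ lam, n_ mu)) :
  x \in K -> y \in K -> cj (x * y)%g Y = cj x (cj y Y).
Proof.
move=> Kx Ky; apply: vec_inj; rewrite -!tens_cj.
by rewrite -rep_tens_linear // -mulmxA.
Qed.

Lemma cj_inj lam mu x : x \in K -> injective (@cj lam mu x).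
Proof.
move=> Kx Y Z /(congr1 (fun M => invmx (rep d lam x) *m M *m rep d mu x)).
rewrite /cj !mulmxA mulVmx ?rep_unit // !mul1mx.
by rewrite -!mulmxA mulVmx ?rep_unit // !mulmx1.
Qed.

Lemma cj1 lam mu (Y : 'M[k]_(n_ lam, n_ mu)) : cj 1%g Y = Y.
Proof. by apply: (@cj_inj _ _ 1%g) => //; rewrite -cjM ?mulg1. Qed.

Lemma cjVK lam mu x : x \in K -> cancel (@cj lam mu x^-1%g) (cj x).
Proof. by move=> Kx Y; rewrite -cjM ?groupV // mulgV cj1. Qed.

Lemma cj_mul lam mu nu x (Y : 'M[k]_(n_ lam, n_ mu)) (Z : 'M[k]_(n_ mu, n_ nu)) :
  x \in K -> cj x Y *m cj x Z = cj x (Y *m Z).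
Proof. by move=> Kx; rewrite /cj !mulmxA mulmxKV // rep_unit. Qed.

Lemma cj_is_linear lam mu x : linear (@cj lam mu x).
Proof. by move=> c Y Z; rewrite /cj mulmxDr mulmxDl -scalemxAr -scalemxAl. Qed.

Lemma cj0 lam mu x : cj x (0 : 'M[k]_(n_ lam, n_ mu)) = 0.
Proof. by rewrite /cj mulmx0 mul0mx. Qed.

Lemma mxtrace_cj lam x (Y : 'M[k]_(n_ lam)) : x \in K -> \tr (cj x Y) = \tr Y.
Proof. by move=> Kx; rewrite /cj mxtrace_mulC mulKmx // rep_unit. Qed.

(** Schur's lemma: Y commutes with the operators of K, which span all matrices. *)
Lemma cj_scalar lam (Y : 'M[k]_(n_ lam)) :
  (forall x, x \in K -> cj x Y = Y) -> exists c, Y = c%:M.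
Proof.
move=> e; apply: (span_center (rep_span lam)) => _ /imageP[x Kx ->].
by rewrite -[in LHS](e x Kx) /cj mulmxKV // rep_unit.
Qed.

End DatumFacts.

Section Realization.
Variables (k : closedFieldType) (gT : finGroupType) (A : {group gT}).
Hypotheses (char0 : [pchar k] =i pred0) (abelA : abelian A).

Notation dualA := (dual k A).
Notation fn := {ffun gT -> k^o}.
Notation kGG := (galg k [the finGroupType of (gT * gT)%type]).
Implicit Types (lam mu nu kap m : dualA) (f h : fn) (x g : gT).

Definition hom_family (n_ : dualA -> nat) :=
  forall lam mu : dualA, 'Hom(fn, 'M[k]_(n_ lam, n_ mu)).

Lemma hom_family_ex (n_ : dualA -> nat)
    (F : forall lam mu : dualA, fn -> 'M[k]_(n_ lam, n_ mu)) :
  (forall lam mu, linear (F lam mu)) ->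
  exists T : hom_family n_, forall lam mu f, T lam mu f = F lam mu f.
Proof.
by move=> lF; exists (fun lam mu => lin_hom (lF lam mu)) => lam mu f; rewrite lin_homE.
Qed.

(* The functions F_(mu - lam) are the morphisms mu -> lam of a category with
   composition J, and T is a functor on it, extended by 0 to the other weights. *)
Definition functorial (J : dualA -> kGG) (n_ : dualA -> nat) (T : hom_family n_) :=
  (forall lam mu m f, in_F m f -> m != mu - lam -> T lam mu f = 0) /\
  (forall lam nu f h,
     T lam nu (op (J nu) f h) = \sum_mu T lam mu f *m T mu nu h).

(** The last condition is injectivity of f ↦ (g ↦ T(g^-1 f)). Surjectivity onto the induced
    functions is left out because it follows by counting dimensions ([real_surj]). *)
Definition realizes (J : dualA -> kGG) (d : datum k A) (T : hom_family (vdim d)) :=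
  [/\ functorial J T,
      forall lam mu x f, x \in stab d -> T lam mu (translate x f) = cj x (T lam mu f)
    & forall mu f, (forall lam g, T lam mu (translate g f) = 0) -> f = 0].

Definition realizable (J : dualA -> kGG) (d : datum k A) :=
  exists T : hom_family (vdim d), realizes J T.

(** F is an element of the module induced from Hom(V_mu, V_lam). The datum makes this module
    isomorphic to F_(mu - lam), so the injective map f ↦ (g ↦ T(g^-1 f)) must be onto. *)
Lemma hom_surj (d : datum k A) lam mu (T : 'Hom(fn, 'M[k]_(vdim d lam, vdim d mu)))
    (F : gT -> 'M[k]_(vdim d lam, vdim d mu)) :
  (forall x f, x \in stab d -> T (translate x f) = cj x (T f)) ->
  (forall f, in_F (mu - lam) f -> (forall g, T (translate g f) = 0) -> f = 0) ->
  (forall g x, x \in stab d -> F (g * x)%g = cj x^-1%g (F g)) ->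
  exists2 f, in_F (mu - lam) f & forall g, T (translate g^-1%g f) = F g.
Proof.
move=> eT iT eF; have [E [E1 E2 E3 E4]] := rep_ind d lam mu.
pose W := tens_rep (rep d lam) (dual_rep (rep d mu)).
pose P := in_Ind (stab d) W.
pose E' v : fn := [ffun g => E v g 0 0].
(* G is the isomorphism of the datum followed by f ↦ (g ↦ T(g^-1 f)): an injective endomorphism of
   the induced space, hence onto. *)
pose G v : {ffun gT -> 'cV[k]_(vdim d lam * vdim d mu)} :=
  [ffun g => vec (T (translate g^-1%g (E' v)))].
have E'L : linear E'.
  by move=> c u v; apply/ffunP=> g; rewrite !ffunE linearP !ffunE !mxE.
(* The convention of [in_Ind] inverts the character: the module induced from lam - mu is F_(mu -
   lam). *)
have FE' v : P v -> in_F (mu - lam) (E' v).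
  move=> /E1 Iv g a Aa; rewrite !ffunE Iv // mxE big_ord1 mxE eqxx mulr1n.
  by rewrite dualV // dual_add dual_opp invfM invrK [(lam a)^-1 * _]mulrC.
have P0 : P 0 by move=> g x Kx; rewrite !ffunE mulmx0.
have PL (c : k) u v : P u -> P v -> P (c *: u + v).
  by move=> Pu Pv g x Kx; rewrite !ffunE Pu // Pv // mulmxDr scalemxAr.
have lid : linear (@id {ffun gT -> 'cV[k]_(vdim d lam * vdim d mu)}) by [].
have lG : linear G.
  move=> c u v; apply/ffunP=> g; rewrite !ffunE E'L translate_linear linearP /=.
  by rewrite vec_is_linear.
have PG v : P v -> P (G v).
  move=> Pv g x Kx; rewrite !ffunE invMg translateM eT ?groupV //.
  by rewrite tens_cj.
have iG v : P v -> G v = 0 -> v = 0.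
  move=> Pv /ffunP G0; apply: E2 => //; apply/ffunP=> g; apply/matrixP => i j.
  rewrite (ord1 i) (ord1 j) ffunE mxE.
  have /ffunP/(_ g) : E' v = 0.
    apply: (iT _ (FE' v Pv)) => x; have := G0 x^-1%g.
    by rewrite !ffunE invgK -[0 in RHS](vec0 k) => /vec_inj.
  by rewrite !ffunE.
have [//|w Pw|g x Kx|v Pv eG] := inj_same_surj P0 PL lid lG _ _ PG iG (w := [ffun g => vec (F g)]).
- by exists w.
- by rewrite !ffunE eF // tens_cj.
exists (E' v); first exact: FE'.
by move=> g; have /ffunP/(_ g) := eG; rewrite !ffunE => /vec_inj.
Qed.

Section Functorial.
Variables (J : dualA -> kGG) (n_ : dualA -> nat) (T : hom_family n_).
Hypothesis fT : functorial J T.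

Lemma fun_out lam mu m f : in_F m f -> m != mu - lam -> T lam mu f = 0.
Proof. by case: fT => + _; apply. Qed.

Lemma fun_comp lam nu f h :
  T lam nu (op (J nu) f h) = \sum_mu T lam mu f *m T mu nu h.
Proof. by case: fT. Qed.

Lemma fun_pr lam mu f : T lam mu (pr (mu - lam) f) = T lam mu f.
Proof.
rewrite -[f in RHS](pr_sum char0 abelA) linear_sum (bigD1 (mu - lam)) //= big1 ?addr0 //.
by move=> m nm; apply: fun_out nm; apply: pr_in.
Qed.

Lemma fun_mull lam mu nu f h : in_F (mu - lam) f ->
  T lam nu (op (J nu) f h) = T lam mu f *m T mu nu h.
Proof.
move=> Ff; rewrite fun_comp (bigD1 mu) //= big1 ?addr0 // => mu' nmu.
rewrite (fun_out Ff) ?mul0mx //; apply: contra nmu => /eqP/addIr ->.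
by rewrite eqxx.
Qed.

Lemma fun_mulr lam mu nu f h : in_F (nu - mu) h ->
  T lam nu (op (J nu) f h) = T lam mu f *m T mu nu h.
Proof.
move=> Fh; rewrite fun_comp (bigD1 mu) //= big1 ?addr0 // => mu' nmu.
rewrite (fun_out Fh) ?mulmx0 //; apply: contra nmu => /eqP/addrI/oppr_inj ->.
by rewrite eqxx.
Qed.

End Functorial.

Section Realized.
Variables (J : dualA -> kGG) (d : datum k A) (T : hom_family (vdim d)).
Hypothesis rT : realizes J T.

Lemma real_fun : functorial J T. Proof. by case: rT. Qed.

Lemma real_equiv lam mu x f :
  x \in stab d -> T lam mu (translate x f) = cj x (T lam mu f).
Proof. by case: rT => _ + _; apply. Qed.

Lemma real_inj mu f : (forall lam g, T lam mu (translate g f) = 0) -> f = 0.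
Proof. by case: rT => _ _; apply. Qed.

Lemma real_eq mu f f' :
  (forall lam g, T lam mu (translate g f) = T lam mu (translate g f')) -> f = f'.
Proof.
move=> e; apply/eqP; rewrite -subr_eq0; apply/eqP/(real_inj (mu := mu)) => lam g.
by rewrite addrC -scaleN1r translate_linear linearP /= e scaleN1r addNr.
Qed.

Lemma real_inj_in lam mu f : in_F (mu - lam) f ->
  (forall g, T lam mu (translate g f) = 0) -> f = 0.
Proof.
move=> Ff e; apply: (real_inj (mu := mu)) => kap g.
case: (eqVneq kap lam) => [->|nk]; first exact: e.
apply: (fun_out real_fun (in_F_translate g Ff)); apply: contra nk.
by move=> /eqP/addrI/oppr_inj ->.
Qed.

Lemma real_eq_in lam mu f f' : in_F (mu - lam) f -> in_F (mu - lam) f' ->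
  (forall g, T lam mu (translate g f) = T lam mu (translate g f')) -> f = f'.
Proof.
move=> Ff Ff' e; apply/eqP; rewrite -subr_eq0; apply/eqP/(@real_inj_in lam mu).
  by rewrite -scaleN1r; apply/in_FD/in_FZ.
move=> g; by rewrite addrC -scaleN1r translate_linear linearP /= e scaleN1r addNr.
Qed.

Lemma real_surj lam mu (F : gT -> 'M[k]_(vdim d lam, vdim d mu)) :
  (forall g x, x \in stab d -> F (g * x)%g = cj x^-1%g (F g)) ->
  exists2 f, in_F (mu - lam) f & forall g, T lam mu (translate g^-1%g f) = F g.
Proof.
by apply: hom_surj; [exact: real_equiv | exact: real_inj_in].
Qed.

(** The preimage of the generator 1 ⊗ Y of the induced module. *)
Lemma real_surj_stab lam mu Y : exists f,
  [/\ in_F (mu - lam) f, T lam mu f = Y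
    & forall g, g \notin stab d -> T lam mu (translate g f) = 0].
Proof.
have [|f Ff Tf] := @real_surj lam mu (fun g => if g \in stab d then cj g^-1%g Y else 0).
  move=> g x Kx; rewrite groupMr //; case: ifP => Kg; last by rewrite cj0.
  by rewrite invMg cjM ?groupV.
exists f; split=> // [|g nKg]; last by rewrite -[g]invgK Tf groupV (negPf nKg).
by have := Tf 1%g; rewrite invg1 translate1 group1 cj1.
Qed.

(** With T f = 1, the left unit law gives T cst1 = T cst1 · T f = T f = 1. *)
Lemma real_unit lam : (forall h, op (J lam) cst1 h = h) -> T lam lam cst1 = 1%:M.
Proof.
move=> e; have [f [Ff Tf _]] := @real_surj_stab lam lam 1%:M.
have := fun_mull real_fun (lam := lam) (mu := lam) (f := cst1) lam f.
by rewrite subrr e Tf mulmx1 => -> //; apply: in_F_cst1.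
Qed.

End Realized.

End Realization.

(** * Gauge transformations *)

Section Gauge.
Variables (k : closedFieldType) (gT : finGroupType) (A : {group gT}).
Hypotheses (char0 : [pchar k] =i pred0) (abelA : abelian A).

Notation dualA := (dual k A).
Notation fn := {ffun gT -> k^o}.
Notation kG := (galg k gT).
Notation kGG := (galg k [the finGroupType of (gT * gT)%type]).
Implicit Types (lam mu nu kap m : dualA) (f h : fn) (x g : gT) (t u : kG).

Definition rt t f : fn := [ffun g => ract t f g].

Lemma rt_is_linear t : linear (rt t).
Proof.
move=> c f h; apply/ffunP=> g; rewrite fnD fnZ !ffunE -ractZr -big_split /=.
by apply: eq_bigr => x _; rewrite fnD fnZ mulrDr.
Qed.

Lemma rt_sum t I r (P : pred I) (F : I -> fn) :
  rt t (\sum_(i <- r | P i) F i) = \sum_(i <- r | P i) rt t (F i).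
Proof.
apply/ffunP=> g; rewrite fn_sum ffunE; under [RHS]eq_bigr do rewrite ffunE.
by rewrite -ract_sumr; apply: eq_ract => x; rewrite fn_sum.
Qed.

Lemma rt_delta t x : rt t (delta x) 1%g = gcoef t x.
Proof.
rewrite ffunE -[in RHS](mul1g x) -[in RHS]invg1 -ract_delta.
by apply: eq_ract => y; rewrite ffunE.
Qed.

Lemma rt_inj t u : (forall f, rt t f = rt u f) -> t = u.
Proof. by move=> e; apply/galgP => x; rewrite -!rt_delta e. Qed.

Lemma rtM t u f : rt (t * u) f = rt t (rt u f).
Proof.
apply/ffunP=> g; rewrite !ffunE ractM; apply: eq_ract => x.
by rewrite ffunE.
Qed.

Lemma rt1 f : rt 1 f = f.
Proof. by apply/ffunP=> g; rewrite ffunE ract1. Qed.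

Lemma translate_rt x t f : translate x (rt t f) = rt t (translate x f).
Proof.
apply/ffunP=> g; rewrite translateE !ffunE; apply: eq_bigr => y _.
by rewrite translateE mulgA.
Qed.

(** By invariance S is determined by its values at 1, and the coefficient of t at x is
    S(delta_x)(1). *)
Lemma rt_ex (S : fn -> fn) : linear S ->
  (forall x f, S (translate x f) = translate x (S f)) -> exists t, forall f, rt t f = S f.
Proof.
move=> lS eS; exists (gfun (fun x => S (delta x) 1%g)) => f; apply/ffunP=> g.
have [s sE] := hom_of_linear lS.
have -> : S f g = S (translate g^-1%g f) 1%g by rewrite eS translateE invgK mulg1.
rewrite -sE [translate _ f]fn_delta linear_sum fn_sum ffunE; apply: eq_bigr => x _.
by rewrite gcoefE linearZ fnZ /= sE translateE invgK mulrC.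
Qed.

Lemma zero_weight1P t :
  zero_weight1 A t <-> forall m f, in_F m f -> in_F m (rt t f).
Proof.
split=> [zw m f Ff g a Aa|wt a Aa].
  have := congr1 (fun u => rt u f g) (zw a Aa); rewrite !rtM !ffunE ract_gel ffunE => <-.
  rewrite -ractZr; apply: eq_ract => x.
  by rewrite ffunE ract_gel Ff.
apply: rt_inj => f; rewrite !rtM -[f](pr_sum char0 abelA) !rt_sum.
apply: eq_bigr => m _; apply/ffunP=> g.
rewrite [RHS]ffunE ract_gel (wt m) //; last exact: pr_in.
rewrite !ffunE -ractZr; apply: eq_ract => x.
by rewrite ffunE ract_gel pr_in.
Qed.

(** The right translations by the t(lam) carry the products of J' to those of J. The left factor
    uses t(lam - m) because P_mu in the definition of the gauge transform reads off the weight m of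
    the right factor. *)
Lemma gauge_transformP (J J' : dualA -> kGG) (t : dualA -> kG) : is_gauge t ->
  (forall lam, J' lam = gauge_transform t J lam) <->
  (forall lam m f h, in_F m h -> rt (t lam) (op (J' lam) f h)
     = op (J lam) (rt (t (lam - m)) f) (rt (t lam) h)).
Proof.
move=> gt; have zw lam : zero_weight1 A (t lam) by case: (gt lam).
have E lam m f h : in_F m h -> op (gauge_transform t J lam) f h
    = rt (t lam)^-1 (op (J lam) (rt (t (lam - m)) f) (rt (t lam) h)).
  move=> Fh; set H := rt (t lam) h.
  have FH : in_F m H by exact: ((zero_weight1P _).1 (zw lam) m h Fh).
  have idH (n : dualA) z : ract (idem n) H z = pr n H z :> k by rewrite ffunE.
  have eF p q : ract (gtens 1 (t lam)) (fun p => (f p.1 : k) * (h p.2 : k)) (p, q)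
      = (f p : k) * (H q : k) by rewrite ract_gtens ract1 /= ractZr ffunE.
  have eI (n : dualA) p q : ract (idem n) (fun y => ract (gtens 1 (t lam))
      (fun p => (f p.1 : k) * (h p.2 : k)) (p, y)) q = (f p : k) * (pr n H q : k).
    by rewrite -idH -ractZr; apply: eq_ract => y; apply: eF.
  apply/ffunP=> g; rewrite !ffunE !ractM ract_gmap.
  apply: eq_bigr => x _ /=; rewrite ffunE; congr (_ * _).
  have -> : ((g, g) * (x, x))%g = ((g * x, g * x)%g : gT * gT) by [].
  apply: eq_ract => -[y z]; rewrite ract_sum (bigD1 m) //= big1 => [|n nm].
    rewrite addr0 ract_gtens mulrC [rt _ f _]ffunE -ractZr; apply: eq_ract => p.
    by rewrite eI pr_id // mulrC.
  rewrite ract_gtens (@eq_ract _ _ _ _ (fun=> 0)) => [|p].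
    by rewrite /ract big1 // => p _; rewrite mulr0.
  by rewrite eI (pr_out FH nm) fn0 mulr0.
have ut lam : t lam \is a GRing.unit by case: (gt lam).
split=> [e lam m f h Fh|e lam].
  by rewrite e (E _ m) // -rtM mulrV // rt1.
apply: op_inj => f h; rewrite -[h](pr_sum char0 abelA) !op_sumr.
apply: eq_bigr => m _; rewrite (E _ m) -?e -?rtM ?mulVr ?rt1 //; exact: pr_in.
Qed.

(** The functor for J' is T lam mu precomposed with right translation by t(mu). *)
Lemma realizable_gauge (J J' : dualA -> kGG) (t : dualA -> kG) (d : datum k A) :
  is_gauge t -> (forall lam, J' lam = gauge_transform t J lam) ->
  realizable J d -> realizable J' d.
Proof.
move=> gt /(gauge_transformP _ _ gt) eJ [T [[T0 TM] Teq Tinj]].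
have zw lam : zero_weight1 A (t lam) by case: (gt lam).
have wt lam m f := (zero_weight1P (t lam)).1 (zw lam) m f.
have ut lam : t lam \is a GRing.unit by case: (gt lam).
pose T' lam mu f := T lam mu (rt (t mu) f).
have [|T1 T1E] := hom_family_ex (F := T').
  by move=> lam mu c f h; rewrite /T' rt_is_linear linearP.
exists T1; split; [split | |].
- by move=> lam mu m f Ff nm; rewrite T1E; apply: T0 nm; apply: wt.
- move=> lam nu f h; rewrite T1E /T' -[h](pr_sum char0 abelA) op_sumr rt_sum linear_sum.
  under [RHS]eq_bigr => mu _ do rewrite linear_sum mulmx_sumr.
  rewrite [RHS]exchange_big; apply: eq_bigr => m _ /=.
  rewrite (eJ _ m) ?TM; last exact: pr_in.
  have e m' : m' != nu - m -> T m' nu (rt (t nu) (pr m h)) = 0.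
    move=> nm; apply: (T0 _ _ m); first exact: (wt _ _ _ (pr_in m h)).
    by apply: contra nm => /eqP ->; rewrite subKr.
  rewrite (bigD1 (nu - m)) //= big1 ?addr0 => [|m' nm]; last by rewrite e ?mulmx0.
  rewrite [RHS](bigD1 (nu - m)) //= [\sum_(_ | _) _]big1 ?addr0 => [|m' nm].
    by rewrite !T1E.
  by rewrite !T1E /T' e ?mulmx0.
- by move=> lam mu x f Kx; rewrite !T1E /T' -translate_rt Teq.
- move=> mu f e; rewrite -[f]rt1 -(mulVr (ut mu)) rtM (Tinj mu (rt (t mu) f)) => [|lam g].
    by apply/ffunP=> g; rewrite !ffunE /ract big1 // => y _; rewrite fn0 mulr0.
  by rewrite translate_rt -(e lam g) T1E.
Qed.

(** The new functor translates by g^-1, applies T and conjugates by the maps phi. Equivariance holds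
    because the multiplier is the same for lam and mu, so it cancels. *)
Lemma realizable_iso (J : dualA -> kGG) (d d' : datum k A) :
  datum_iso d d' -> realizable J d -> realizable J d'.
Proof.
case=> g [phi [al [eK al0 inv eq]]] [T [[T0 TM] Teq Tinj]].
have {inv} /fin_all_exists[psi psiP] lam : exists psi : 'M[k]_(vdim d lam, vdim d' lam),
    psi *m phi lam = 1%:M /\ phi lam *m psi = 1%:M by case: (inv lam) => psi; exists psi.
have [|T1 T1E] := hom_family_ex (F := fun lam mu f =>
    phi lam *m T lam mu (translate g^-1%g f) *m psi mu).
  move=> lam mu c f h.
  by rewrite translate_linear linearP /= mulmxDr mulmxDl -scalemxAr -scalemxAl.
exists T1; split; [split | |].
- move=> lam mu m f Ff nm; rewrite T1E (T0 _ _ _ _ _ nm) ?mulmx0 ?mul0mx //.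
  exact: in_F_translate.
- move=> lam nu f h; rewrite T1E translate_op TM mulmx_sumr mulmx_suml.
  apply: eq_bigr => mu _; rewrite !T1E !mulmxA -[_ *m psi mu *m phi mu]mulmxA.
  by rewrite (psiP mu).1 mulmx1.
- move=> lam mu x' f; rewrite eK => /imsetP[x Kx ->{x'}].
  have -> : (x ^ g^-1)%g = (g * x * g^-1)%g by rewrite conjgE invgK mulgA.
  have K'x : (g * x * g^-1)%g \in stab d'.
    by rewrite eK mem_conjg invgK conjgE !mulgA mulgKV mulVg mul1g.
  rewrite !T1E -translateM !mulgA mulVg mul1g translateM Teq // /cj.
  apply: (can_inj (mulmxK (rep_unit mu K'x))); rewrite mulmxKV ?rep_unit //.
  rewrite !mulmxA.
  have e1 : phi lam *m rep d lam x = (al x)^-1 *: (rep d' lam (g * x * g^-1)%g *m phi lam).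
    by rewrite eq // scalerA mulVf ?al0 // scale1r.
  have e2 : psi mu *m rep d' mu (g * x * g^-1)%g = al x *: (rep d mu x *m psi mu).
    rewrite -[LHS]mulmx1 -(psiP mu).2 !mulmxA -[_ *m _ *m phi mu]mulmxA eq //.
    by rewrite -scalemxAr -scalemxAl !mulmxA (psiP mu).1 mul1mx.
  rewrite -[LHS]mulmxA e2 e1 -!scalemxAl -!scalemxAr scalerA.
  rewrite mulVf ?al0 // scale1r -!mulmxA; congr (_ *m (_ *m (_ *m _))).
  by rewrite mulmxA mulVmx ?rep_unit // mul1mx.
- move=> mu f e; apply: (Tinj mu) => lam x; have := e lam (g * x)%g.
  move/(congr1 (fun M => psi lam *m M *m phi mu)).
  rewrite T1E -translateM mulKg mulmx0 mul0mx !mulmxA (psiP lam).1 mul1mx.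
  by rewrite -mulmxA (psiP mu).1 mulmx1.
Qed.

End Gauge.

Section GaugeFromRealization.
Variables (k : closedFieldType) (gT : finGroupType) (A : {group gT}).
Hypotheses (char0 : [pchar k] =i pred0) (abelA : abelian A).

Notation dualA := (dual k A).
Notation fn := {ffun gT -> k^o}.
Notation kG := (galg k gT).
Notation kGG := (galg k [the finGroupType of (gT * gT)%type]).
Implicit Types (lam mu nu kap m : dualA) (f h : fn) (x g : gT).

(** For each f there is exactly one f' whose translates have the same images under T as those of f
    under T': existence weight by weight from surjectivity onto induced functions, uniqueness from
    injectivity. Uniqueness makes f ↦ f' linear and translation invariant, hence a right
    translation. *)
Lemma real_transfer (J J' : dualA -> kGG) (d : datum k A) (T T' : hom_family (vdim d)) :
  realizes J T -> realizes J' T' ->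
  forall mu, exists t : kG, forall lam f, T lam mu (rt t f) = T' lam mu f.
Proof.
move=> rT rT' mu.
have /choice[S SE] f : exists f', forall lam g,
    T lam mu (translate g f') = T' lam mu (translate g f).
  have ex lam : exists F, in_F (mu - lam) F /\
      forall g, T lam mu (translate g F) = T' lam mu (translate g f).
    have [|F FF FE] := real_surj rT (F := fun g => T' lam mu (translate g^-1%g f)).
      by move=> x y Ky; rewrite invMg translateM (real_equiv rT') ?groupV.
    by exists F; split=> // g; rewrite -[g]invgK FE.
  have {ex} /choice[F FP] := ex; exists (\sum_lam F lam) => lam g.
  have [FF FE] := FP lam.
  rewrite translate_sum linear_sum (bigD1 lam) //= big1 ?addr0 ?FE // => lam' nl.
  have [FF' _] := FP lam'.
  rewrite (fun_out (real_fun rT) (in_F_translate g FF')) //.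
  by apply: contra nl => /eqP/addrI/oppr_inj ->.
have [||t tE] := @rt_ex _ _ S.
- move=> c f h; apply: (real_eq rT (mu := mu)) => lam g.
  by rewrite SE !translate_linear !linearP /= !SE.
- move=> x f; apply: (real_eq rT (mu := mu)) => lam g.
  by rewrite SE -!translateM SE.
by exists t => lam f; rewrite tE -[S f]translate1 SE translate1.
Qed.

(** The transfers in the two directions are inverse to each other; weights and the gauge relation
    are checked after applying T, which is jointly injective on translates. *)
Lemma gauge_of_realizations (J J' : dualA -> kGG) (d : datum k A) :
  is_twist J -> is_twist J' -> realizable J d -> realizable J' d ->
  exists2 t, is_gauge t & forall lam, J' lam = gauge_transform t J lam.
Proof.
move=> /(is_twistP char0 abelA) tJ /(is_twistP char0 abelA) tJ' [T rT] [T' rT'].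
have /choice[t tE] := real_transfer rT rT'.
have /choice[u uE] := real_transfer rT' rT.
have wt mu m f : in_F m f -> in_F m (rt (t mu) f).
  move=> Ff; rewrite -[rt _ f](pr_sum char0 abelA) (bigD1 m) //= big1 => [|n nm].
    by rewrite addr0; apply: pr_in.
  apply: (real_inj rT (mu := mu)) => lam g; rewrite translate_pr translate_rt.
  case: (eqVneq n (mu - lam)) => [e|ne].
    rewrite e (fun_pr char0 abelA (real_fun rT)) tE (fun_out (real_fun rT') (m := m)) //.
      exact: in_F_translate.
    by rewrite -e eq_sym.
  by rewrite (fun_out (real_fun rT) (m := n)) //; apply: pr_in.
have gt : is_gauge t.
  move=> lam; split.
  - apply/unitrP; exists (u lam); split; apply: rt_inj => f; rewrite rtM rt1.
      apply: (real_eq rT' (mu := lam)) => kap g.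
      by rewrite !translate_rt uE tE.
    apply: (real_eq rT (mu := lam)) => kap g.
    by rewrite !translate_rt tE uE.
  - exact/(zero_weight1P char0 abelA)/wt.
  have [_ _ _ e _] := tJ lam; have [_ _ _ e' _] := tJ' lam.
  (* The counit of t(lam) is the value at 1 of its action on the constant 1; this constant is fixed
     since both functors send it to the identity. *)
  have /ffunP/(_ 1%g) : rt (t lam) cst1 = cst1.
    have F1 : in_F (lam - lam) (cst1 : fn) by rewrite subrr; apply: in_F_cst1.
    apply: (real_eq_in rT (wt _ _ _ F1) F1) => g.
    rewrite translate_rt translate_cst1 tE.
    by rewrite (real_unit rT) // (real_unit rT').
  rewrite !ffunE gev_ract => {2}<-.
  by apply: eq_ract => x; rewrite ffunE.
exists t => //; apply/(gauge_transformP char0 abelA _ _ gt) => lam m f h Fh.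
apply: (real_eq rT (mu := lam)) => kap g.
have Fh' : in_F (lam - (lam - m)) (translate g h) by rewrite subKr; apply: in_F_translate.
rewrite translate_rt !translate_op tE (fun_mulr (real_fun rT') _ _ Fh').
rewrite !translate_rt (@fun_mulr _ _ _ _ _ _ (real_fun rT) kap (lam - m)); first by rewrite !tE.
by rewrite subKr; apply/wt/in_F_translate.
Qed.

End GaugeFromRealization.

(** * The exchange construction *)

Section Transposition.
Variables (k : closedFieldType) (gT : finGroupType) (A : {group gT}).
Hypotheses (char0 : [pchar k] =i pred0) (abelA : abelian A).

Notation dualA := (dual k A).
Notation fn := {ffun gT -> k^o}.
Notation kGG := (galg k [the finGroupType of (gT * gT)%type]).
Implicit Types (f h : fn) (x g y : gT) (lam mu nu kap m : dualA).

Lemma functorial_graded (J : dualA -> kGG) (n_ : dualA -> nat) (T : hom_family n_) :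
  (forall lam mu m f, in_F m f -> m != mu - lam -> T lam mu f = 0) ->
  (forall lam m (n : dualA) f h, in_F m f -> in_F n h -> in_F (m + n) (op (J lam) f h)) ->
  (forall lam mu nu f h, in_F (mu - lam) f -> in_F (nu - mu) h ->
     T lam nu (op (J nu) f h) = T lam mu f *m T mu nu h) ->
  functorial J T.
Proof.
move=> T0 wt TM; split=> // lam nu f h.
have Tpr lam' mu f' : T lam' mu f' = T lam' mu (pr (mu - lam') f').
  rewrite -[f' in LHS](pr_sum char0 abelA) linear_sum (bigD1 (mu - lam')) //= big1 ?addr0 //.
  by move=> m nm; apply: T0 nm; apply: pr_in.
rewrite -[h in LHS](pr_sum char0 abelA) op_sumr linear_sum /=.
rewrite (reindex_inj (can_inj (subKr nu))) /=; apply: eq_bigr => mu _.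
rewrite -[f in LHS](pr_sum char0 abelA) op_suml linear_sum (bigD1 (mu - lam)) //=.
rewrite big1 ?addr0 => [|m nm].
  by rewrite (TM _ mu) -?Tpr //; apply: pr_in.
apply: (T0 _ _ (m + (nu - mu))); first by apply: wt; apply: pr_in.
apply: contra nm => /eqP e; rewrite -(inj_eq (addIr (nu - mu))) e.
by rewrite [eqbRHS]addrC addrA subrK.
Qed.

Section Pair.
Variables (d : datum k A) (lam kap m : dualA).
Notation K := (stab d).
Notation W := (tens_rep (rep d lam) (dual_rep (rep d kap))).
Variable E : 'Hom({ffun gT -> 'cV[k]_(vdim d lam * vdim d kap)}, {ffun gT -> 'cV[k]_1}).

(* The functor of the exchange construction: the entries of Psi are those of transp
   at matrix coefficients. *)
Definition transp f : 'M[k]_(vdim d kap, vdim d lam) :=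
  \matrix_(j, i) ((#|A|%:R)^-1 * \sum_g (f g : k) * E (ind_gen K W
    (tensmx (delta_mx i 0 : 'cV[k]_(vdim d lam)) (delta_mx j 0 : 'cV[k]_(vdim d kap)))) g 0 0).

Lemma transp_is_linear : linear transp.
Proof.
move=> c f h; apply/matrixP => j i; rewrite !mxE mulrCA -mulrDr; congr (_ * _).
rewrite mulr_sumr -big_split; apply: eq_bigr => g _ /=.
by rewrite fnD fnZ mulrDl mulrA.
Qed.

Lemma ind_gen_is_linear n (V : gT -> 'M[k]_n) : linear (ind_gen K V).
Proof.
move=> c u v; apply/ffunP=> g; rewrite !ffunE; case: ifP => _; last by rewrite scaler0 addr0.
by rewrite mulmxDr scalemxAr.
Qed.

Lemma vec_sum (Y : 'M[k]_(vdim d lam, vdim d kap)) :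
  vec Y = \sum_i \sum_j Y i j *: tensmx (delta_mx i 0 : 'cV[k]_(vdim d lam))
                                       (delta_mx j 0 : 'cV[k]_(vdim d kap)).
Proof.
have [v vE] := hom_of_linear (@vec_is_linear k (vdim d lam) (vdim d kap)).
rewrite -vE [Y in LHS]matrix_sum_delta linear_sum; apply: eq_bigr => i _.
by rewrite linear_sum; apply: eq_bigr => j _; rewrite linearZ /= vE tens_delta.
Qed.

(** The transposition property: trace pairing on matrices against the pairing |A|^-1 Σ_g f(g) F(g)
    on functions. Equivariance and injectivity of [transp] are read off from it. *)
Lemma transp_trace f Y :
  \tr (Y *m transp f) = (#|A|%:R)^-1 * \sum_g (f g : k) * E (ind_gen K W (vec Y)) g 0 0.
Proof.
have [v vE] := hom_of_linear (@ind_gen_is_linear _ W).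
under [in RHS]eq_bigr => g _.
  rewrite -vE vec_sum !linear_sum sum_ffunE summxE mulr_sumr.
  under eq_bigr => i _ do rewrite !linear_sum sum_ffunE summxE mulr_sumr.
over.
rewrite /= exchange_big mulr_sumr; apply: eq_bigr => i _.
rewrite mxE exchange_big mulr_sumr; apply: eq_bigr => j _ /=.
rewrite mxE mulrCA; congr (_ * _); rewrite mulr_sumr; apply: eq_bigr => g _.
by rewrite !linearZ /= vE !ffunE mxE mulrCA.
Qed.

Hypothesis EI : Ind_iso K A W (dual_mx m) E.

Lemma ind_gen_translate x Y : x \in K ->
  ind_gen K W (vec (cj x Y)) = translate x (ind_gen K W (vec Y)).
Proof.
move=> Kx; apply/ffunP=> g; rewrite !ffunE groupMl ?groupV //; case: ifP => // Kg.
by rewrite !tens_cj invMg invgK cjM ?groupV.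
Qed.

Lemma ind_gen_in Y : in_Ind K W (ind_gen K W (vec Y)).
Proof.
move=> g x Kx; rewrite !ffunE groupMr //; case: ifP => Kg; last by rewrite mulmx0.
by rewrite !tens_cj invMg cjM ?groupV.
Qed.

Lemma ind_sum F : in_Ind K W F ->
  F = (#|K|%:R)^-1 *: \sum_g translate g (ind_gen K W (F g)).
Proof.
move=> IF; apply/ffunP=> y; rewrite ffunE sum_ffunE.
rewrite (eq_bigr (fun g => if (g^-1 * y)%g \in K then F y else 0)); last first.
  move=> g _; rewrite translateE ffunE; case: ifP => // Kg.
  have -> : F y = F (g * (g^-1 * y))%g by rewrite mulKVg.
  by rewrite IF.
rewrite -big_mkcond /= (reindex_inj invg_inj) (reindex_inj (mulIg y^-1%g)) /=.
under eq_bigl => g do rewrite invgK mulgKV.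
by rewrite sumr_const -scaler_nat scalerA mulVf ?scale1r // cardG_neq0.
Qed.

Lemma transp_equiv x f : x \in K -> transp (translate x f) = cj x (transp f).
Proof.
move=> Kx; have [E1 E2 E3 E4] := EI; apply: mxtrace_inj => Y.
rewrite -[in RHS](@cjVK _ _ _ d _ _ _ Kx Y) cj_mul // mxtrace_cj // !transp_trace.
congr (_ * _); rewrite (reindex_inj (mulgI x)) /=; apply: eq_bigr => g _.
rewrite translateE mulKg ind_gen_translate ?groupV // E4; last exact: ind_gen_in.
by rewrite translateE invgK.
Qed.

(** The hypothesis says that f is orthogonal to E(F) for F a translate of a generator, hence for
    every induced F; these E(F) fill the whole module induced from m. *)
Lemma transp_inj f : in_F m f -> (forall g, transp (translate g f) = 0) -> f = 0.
Proof.
move=> Ff e; have [E1 E2 E3 E4] := EI.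
have sum0 F : in_Ind K W F -> \sum_y (f y : k) * E F y 0 0 = 0.
  move=> IF; rewrite (ind_sum IF) linearZ linear_sum /=.
  under eq_bigr => y _ do rewrite ffunE mxE mulrCA sum_ffunE summxE mulr_sumr.
  rewrite -mulr_sumr exchange_big big1 ?mulr0 // => g _ /=.
  have := transp_trace (translate g^-1%g f) (unvec (F g)).
  rewrite e mulmx0 mxtrace0 unvecK => /esym/eqP.
  rewrite mulf_eq0 invr_eq0 (negPf (cardG_neq0 char0 A)) => /eqP e0.
  rewrite -[RHS]e0 [LHS](reindex_inj (mulgI g)); apply: eq_bigr => y _ /=.
  rewrite E4; last by rewrite -[F g]unvecK; apply: ind_gen_in.
  by rewrite !translateE invgK mulKg.
apply/ffunP=> y; rewrite fn0.
(* Supported on the coset yA and normalized so that its pairing with f is |A| f(y). *)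
pose F' : {ffun gT -> 'cV[k]_1} :=
  [ffun g => if (y^-1 * g)%g \in A then (m (y^-1 * g)^-1%g)%:M else 0].
have IF' : in_Ind A (dual_mx m) F'.
  move=> g a Aa; rewrite !ffunE mulgA groupMr //; case: ifP => Ag; last by rewrite mulmx0.
  by rewrite invMg dualM ?groupV // -scalar_mxM.
have [F IF EF] := E3 _ IF'; have := sum0 F IF.
rewrite EF (reindex_inj (mulgI y)) (bigID (mem A)) /= [X in _ + X]big1 ?addr0; last first.
  by move=> a nAa; rewrite ffunE mulKg (negPf nAa) mxE mulr0.
rewrite (eq_bigr (fun=> (f y : k))) => [|a Aa].
  rewrite sumr_const -mulr_natr => /eqP; rewrite mulf_eq0 (negPf (cardG_neq0 char0 A)) orbF.
  by move/eqP.
rewrite ffunE mulKg Aa mxE eqxx mulr1n Ff // dualV // mulrAC.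
by rewrite mulfV ?mul1r // dual_neq0.
Qed.

End Pair.
End Transposition.

Section Exchange.
Variables (k : closedFieldType) (gT : finGroupType) (A : {group gT}).
Hypotheses (char0 : [pchar k] =i pred0) (abelA : abelian A).

Notation dualA := (dual k A).
Notation fn := {ffun gT -> k^o}.
Notation kGG := (galg k [the finGroupType of (gT * gT)%type]).
Implicit Types (f h : fn) (x g y : gT) (lam mu nu kap m : dualA).

Definition mcoef n (X : gT -> 'M[k]_n) (v : 'cV[k]_n) (s : 'I_n) : fn :=
  [ffun g => (X g *m v) s 0].

Lemma mcoef_in n (X : mx_representation k [set: gT] n) mu v s :
  in_weight X mu v -> in_F mu (mcoef X v s).
Proof.
move=> wv g a Aa; rewrite !ffunE repr_mxM ?inE // -mulmxA (wv a Aa) -scalemxAr.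
by rewrite mxE.
Qed.

Lemma tens_colE p q (y : 'cV[k]_p) (x : 'cV[k]_q) r s :
  tensmx y x (mxtens_index (r, s)) 0 = y r 0 * x s 0.
Proof.
by rewrite mxE mxtens_indexK; congr (y r _ * x s _); apply: ord1.
Qed.

Lemma mcoef_tens p q (Y : mx_representation k [set: gT] p)
    (X : mx_representation k [set: gT] q) (u : kGG) (y : 'cV_p) (x : 'cV_q) r s :
  mcoef (tens_rep Y X) (act2 Y X u *m tensmx y x) (mxtens_index (r, s))
  = op u (mcoef Y y r) (mcoef X x s).
Proof.
apply/ffunP=> g; rewrite opE ffunE mulmx_suml mulmx_sumr summxE.
apply: eq_bigr => -[a b] _ /=; rewrite -scalemxAl -scalemxAr mxE; congr (_ * _).
rewrite /tens_rep !(@tensmx_mul _ p p q q 1 1) !ffunE !repr_mxM ?inE // -!mulmxA.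
exact: tens_colE.
Qed.

(** All functions under right translation. Every f in F_mu is a matrix coefficient of a vector of
    weight mu here, so this one module detects the exchange equation. *)
Definition rreg_mx g : 'M[k]_#|gT| :=
  \matrix_(i, j) (enum_val j == (enum_val i * g)%g)%:R.

Fact rreg_mx_repr : mx_repr [set: gT] rreg_mx.
Proof.
split=> [|x y _ _]; apply/matrixP => i j; rewrite !mxE.
  by rewrite mulg1 (inj_eq enum_val_inj) eq_sym.
rewrite (bigD1 (enum_rank (enum_val i * x)%g)) //= !mxE enum_rankK eqxx mul1r mulgA.
rewrite big1 ?addr0 // => l nl; rewrite !mxE.
by rewrite -(inj_eq enum_rank_inj) enum_valK (negPf nl) mul0r.
Qed.
Canonical rreg_repr := MxRepresentation rreg_mx_repr.

Definition fn_col f : 'cV[k]_#|gT| := \col_i f (enum_val i).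

Lemma rreg_fn_col g f : rreg_mx g *m fn_col f = fn_col [ffun x => f (x * g)%g].
Proof.
apply/matrixP => i j; rewrite !mxE ffunE (bigD1 (enum_rank (enum_val i * g)%g)) //=.
rewrite !mxE enum_rankK eqxx mul1r big1 ?addr0 // => l nl; rewrite !mxE.
by rewrite -(inj_eq enum_rank_inj) enum_valK (negPf nl) mul0r.
Qed.

Lemma rreg_weight mu f : in_F mu f -> in_weight rreg_repr mu (fn_col f).
Proof.
move=> Ff a Aa; rewrite [rreg_repr a]/(rreg_mx a) rreg_fn_col.
by apply/matrixP => i j; rewrite !mxE ffunE Ff.
Qed.

Lemma rreg_mcoef f : mcoef rreg_repr (fn_col f) (enum_rank 1%g) = f.
Proof.
apply/ffunP=> g; rewrite ffunE [rreg_repr g]/(rreg_mx g) rreg_fn_col.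
by rewrite mxE ffunE enum_rankK mul1g.
Qed.

Variable d : datum k A.
Notation n_ := (vdim d).

Section Eps.
Variable eps : forall lam mu : dualA, ind_hom d lam mu.

Lemma Psi_entry lam mu n (X : gT -> 'M[k]_n) (x : 'cV_n) j s i :
  Psi eps lam mu X x (mxtens_index (j, s)) i = transp (eps lam mu) (mcoef X x s) j i.
Proof.
rewrite !mxE mxtens_indexK /=; congr (_ * _); rewrite summxE; apply: eq_bigr => g _.
by rewrite -scalemxAr mxE ffunE mulrC.
Qed.

Lemma tensA_index lam mu nu p q (l : 'I_(n_ (lam - mu - nu)))
    (l' : 'I_(n_ (lam - (mu + nu)))) (r : 'I_p) (s : 'I_q) : l = l' :> nat ->
  cast_ord (esym (vdim_tensA d lam mu nu p q)) (mxtens_index (mxtens_index (l, r), s))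
  = mxtens_index (l', mxtens_index (r, s)).
Proof. by move=> e; apply/val_inj; rewrite /= e mulnDl addnA mulnA. Qed.

(** Entries of Psi are values of [transp] at matrix coefficients, so the identity for functions
    gives it for all modules; the right regular representation gives the converse. Requiring l and
    l' to be the same number replaces the cast. *)
Lemma exchange_equationP (J : dualA -> kGG) : exchange_equation eps J <->
  forall lam mu nu f h (l : 'I_(n_ (lam - mu - nu))) (l' : 'I_(n_ (lam - (mu + nu)))) i,
    in_F nu f -> in_F mu h -> l = l' :> nat ->
    (transp (eps (lam - mu) nu) f *m transp (eps lam mu) h) l i
    = transp (eps lam (mu + nu)) (op (J lam) f h) l' i.
Proof.
have LHS p q (Y : mx_representation k [set: gT] p) (X : mx_representation k [set: gT] q)
    lam mu nu (x : 'cV_q) (y : 'cV_p) l r s i :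
    (tensmx (Psi eps (lam - mu) nu Y y) (1%:M : 'M[k]_q) *m Psi eps lam mu X x)
      (mxtens_index (mxtens_index (l, r), s)) i
    = (transp (eps (lam - mu) nu) (mcoef Y y r) *m transp (eps lam mu) (mcoef X x s)) l i.
  rewrite [LHS]mxE [RHS]mxE (reindex (@mxtens_index _ _)) /=; last first.
    exists (@mxtens_unindex _ _) => ? _; [exact: mxtens_indexK | exact: mxtens_unindexK].
  transitivity (\sum_j \sum_s' tensmx (Psi eps (lam - mu) nu Y y) 1%:M
    (mxtens_index (mxtens_index (l, r), s)) (mxtens_index (j, s')) *
    Psi eps lam mu X x (mxtens_index (j, s')) i).
    by rewrite pair_bigA; apply: eq_bigr => -[].
  apply: eq_bigr => j _; rewrite (bigD1 s) //= big1 ?addr0 => [|s' ns].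
    by rewrite tensmxE !Psi_entry [_%:M _ _]mxE eqxx mulr1.
  by rewrite tensmxE [_%:M _ _]mxE eq_sym (negPf ns) mulr0 mul0r.
have RHS p q (Y : mx_representation k [set: gT] p) (X : mx_representation k [set: gT] q)
    lam mu nu (x : 'cV_q) (y : 'cV_p) (l : 'I_(n_ (lam - mu - nu)))
    (l' : 'I_(n_ (lam - (mu + nu)))) r s i : l = l' :> nat ->
    castmx (vdim_tensA d lam mu nu p q, erefl)
      (Psi eps lam (mu + nu) (tens_rep Y X) (act2 Y X (J lam) *m tensmx y x))
      (mxtens_index (mxtens_index (l, r), s)) i
    = transp (eps lam (mu + nu)) (op (J lam) (mcoef Y y r) (mcoef X x s)) l' i.
  by move=> e; rewrite castmxE /= (tensA_index _ _ e) cast_ord_id Psi_entry mcoef_tens.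
split=> [ex lam mu nu f h l l' i Ff Fh e|ex p q Y X lam mu nu x y wx wy].
  have := ex _ _ rreg_repr rreg_repr lam mu nu (fn_col h) (fn_col f)
    (rreg_weight Fh) (rreg_weight Ff).
  move/matrixP/(_ (mxtens_index (mxtens_index (l, enum_rank 1%g), enum_rank 1%g)) i).
  by rewrite LHS (RHS _ _ _ _ _ _ _ _ _ _ l') // !rreg_mcoef.
apply/matrixP => r i; case: (mxtens_indexP r) => r1 s; case: (mxtens_indexP r1) => l r2.
have e : vdim d (lam - mu - nu) = vdim d (lam - (mu + nu)) by rewrite opprD addrA.
rewrite LHS (RHS _ _ _ _ _ _ _ _ _ _ (cast_ord e l)) //.
by apply: ex => //; apply: mcoef_in.
Qed.

Lemma normalizedP : normalized eps <->
  forall lam (j : 'I_(n_ (lam - 0))) (j' : 'I_(n_ lam)) i, j = j' :> nat ->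
    transp (eps lam 0) cst1 j i = (1%:M : 'M[k]_(n_ lam)) j' i.
Proof.
have E lam (j : 'I_(n_ (lam - 0))) (j' : 'I_(n_ lam)) i : j = j' :> nat ->
    castmx (vdim_tens0 d lam, erefl) (Psi eps lam 0 (fun=> 1%:M) (1%:M : 'cV[k]_1)) j' i
    = transp (eps lam 0) cst1 j i.
  move=> e; rewrite castmxE /= cast_ord_id.
  have -> : cast_ord (esym (vdim_tens0 d lam)) j' = mxtens_index (j, 0 : 'I_1).
    by apply/val_inj; rewrite /= muln1 addn0 e.
  rewrite Psi_entry; congr (transp _ _ _ _).
  by apply/ffunP=> g; rewrite !ffunE mulmx1 mxE eqxx.
split=> [no lam j j' i e|no lam]; first by rewrite -(E _ _ j') // no.
apply/matrixP => j' i; have e : vdim d lam = vdim d (lam - 0) by rewrite subr0.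
by rewrite (E _ (cast_ord e j')) //; apply: no.
Qed.

End Eps.

Lemma hom_family_cast (T : hom_family n_) kap kap' lam f (j : 'I_(n_ kap)) (j' : 'I_(n_ kap')) i :
  kap = kap' -> j = j' :> nat -> T kap lam f j i = T kap' lam f j' i.
Proof. by move=> e; subst kap' => /val_inj ->. Qed.

Lemma twistP (J : twist k A) : is_twist J. Proof. by case: J. Qed.

(** The functor T kap lam is [transp] of eps lam (lam - kap), restricted to its weight and cast
    along lam - (lam - kap) = kap; the exchange equation is its functoriality. *)
Lemma exchange_realizable (J : twist k A) : exchange_twist d J -> realizable J d.
Proof.
case=> eps [epsI _ /exchange_equationP ex].
have [|T TE] := hom_family_ex (F := fun kap lam f =>
    castmx (congr1 n_ (subKr lam kap), erefl)
      (transp (eps lam (lam - kap)) (pr (lam - kap) f))).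
  move=> kap lam c f h; rewrite prD prZ transp_is_linear.
  by apply/matrixP => i j; rewrite !(mxE, castmxE).
have Tsub lam mu f : T (lam - mu) lam f = transp (eps lam mu) (pr mu f).
  rewrite TE; move: (congr1 _ _); move: (subKr lam mu) => e.
  by rewrite e => e'; rewrite (eq_irrelevance e' erefl) castmx_id.
have tJ := (is_twistP char0 abelA J).1 (twistP J).
have transp0 lam mu : transp (eps lam mu) 0 = 0.
  apply/matrixP => i j; rewrite !mxE big1 ?mulr0 // => g _.
  by rewrite fn0 mul0r.
exists T; split; [apply: (functorial_graded char0 abelA) | |].
- move=> lam mu m f Ff nm; rewrite TE (pr_out Ff) 1?eq_sym // transp0.
  by apply/matrixP => i j; rewrite castmxE !mxE.
- by move=> lam; case: (tJ lam).
- move=> lam mu nu f h Ff Fh.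
  have key L m (n : dualA) f' h' : in_F n f' -> in_F m h' ->
      T (L - m - n) L (op (J L) f' h') = T (L - m - n) (L - m) f' *m T (L - m) L h'.
    move=> Ff' Fh'; apply/matrixP => l i; rewrite !Tsub !pr_id //.
    have e : L - m - n = L - (m + n) by rewrite opprD addrA.
    rewrite (@hom_family_cast T _ _ L _ _ (cast_ord (congr1 n_ e) l) _ e) // Tsub pr_id //.
      by rewrite (ex _ _ _ _ _ _ (cast_ord (congr1 n_ e) l)).
    by case: (tJ L) => _ wt _ _ _; rewrite addrC; apply: wt.
  by have := key nu (nu - mu) (mu - lam) f h Ff Fh; rewrite !subKr.
- move=> lam mu x f Kx; rewrite -(subKr mu lam); set m := mu - lam.
  by rewrite !Tsub -translate_pr (transp_equiv (epsI mu m)).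
- move=> mu f e; rewrite -[f](pr_sum char0 abelA) big1 // => m _.
  apply: (transp_inj char0 (epsI mu m) (pr_in m f)) => g.
  by rewrite translate_pr -Tsub e.
Qed.

(** E is the transpose of T for the pairings of [transp_trace]. Injectivity comes from the
    surjectivity of T onto induced functions; being onto then follows by comparison with the
    isomorphism of the datum. *)
Lemma real_ind_iso (J : dualA -> kGG) (T : hom_family n_) lam kap : realizes J T ->
  exists E : 'Hom({ffun gT -> 'cV[k]_(n_ lam * n_ kap)}, {ffun gT -> 'cV[k]_1}),
    Ind_iso (stab d) A (tens_rep (rep d lam) (dual_rep (rep d kap)))
      (dual_mx (lam - kap)) E /\
    forall f, transp E f = T kap lam f.
Proof.
move=> rT; pose K := stab d; pose W := tens_rep (rep d lam) (dual_rep (rep d kap)).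
(* On a generator the sum over g below has |K| equal terms, and [transp] divides by |A|; with this c
   the transpose is exactly T. *)
pose c : k := #|A|%:R / #|K|%:R.
have c0 : c != 0 by rewrite mulf_neq0 ?invr_eq0 ?cardG_neq0.
pose e (F : {ffun gT -> 'cV[k]_(n_ lam * n_ kap)}) y : k :=
  c * \sum_g \tr (unvec (F g) *m T kap lam (translate g^-1%g (delta y))).
have [|E EE] := @hom_of_linear k {ffun gT -> 'cV[k]_(n_ lam * n_ kap)}
    {ffun gT -> 'cV[k]_1} (fun F => [ffun y => (e F y)%:M]).
  move=> a F F'; apply/ffunP=> y; rewrite !ffunE /e scale_scalar_mx -raddfD /=.
  congr (_ %:M); rewrite mulrCA -mulrDr; congr (_ * _).
  rewrite mulr_sumr -big_split; apply: eq_bigr => g _; rewrite !ffunE unvec_is_linear mulmxDl mxtraceD.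
  by rewrite -scalemxAl mxtraceZ.
have EE' F y : E F y 0 0 = e F y by rewrite EE ffunE mxE eqxx mulr1n.
have sumE F f : \sum_y (f y : k) * E F y 0 0
    = c * \sum_g \tr (unvec (F g) *m T kap lam (translate g^-1%g f)).
  under eq_bigr => y _ do rewrite EE' /e mulrCA mulr_sumr.
  rewrite -mulr_sumr exchange_big; congr (_ * _); apply: eq_bigr => g _ /=.
  rewrite [f in RHS]fn_delta translate_sum linear_sum mulmx_sumr raddf_sum /=.
  apply: eq_bigr => y _; rewrite translateZ linearZ /= -scalemxAr mxtraceZ.
  by [].
have tr_in F Z : in_Ind K W F -> (forall g x, x \in K -> Z (g * x)%g = cj x^-1%g (Z g)) ->
    forall g x, x \in K -> \tr (unvec (F (g * x)%g) *m Z (g * x)%g) = \tr (unvec (F g) *m Z g).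
  move=> IF eZ g x Kx; rewrite IF // eZ // -[F g]unvecK tens_cj !vecK.
  by rewrite cj_mul ?groupV // mxtrace_cj ?groupV.
have Teq f g x : x \in K ->
    T kap lam (translate (g * x)^-1%g f) = cj x^-1%g (T kap lam (translate g^-1%g f)).
  by move=> Kx; rewrite invMg translateM (real_equiv rT) ?groupV.
(* F(g0) is tested against Y by an f whose induced function is supported on g0 K with value Y at
   g0. *)
have iE F : in_Ind K W F -> E F = 0 -> F = 0.
  move=> IF E0; apply/ffunP=> g0; rewrite ffunE; apply: (can_inj (@unvecK _ _ _)).
  apply: mxtrace_inj => Y; rewrite mxtrace_mulC -[0](vec0 k) vecK mulmx0 mxtrace0.
  have [|f _ fE] := real_surj rT (lam := kap) (mu := lam) (F := fun g =>
      if (g0^-1 * g)%g \in K then cj (g0^-1 * g)^-1%g Y else 0).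
    move=> g x Kx; rewrite mulgA groupMr //; case: ifP => Kg; last by rewrite cj0.
    by rewrite invMg cjM ?groupV.
  have := sumE F f; rewrite E0 big1 => [/esym/eqP|y _]; last by rewrite ffunE mxE mulr0.
  rewrite mulf_eq0 (negPf c0) (reindex_inj (mulgI g0)) (bigID (mem K)) /=.
  rewrite [X in _ + X]big1 ?addr0 => [|x nKx]; last first.
    by rewrite fE mulKg (negPf nKx) mulmx0 mxtrace0.
  rewrite (eq_bigr (fun=> \tr (unvec (F g0) *m Y))) => [|x Kx].
    by rewrite sumr_const -mulr_natr mulf_eq0 (negPf (cardG_neq0 char0 _)) orbF => /eqP.
  by rewrite fE mulKg Kx IF // -[F g0]unvecK tens_cj !vecK cj_mul ?groupV // mxtrace_cj ?groupV.
have lE : linear E by exact: linearP.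
have [D [D1 D2 D3 D4]] := rep_ind d lam kap.
have P0 : in_Ind K W 0 by move=> g x Kx; rewrite !ffunE mulmx0.
have PL (a : k) u v : in_Ind K W u -> in_Ind K W v -> in_Ind K W (a *: u + v).
  by move=> Pu Pv g x Kx; rewrite !ffunE Pu // Pv // mulmxDr scalemxAr.
have prd m y a : a \in A -> pr m (delta (y * a)%g) = (m a)^-1 *: pr m (delta y : fn).
  move=> Aa; apply/ffunP=> g; rewrite fnZ !prE mulrCA; congr (_ * _).
  rewrite mulr_sumr (reindex_inj (mulIg a)) /=; apply: eq_big => [b|b Ab].
    by rewrite groupMr.
  move: Ab; rewrite groupMr // => Ab; rewrite dualM // invfM !ffunE mulgA (inj_eq (mulIg a)).
  by rewrite mulrAC mulrC mulrA.
have wE F : in_Ind K W F -> in_Ind A (dual_mx (lam - kap)) (E F).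
  move=> _ y a Aa; rewrite !EE !ffunE -scalar_mxM dualV // mulrCA; congr (_%:M).
  congr (_ * _); rewrite mulr_sumr; apply: eq_bigr => g _.
  rewrite -(fun_pr char0 abelA (real_fun rT)) -translate_pr prd // translateZ linearZ /=.
  by rewrite translate_pr (fun_pr char0 abelA (real_fun rT)) -scalemxAr mxtraceZ.
exists E; split; [split=> // | move=> f].
- exact: (inj_same_surj P0 PL (linearP D) lE D2 D3 wE iE).
- move=> h F _; apply/ffunP=> y; rewrite translateE !EE !ffunE /e; congr (_ * _)%:M.
  rewrite (reindex_inj (mulgI h)); apply: eq_bigr => g _ /=.
  by rewrite translateE mulKg invMg translateM translate_delta.
apply: mxtrace_inj => Y; rewrite transp_trace // sumE (bigID (mem K)) /=.
rewrite [X in _ + X]big1 ?addr0 => [|g nKg]; last first.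
  by rewrite ffunE (negPf nKg) -[0](vec0 k) vecK mul0mx mxtrace0.
rewrite (eq_bigr (fun=> \tr (Y *m T kap lam f))) => [|g Kg].
  rewrite sumr_const -[\tr _ *+ _]mulr_natr /c -[_ / _ * _]mulrA mulKf ?cardG_neq0 //.
  by rewrite mulrCA mulVf ?mulr1 ?cardG_neq0.
rewrite ffunE Kg tens_cj vecK (real_equiv rT) ?groupV // cj_mul ?groupV //.
by rewrite mxtrace_cj ?groupV.
Qed.

Lemma realizable_exchange (J : twist k A) : realizable J d -> exchange_twist d J.
Proof.
case=> T rT.
have ex lam mu : exists E : ind_hom d lam mu,
    Ind_iso (stab d) A (tens_rep (rep d lam) (dual_rep (rep d (lam - mu)))) (dual_mx mu) E /\
    forall f, transp E f = T (lam - mu) lam f.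
  by have := real_ind_iso lam (lam - mu) rT; rewrite subKr.
have /fin_all_exists[eps epsP] lam := fin_all_exists (ex lam).
have tJ := (is_twistP char0 abelA J).1 (twistP J).
exists eps; split.
- by move=> lam mu; case: (epsP lam mu).
- apply/normalizedP => lam j j' i e; have [_ ->] := epsP lam 0.
  rewrite (@hom_family_cast T _ _ lam cst1 _ _ i (subr0 lam) e) (real_unit rT) //.
  by case: (tJ lam).
apply/exchange_equationP => lam mu nu f h l l' i Ff Fh e.
rewrite (epsP _ _).2 (epsP _ _).2 (epsP _ _).2.
have eq : lam - mu - nu = lam - (mu + nu) by rewrite opprD addrA.
rewrite -(@hom_family_cast T _ _ lam _ _ _ i eq e) (@fun_mulr _ _ _ _ _ _ (real_fun rT) _ (lam - mu)) //.
by rewrite subKr.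
Qed.

End Exchange.

(** * Existence of a twist for a datum *)

Section TwistFromDatum.
Variables (k : closedFieldType) (gT : finGroupType) (A : {group gT}).
Hypotheses (char0 : [pchar k] =i pred0) (abelA : abelian A).

Notation dualA := (dual k A).
Notation fn := {ffun gT -> k^o}.
Notation kGG := (galg k [the finGroupType of (gT * gT)%type]).
Implicit Types (f h : fn) (x g y : gT) (lam mu nu kap m : dualA).

Variable d : datum k A.
Notation K := (stab d).
Notation n_ := (vdim d).

Lemma cst1_neq0 : (cst1 : fn) != 0.
Proof. by apply/eqP => /ffunP/(_ 1%g)/eqP; rewrite !ffunE oner_eq0. Qed.

(** For each pair, T is the transpose of an arbitrary isomorphism of induced modules; compatibility
    between pairs is imposed later through the definition of J. T lam lam cst1 is invariant under K,
    thus scalar, and nonzero by injectivity, so it can be rescaled to the identity. *)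
Lemma hom_family_of_datum : exists T : hom_family n_,
  [/\ forall lam mu m f, in_F m f -> m != mu - lam -> T lam mu f = 0,
      forall lam mu x f, x \in K -> T lam mu (translate x f) = cj x (T lam mu f),
      forall lam mu f, in_F (mu - lam) f ->
        (forall g, T lam mu (translate g f) = 0) -> f = 0
    & forall lam, T lam lam cst1 = 1%:M].
Proof.
have ex lam mu : exists T : 'Hom(fn, 'M[k]_(n_ lam, n_ mu)),
  [/\ forall m f, in_F m f -> m != mu - lam -> T f = 0,
      forall x f, x \in K -> T (translate x f) = cj x (T f)
    & forall f, in_F (mu - lam) f -> (forall g, T (translate g f) = 0) -> f = 0].
  have [E EI] := rep_ind d mu lam.
  have [|T TE] := @hom_of_linear k fn _ (fun f => transp E (pr (mu - lam) f)).
    by move=> c f h; rewrite prD prZ transp_is_linear.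
  exists T; split.
  - move=> m f Ff nm; rewrite TE (pr_out Ff) 1?eq_sym //.
    apply/matrixP => i j; rewrite !mxE big1 ?mulr0 // => g _.
    by rewrite fn0 mul0r.
  - by move=> x f Kx; rewrite !TE -translate_pr (transp_equiv EI).
  move=> f Ff e; apply: (transp_inj char0 EI Ff) => g.
  by rewrite -(e g) TE pr_id //; apply: in_F_translate.
have /fin_all_exists[T TP] lam := fin_all_exists (ex lam).
have /choice[c cP] lam : exists c, T lam lam cst1 = c%:M.
  by apply: cj_scalar => x Kx; have [_ <- //] := TP lam lam; rewrite translate_cst1.
have c0 lam : c lam != 0.
  apply: contraNneq cst1_neq0 => c0; apply/eqP; have [_ _ ti] := TP lam lam.
  apply: ti => [|g]; first by rewrite subrr; apply: in_F_cst1.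
  by rewrite translate_cst1 cP c0 raddf0.
exists (fun lam mu => (c mu)^-1 *: T lam mu); split.
- move=> lam mu m f Ff nm; have [t _ _] := TP lam mu.
  by rewrite scale_lfunE (t _ _ Ff nm) scaler0.
- move=> lam mu x f Kx; have [_ t _] := TP lam mu.
  by rewrite !scale_lfunE t // /cj -scalemxAr -scalemxAl.
- move=> lam mu f Ff e; have [_ _ t] := TP lam mu.
  apply: t => // g; have := e g; rewrite scale_lfunE => /eqP.
  by rewrite scaler_eq0 invr_eq0 (negPf (c0 mu)) => /eqP.
by move=> lam; rewrite scale_lfunE cP scale_scalar_mx mulVf.
Qed.

Section FromFamily.
Variable T : hom_family n_.
Hypothesis Tw : forall lam mu m f, in_F m f -> m != mu - lam -> T lam mu f = 0.
Hypothesis Teq : forall lam mu x f, x \in K -> T lam mu (translate x f) = cj x (T lam mu f).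
Hypothesis Ti : forall lam mu f, in_F (mu - lam) f ->
        (forall g, T lam mu (translate g f) = 0) -> f = 0.
Hypothesis T1 : forall lam, T lam lam cst1 = 1%:M.

Lemma hom_family_pr lam mu f : T lam mu (pr (mu - lam) f) = T lam mu f.
Proof.
rewrite -[f in RHS](pr_sum char0 abelA) linear_sum (bigD1 (mu - lam)) //= big1 ?addr0 //.
by move=> m nm; apply: Tw nm; apply: pr_in.
Qed.

Lemma hom_family_inj mu f : (forall lam g, T lam mu (translate g f) = 0) -> f = 0.
Proof.
move=> e; rewrite -[f](pr_sum char0 abelA) big1 // => m _.
apply: (@Ti (mu - m) mu); first by rewrite subKr; apply: pr_in.
by move=> g; rewrite translate_pr; have := hom_family_pr (mu - m) mu (translate g f); rewrite subKr => ->.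
Qed.

Lemma hom_family_surj mu (F : forall lam, gT -> 'M[k]_(n_ lam, n_ mu)) :
  (forall lam g x, x \in K -> F lam (g * x)%g = cj x^-1%g (F lam g)) ->
  exists f, forall lam g, T lam mu (translate g^-1%g f) = F lam g.
Proof.
move=> eF.
have ex lam : exists f, in_F (mu - lam) f /\ forall g, T lam mu (translate g^-1%g f) = F lam g.
  have [|||f] := @hom_surj _ _ _ d lam mu (T lam mu) (F lam); last by exists f.
  - by move=> x f; apply: Teq.
  - by move=> f; apply: Ti.
  - exact: eF.
have [f fP] := choice ex; exists (\sum_lam f lam) => lam g.
rewrite translate_sum linear_sum (bigD1 lam) //= big1 ?addr0 ?(fP lam).2 // => lam' nl.
apply: (Tw (in_F_translate _ (fP lam').1)).
by apply: contra nl => /eqP/addrI/oppr_inj ->.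
Qed.

(** The constant induced function Y comes from some f in F_(mu - lam), which is invariant under
    translation and so constant. Constants have weight 0 and are killed by T lam mu. *)
Lemma invariant_zero lam mu (Y : 'M[k]_(n_ lam, n_ mu)) : lam != mu ->
  (forall x, x \in K -> cj x Y = Y) -> Y = 0.
Proof.
move=> nlm eY; have [|||f Ff fE] := @hom_surj _ _ _ d lam mu (T lam mu) (fun=> Y).
- by move=> x f; apply: Teq.
- by move=> f; apply: Ti.
- by move=> g x Kx; rewrite eY ?groupV.
have invf x : translate x f = f.
  apply/eqP; rewrite -subr_eq0; apply/eqP/(@Ti lam mu).
    by rewrite -scaleN1r; apply: in_FD => //; [apply: in_F_translate | apply: in_FZ].
  move=> g; rewrite -[g]invgK -scaleN1r translateD translateZ -translateM linearD linearZ /=.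
  by rewrite -[(_ * _)%g]invgK !fE scaleN1r subrr.
have ef : f = f 1%g *: cst1.
  by apply/ffunP=> g; rewrite fnZ ffunE mulr1; apply: in_F_inv.
rewrite -(fE 1%g) invg1 translate1 ef linearZ /= (Tw (@in_F_cst1 k gT A)) ?scaler0 //.
by rewrite eq_sym subr_eq0 eq_sym.
Qed.

(* Schur orthogonality for the pairwise non-isomorphic V_mu. *)
Lemma coef_free (X : forall mu, 'M[k]_(n_ mu)) :
  (forall x, x \in K -> \sum_mu \tr (invmx (rep d mu x) *m X mu) = 0) ->
  forall mu, X mu = 0.
Proof.
move=> e kap; apply/matrixP => a b; rewrite mxE.
(* The average over K vanishes for mu different from kap, and for mu = kap it is a scalar computed
   by its trace. *)
pose Y mu (M : 'M[k]_(n_ kap, n_ mu)) := \sum_(x in K) cj x M.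
have Yinv mu M x : x \in K -> cj x (Y mu M) = Y mu M.
  move=> Kx; have [c cE] := hom_of_linear (@cj_is_linear _ _ _ d kap mu x).
  rewrite -cE linear_sum [RHS](reindex_inj (mulgI x)) /=.
  by apply: eq_big => [y|y Ky]; rewrite ?groupMl // cE cjM.
have nK : #|K|%:R != 0 :> k by apply: cardG_neq0.
have nn : (n_ kap)%:R != 0 :> k by rewrite natf0 // -lt0n vdim_gt0.
have Yout mu (M : 'M[k]_(n_ kap, n_ mu)) : kap != mu -> Y mu M = 0.
  by move=> nkm; apply: invariant_zero => // x Kx; apply: Yinv.
have Yin (M : 'M[k]_(n_ kap)) : Y kap M = (#|K|%:R / (n_ kap)%:R * \tr M)%:M.
  have [c Yc] : exists c, Y kap M = c%:M by apply: cj_scalar => x Kx; apply: Yinv.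
  rewrite Yc; congr (_%:M); have := congr1 mxtrace Yc.
  rewrite mxtrace_scalar linear_sum (eq_bigr (fun=> \tr M)) => [|x Kx]; last first.
    by rewrite /= mxtrace_cj.
  rewrite sumr_const -[\tr _ *+ _]mulr_natl -[c *+ _]mulr_natr => ec.
  by rewrite mulrAC ec mulfK.
have : \sum_(x in K) rep d kap x a b * \sum_mu \tr (invmx (rep d mu x) *m X mu) = 0.
  by rewrite big1 // => x Kx; rewrite e // mulr0.
under eq_bigr => x _ do rewrite mulr_sumr.
rewrite exchange_big (bigD1 kap) //=.
have S mu : \sum_(x in K) rep d kap x a b * \tr (invmx (rep d mu x) *m X mu)
    = \sum_c \sum_t Y mu (delta_mx b c) a t * X mu t c.
  transitivity (\sum_(x in K) \sum_c \sum_t cj x (delta_mx b c) a t * X mu t c).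
    apply: eq_bigr => x _; rewrite mulr_sumr; apply: eq_bigr => c _.
    rewrite mxE mulr_sumr; apply: eq_bigr => t _; rewrite mulrA; congr (_ * _).
    rewrite /cj -mulmxA mxE (bigD1 b) //= big1 ?addr0 => [|l nl]; last first.
      by rewrite mxE big1 ?mulr0 // => l' _; rewrite mxE (negPf nl) mul0r.
    congr (_ * _); rewrite mxE (bigD1 c) //= big1 ?addr0 => [|l nl]; last first.
      by rewrite mxE (negPf nl) andbF mul0r.
    by rewrite mxE !eqxx mul1r.
  rewrite exchange_big; apply: eq_bigr => c _; rewrite exchange_big; apply: eq_bigr => t _.
  by rewrite summxE mulr_suml.
rewrite S [X in _ + X]big1 ?addr0 => [|mu nmu]; last first.
  rewrite S big1 // => c _; rewrite big1 // => t _.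
  by rewrite Yout 1?eq_sym // mxE mul0r.
rewrite (bigD1 b) //= [X in _ + X]big1 ?addr0 => [|c nc]; last first.
  rewrite big1 // => t _; rewrite Yin mxE mxtrace_delta eq_sym (negPf nc) mulr0.
  by rewrite mul0rn mul0r.
rewrite (bigD1 a) //= [X in _ + X]big1 ?addr0 => [|t nt]; last first.
  by rewrite Yin mxE eq_sym (negPf nt) mulr0n mul0r.
rewrite Yin mxE !eqxx mulr1n /= => /eqP.
rewrite mxtrace_delta eqxx mulr1 mulf_eq0 mulf_eq0 invr_eq0 (negPf nK) (negPf nn) /=.
by move/eqP.
Qed.

(** For f and h there is a unique r with T(g r) = Σ T(g f) T(g h) for all g, since the right side is
    an induced function. The map (f, h) ↦ r is bilinear and commutes with translations, hence is
    given by an element of k[G x G], with coefficients its values at 1 on delta functions. *)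
Lemma family_composition : exists J : dualA -> kGG, forall lam nu f h,
  T lam nu (op (J nu) f h) = \sum_mu T lam mu f *m T mu nu h.
Proof.
have exM nu (p : fn * fn) : exists r, forall lam g, T lam nu (translate g r)
    = \sum_mu T lam mu (translate g p.1) *m T mu nu (translate g p.2).
  have [|r rE] := @hom_family_surj nu (fun lam g => \sum_mu
      T lam mu (translate g^-1%g p.1) *m T mu nu (translate g^-1%g p.2)).
    move=> lam g x Kx; have [c cE] := hom_of_linear (@cj_is_linear _ _ _ d lam nu x^-1%g).
    rewrite -cE linear_sum; apply: eq_bigr => mu _ /=.
    by rewrite cE invMg !translateM !(@Teq _ _ x^-1%g) ?groupV // cj_mul ?groupV.
  by exists r => lam g; rewrite -{1}[g]invgK rE invgK.
have /choice[M' MP'] (q : dualA * (fn * fn)) := exM q.1 q.2.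
pose M nu p := M' (nu, p); have MP nu p lam g : T lam nu (translate g (M nu p))
    = \sum_mu T lam mu (translate g p.1) *m T mu nu (translate g p.2) by apply: (MP' (nu, p)).
have Meq nu r p : (forall lam g, T lam nu (translate g r)
    = \sum_mu T lam mu (translate g p.1) *m T mu nu (translate g p.2)) -> r = M nu p.
  move=> e; apply/eqP; rewrite -subr_eq0; apply/eqP/(@hom_family_inj nu) => lam g.
  by rewrite -scaleN1r translateD translateZ linearD linearZ /= e MP scaleN1r subrr.
exists (fun nu => gfun (fun p => M nu (delta p.1, delta p.2) 1%g)) => lam nu f h /=.
transitivity (T lam nu (M nu (f, h))); last first.
  by rewrite -[M nu _]translate1 MP !translate1.
congr (T lam nu _); apply/ffunP=> g.
have -> : M nu (f, h) g = M nu (translate g^-1%g f, translate g^-1%g h) 1%g.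
  have -> : M nu (translate g^-1%g f, translate g^-1%g h) = translate g^-1%g (M nu (f, h)).
    by apply/esym/Meq => lam' x; rewrite -!translateM MP.
  by rewrite translateE invgK mulg1.
have -> : M nu (translate g^-1%g f, translate g^-1%g h) = \sum_x \sum_y
    ((f (g * x)%g : k) * (h (g * y)%g : k)) *: M nu (delta x, delta y).
  apply/esym/Meq => lam' z /=; rewrite translate_sum linear_sum /=.
  transitivity (\sum_x \sum_y \sum_mu (f (g * x)%g *: T lam' mu (translate z (delta x)))
      *m (h (g * y)%g *: T mu nu (translate z (delta y)))).
    apply: eq_bigr => x _; rewrite translate_sum linear_sum; apply: eq_bigr => y _.
    rewrite translateZ linearZ /= MP scaler_sumr; apply: eq_bigr => mu _ /=.
    by rewrite -scalemxAl -scalemxAr scalerA.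
  under [LHS]eq_bigr => x _ do rewrite exchange_big /=.
  rewrite exchange_big; apply: eq_bigr => mu _ /=.
  rewrite [translate g^-1 f in RHS]fn_delta [translate g^-1 h in RHS]fn_delta.
  rewrite !translate_sum (linear_sum (T lam' mu)) (linear_sum (T mu nu)) mulmx_suml; apply: eq_bigr => x _.
  rewrite mulmx_sumr; apply: eq_bigr => y _.
  by rewrite !translateZ !linearZ /= !translateE invgK.
rewrite opE fn_sum.
under [RHS]eq_bigr => x _ do rewrite fn_sum.
rewrite pair_bigA; apply: eq_bigr => -[x y] _ /=.
by rewrite gcoefE fnZ mulrC.
Qed.

Variable J : dualA -> kGG.
Hypothesis TM : forall lam nu f h,
  T lam nu (op (J nu) f h) = \sum_mu T lam mu f *m T mu nu h.

Let rT : realizes J T.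
Proof.
split; [by split | exact: Teq | exact: hom_family_inj].
Qed.

(* If the action of J nu kills Phi, every pair of translates of Phi is killed by
   composition, so the coefficients of Phi against those of all the V_mu vanish. *)
Lemma family_unit nu : J nu \is a GRing.unit.
Proof.
suff inj (Phi : gT * gT -> k) : (forall p, ract (J nu) Phi p = 0) -> forall p, Phi p = 0.
  apply: galg_unit => w Jw; apply: ract_inj => p.
  rewrite [RHS]/ract big1 => [|x _]; last by rewrite gcoef0 mul0r.
  apply: inj => q; rewrite -ractM Jw /ract big1 // => x _.
  by rewrite gcoef0 mul0r.
move=> Phi0.
(* Translating the first factor by a further x in K inserts the inverse of [rep d mu x] between the
   two factors; letting x vary yields the hypothesis of [coef_free]. *)
have S0 lam p q x : x \in K -> \sum_mu (\sum_a \sum_b Phi (a, b) *: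
    (T lam mu (translate p (delta a)) *m invmx (rep d mu x) *m T mu nu (translate q (delta b)))) = 0.
  move=> Kx.
  have Z0 : \sum_a \sum_b Phi (a, b) *:
      op (J nu) (translate (x * p)%g (delta a)) (translate q (delta b)) = 0.
    apply/ffunP=> g; rewrite fn0 -[RHS](Phi0 ((x * p)^-1 * g, q^-1 * g)%g) fn_sum.
    under eq_bigr => a _ do rewrite fn_sum.
    under eq_bigr => a _ do under eq_bigr => b _ do rewrite fnZ opE mulr_sumr.
    rewrite pair_bigA exchange_big; apply: eq_bigr => -[y z] _ /=.
    rewrite (bigD1 ((x * p)^-1 * (g * y), q^-1 * (g * z))%g) //= big1 ?addr0 => [|[a b] nab].
      rewrite !translateE !ffunE !eqxx !mulr1 mulrC; congr (_ * Phi _).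
      by apply: injective_projections; rewrite /= mulgA.
    rewrite !translateE !ffunE -natrM mulnb; move: nab; rewrite xpair_eqE.
    by rewrite [_ == a]eq_sym [_ == b]eq_sym => /negPf ->; rewrite !mulr0.
  have := congr1 (T lam nu) Z0; rewrite linear0 linear_sum /=.
  under eq_bigr => a _ do rewrite linear_sum /=.
  under eq_bigr => a _ do under eq_bigr => b _ do rewrite linearZ /= TM scaler_sumr.
  under eq_bigr => a _ do rewrite exchange_big.
  rewrite exchange_big /= => e; have := congr1 (mulmx (invmx (rep d lam x))) e.
  rewrite mulmx0 mulmx_sumr => {}e; rewrite -[RHS]e; apply: eq_bigr => mu _.
  rewrite mulmx_sumr; apply: eq_bigr => a _; rewrite mulmx_sumr; apply: eq_bigr => b _.
  rewrite -scalemxAr translateM (@Teq _ _ x) // /cj !mulmxA mulVmx ?rep_unit //.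
  by rewrite mul1mx.
have C0 lam mu p q i s t j : \sum_a (\sum_b Phi (a, b) * T mu nu (translate q (delta b)) t j)
    * T lam mu (translate p (delta a)) i s = 0.
  pose X mu : 'M[k]_(n_ mu) := \matrix_(t, s) \sum_a
    (\sum_b Phi (a, b) * T mu nu (translate q (delta b)) t j) * T lam mu (translate p (delta a)) i s.
  suff /(_ mu)/matrixP/(_ t s) : forall mu, X mu = 0 by rewrite !mxE.
  apply: coef_free => x Kx.
  have := congr1 (fun M : 'M_(_, _) => M i j) (S0 lam p q x Kx); rewrite summxE mxE => e.
  rewrite -[RHS]e; apply: eq_bigr => mu' _; rewrite summxE.
  transitivity (\sum_a \sum_b \sum_s' \sum_t' Phi (a, b) * (T lam mu' (translate p (delta a)) i s'
      * invmx (rep d mu' x) s' t' * T mu' nu (translate q (delta b)) t' j)).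
    transitivity (\sum_s' \sum_t' \sum_a \sum_b Phi (a, b) * (T lam mu' (translate p (delta a)) i s'
        * invmx (rep d mu' x) s' t' * T mu' nu (translate q (delta b)) t' j)).
      apply: eq_bigr => s' _; rewrite mxE; apply: eq_bigr => t' _; rewrite mxE mulr_sumr.
      apply: eq_bigr => a _; rewrite mulr_suml mulr_sumr; apply: eq_bigr => b _.
      by ring.
    under eq_bigr => s' _ do rewrite exchange_big /=.
    rewrite exchange_big /=; apply: eq_bigr => a _.
    under eq_bigr => s' _ do rewrite exchange_big /=.
    by rewrite exchange_big.
  apply: eq_bigr => a _; rewrite summxE; apply: eq_bigr => b _.
  rewrite mxE mxE mulr_sumr exchange_big; apply: eq_bigr => t' _ /=.
  by rewrite mxE mulr_suml mulr_sumr.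
have Texp lam mu g f : T lam mu (translate g f)
    = \sum_a (f a : k) *: T lam mu (translate g (delta a)).
  rewrite [f in LHS]fn_delta translate_sum linear_sum; apply: eq_bigr => a _.
  by rewrite translateZ linearZ.
case=> a b; pose h : fn := [ffun b => Phi (a, b)].
(* Phi vanishes one variable at a time: joint injectivity in b, then in a. *)
suff /ffunP/(_ b) : h = 0 by rewrite !ffunE.
apply: (@hom_family_inj nu) => mu q; apply/matrixP => t j; rewrite Texp summxE mxE.
pose f : fn := [ffun a => \sum_b Phi (a, b) * T mu nu (translate q (delta b)) t j].
have /ffunP/(_ a) : f = 0.
  apply: (@hom_family_inj mu) => lam p; apply/matrixP => i s; rewrite Texp summxE mxE.
  by rewrite -[RHS](C0 lam mu p q i s t j); apply: eq_bigr => a' _; rewrite mxE ffunE.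
rewrite !ffunE => e; rewrite -[RHS]e; apply: eq_bigr => b' _.
by rewrite mxE ffunE.
Qed.

(** T is jointly injective on translates and turns composition into the product of matrices, from
    which grading, associativity and units are inherited. *)
Lemma family_twist : is_twist J.
Proof.
apply/(is_twistP char0 abelA) => nu; split.
- exact: family_unit.
- move=> m n f h Ff Fh; rewrite -[op _ _ _](pr_sum char0 abelA) (bigD1 (m + n)) //=.
  rewrite big1 ?addr0 => [|q nq]; first exact: pr_in.
  apply: (@hom_family_inj nu) => lam g; rewrite translate_pr translate_op.
  case: (eqVneq q (nu - lam)) => [e|ne]; last by apply: Tw ne; apply: pr_in.
  rewrite e hom_family_pr TM big1 // => mu _.
  case: (eqVneq m (mu - lam)) => [em|nm]; last first.
    by rewrite (Tw (in_F_translate g Ff) nm) mul0mx.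
  rewrite [X in _ *m X](Tw (in_F_translate g Fh)) ?mulmx0 //.
  apply: contra nq => /eqP ->; rewrite e em.
  by rewrite [eqbRHS]addrC addrA subrK.
- move=> m f1 f2 f3 F3; apply: (real_eq rT (mu := nu)) => lam g; rewrite !translate_op.
  have F3g : in_F (nu - (nu - m)) (translate g f3) by rewrite subKr; apply: in_F_translate.
  rewrite (@fun_mulr _ _ _ _ _ _ (real_fun rT) _ _ _ _ _ F3g) !TM mulmx_suml.
  apply: eq_bigr => kap _.
  by rewrite (@fun_mulr _ _ _ _ _ _ (real_fun rT) _ _ _ _ _ F3g) mulmxA.
- move=> h; apply: (real_eq rT (mu := nu)) => lam g; rewrite translate_op translate_cst1.
  rewrite (@fun_mull _ _ _ _ _ _ (real_fun rT) _ lam) ?T1 ?mul1mx //.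
  by rewrite subrr; apply: in_F_cst1.
- move=> f; apply: (real_eq rT (mu := nu)) => lam g; rewrite translate_op translate_cst1.
  rewrite (@fun_mulr _ _ _ _ _ _ (real_fun rT) _ nu) ?T1 ?mulmx1 //.
  by rewrite subrr; apply: in_F_cst1.
Qed.

End FromFamily.

Lemma datum_realizable : exists J : twist k A, realizable J d.
Proof.
have [T [Tw Teq Ti T1]] := hom_family_of_datum.
have [J TM] := family_composition Tw Teq Ti.
by exists (Twist (family_twist Tw Teq Ti T1 TM)), T; split; [split | | exact: hom_family_inj].
Qed.

End TwistFromDatum.

(** * Associated data *)

Section Associated.
Variables (k : closedFieldType) (gT : finGroupType) (A : {group gT}).
Hypotheses (char0 : [pchar k] =i pred0) (abelA : abelian A).

Notation dualA := (dual k A).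
Notation fn := {ffun gT -> k^o}.
Implicit Types (f h : fn) (x g y : gT) (lam mu nu kap m : dualA).

Lemma delta_mul3 n p q r (i : 'I_n) (j : 'I_p) (s : 'I_q) (t : 'I_r) (M : 'M[k]_(p, q)) :
  delta_mx i j *m M *m delta_mx s t = M j s *: delta_mx i t.
Proof.
apply/matrixP => a b; rewrite !mxE (bigD1 s) //= big1 ?addr0 => [|l /negPf nl].
  rewrite !mxE (bigD1 j) //= big1 ?addr0 => [|l /negPf nl].
    by rewrite !mxE !eqxx andbT /= mulrAC -natrM mulnb mulrC.
  by rewrite !mxE nl andbF mul0r.
by rewrite [delta_mx _ _ _ _]mxE nl mulr0.
Qed.

Lemma starE (J : twist k A) lam f h : star J lam f h = op (J lam) f h.
Proof. by apply/ffunP=> g; rewrite !ffunE gev_gelM. Qed.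

Section FromRealization.
Variables (J : twist k A) (d : datum k A) (T : hom_family (vdim d)).
Hypothesis rT : realizes J T.
Notation K := (stab d).
Notation n_ := (vdim d).

Lemma op_in lam m (n : dualA) f h :
  in_F m f -> in_F n h -> in_F (m + n) (op (J lam) f h).
Proof. by case: ((is_twistP char0 abelA J).1 (twistP J) lam) => _ + _ _ _; apply. Qed.

(** The component F^i attached to the base coset: f corresponds to an induced function supported on
    K, and T is a bijection from these f onto Hom(V_mu, V_lam). For lam = mu it is the minimal
    ideal. *)
Definition supp lam mu f :=
  in_F (mu - lam) f /\ forall g, g \notin K -> T lam mu (translate g f) = 0.

Lemma supp_eq lam mu f f' : supp lam mu f -> supp lam mu f' ->
  T lam mu f = T lam mu f' -> f = f'.
Proof.
move=> [Ff sf] [Ff' sf'] e; apply: (real_eq_in rT Ff Ff') => g.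
case: (boolP (g \in K)) => Kg; last by rewrite sf ?sf'.
by rewrite !(real_equiv rT) // e.
Qed.

Lemma supp_ex lam mu Y : exists2 f, supp lam mu f & T lam mu f = Y.
Proof. by have [f [Ff fE sf]] := real_surj_stab rT Y; exists f. Qed.

Lemma supp0 lam mu : supp lam mu 0.
Proof. by split=> [|g _]; [apply: in_F0 | rewrite translate0 linear0]. Qed.

Lemma supp_linear lam mu (c : k) f f' : supp lam mu f -> supp lam mu f' ->
  supp lam mu (c *: f + f').
Proof.
move=> [Ff sf] [Ff' sf']; split=> [|g nKg]; first by apply/in_FD/Ff'/in_FZ.
by rewrite translate_linear linearP /= sf // sf' // scaler0 addr0.
Qed.

Lemma opM lam mu nu f h : in_F (mu - lam) f ->
  T lam nu (op (J nu) f h) = T lam mu f *m T mu nu h.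
Proof. exact: (@fun_mull _ _ _ _ _ _ (real_fun rT) lam mu). Qed.

Lemma op_in2 lam mu nu f h : in_F (mu - lam) f -> in_F (nu - mu) h ->
  in_F (nu - lam) (op (J nu) f h).
Proof. by move=> Ff Fh; have := op_in nu Ff Fh; rewrite addrC addrA subrK. Qed.

Lemma supp_opl lam mu nu f h : supp lam mu f -> in_F (nu - mu) h ->
  supp lam nu (op (J nu) f h).
Proof.
move=> [Ff sf] Fh; split=> [|g nKg]; first exact: op_in2 Ff Fh.
by rewrite translate_op (@opM _ mu) ?sf ?mul0mx //; apply: in_F_translate.
Qed.

Lemma supp_opr lam mu nu f h : in_F (mu - lam) f -> supp mu nu h ->
  supp lam nu (op (J nu) f h).
Proof.
move=> Ff [Fh sh]; split=> [|g nKg]; first exact: op_in2 Ff Fh.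
by rewrite translate_op (@opM _ mu) ?sh ?mulmx0 //; apply: in_F_translate.
Qed.

Lemma supp_translate lam mu x f : x \in K -> supp lam mu (translate x f) <-> supp lam mu f.
Proof.
move=> Kx; split=> -[Ff sf]; split=> [|g nKg].
- by rewrite -[f](translateK x); apply: in_F_translate.
- by rewrite -[g](mulgKV x) translateM sf // groupMr ?groupV.
- exact: in_F_translate.
- by rewrite -translateM sf // groupMr.
Qed.

Lemma supp_family : exists I : dualA -> {vspace fn}, forall lam f, f \in I lam <-> supp lam lam f.
Proof.
have [|I IP] := @choice _ _ (fun lam (U : {vspace fn}) => forall f, f \in U <-> supp lam lam f).
  by move=> lam; apply: vspace_of_closed; [exact: supp0 | exact: supp_linear].
by exists I.
Qed.

Section WithFamily.
Variable I : dualA -> {vspace fn}.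
Hypothesis IP : forall lam f, f \in I lam <-> supp lam lam f.

Lemma supp_in0 lam f : supp lam lam f -> in_F (0 : dualA) f.
Proof. by case; rewrite subrr. Qed.

(** Multiplying f on both sides by preimages of the identities changes nothing. *)
Lemma in_IFIP lam mu f : in_IFI J lam mu (I lam) (I mu) f <-> supp lam mu f.
Proof.
split=> [[s sP ->]|sf].
  rewrite big_seq; elim/big_rec: _ => [|t h ts sh]; first exact: supp0.
  have [/IP st1 Ft2 /IP st3] := sP t ts.
  rewrite !starE -[op _ _ _]scale1r; apply: supp_linear => //.
  by apply: supp_opr st3; case: (supp_opl st1 Ft2).
have [e1 s1 E1] := @supp_ex lam lam 1%:M; have [e2 s2 E2] := @supp_ex mu mu 1%:M.
exists [:: (e1, f, e2)] => [t|].
  by rewrite inE => /eqP -> /=; split; [exact/IP | case: sf | exact/IP].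
rewrite big_seq1 !starE; have sf1 := supp_opl s1 sf.1.
apply: (supp_eq (lam := lam) (mu := mu)) => //.
  exact: supp_opr sf1.1 s2.
by rewrite (@opM _ mu) ?(@opM _ lam) ?E1 ?E2 ?mul1mx ?mulmx1 //; [case: s1 | case: sf1].
Qed.

Lemma supp_ideal lam : two_sided_ideal J lam (I lam).
Proof.
split=> [f /IP sf|b f Fb /IP sf]; first exact: supp_in0 sf.
rewrite -[in in_F _ b](subrr lam) in Fb.
by rewrite !starE; split; apply/IP; [apply: supp_opr Fb sf | apply: supp_opl sf Fb].
Qed.

Lemma mx1_neq0 lam : (1%:M : 'M[k]_(n_ lam)) != 0.
Proof. by rewrite -mxrank_eq0 mxrank1 -lt0n vdim_gt0. Qed.

(** T makes I lam a full matrix algebra: from one nonzero entry (p, q) of f, the products e_ip f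
    e_qj are multiples of all matrix units. *)
Lemma supp_minimal lam : minimal_ideal J lam (I lam).
Proof.
split; first exact: supp_ideal.
  have [f sf E] := @supp_ex lam lam 1%:M => I0; have /IP := sf.
  rewrite I0 memv0 => /eqP f0; have := mx1_neq0 lam.
  by rewrite -E f0 linear0 eqxx.
move=> I' [F' id'] sub nz; apply/eqP; rewrite eqEsubv sub; apply/subvP => h /IP sh.
have nf : vpick I' != 0 by rewrite vpick0; apply/eqP.
set f := vpick I' in nf; have I'f : f \in I' by apply: memv_pick.
have /IP sf := subvP sub _ I'f.
have nTf : T lam lam f != 0.
  apply: contra nf => /eqP e; apply/eqP; apply: (supp_eq sf (supp0 lam lam)).
  by rewrite e linear0.
have [p [q npq]] : exists p q, T lam lam f p q != 0.
  by move: nTf; apply: contraPP; move=> nex; apply/negP/negPn/eqP/matrixP => p q;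
     rewrite mxE; apply/eqP/negPn/negP => npq; apply: nex; exists p, q.
pose e i j := s2val (cid2 (@supp_ex lam lam (delta_mx i j))).
have se i j : supp lam lam (e i j) by rewrite /e; case: (cid2 _).
have Te i j : T lam lam (e i j) = delta_mx i j by rewrite /e; case: (cid2 _).
have E i j : op (J lam) (op (J lam) (e i p) f) (e q j) \in I'.
  have [] := id' (e i p) f (supp_in0 (se _ _)) I'f; rewrite !starE => If _.
  by have [_] := id' (e q j) _ (supp_in0 (se _ _)) If; rewrite !starE.
have sE i j : supp lam lam (op (J lam) (op (J lam) (e i p) f) (e q j)).
  exact/IP/(subvP sub).
suff -> : h = \sum_i \sum_j (T lam lam h i j / T lam lam f p q) *:
    op (J lam) (op (J lam) (e i p) f) (e q j).
  by apply: memv_suml => i _; apply: memv_suml => j _; apply: memvZ.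
apply: (supp_eq sh); last first.
  rewrite linear_sum [LHS]matrix_sum_delta; apply: eq_bigr => i _; rewrite linear_sum.
  apply: eq_bigr => j _; rewrite linearZ /= (@opM _ lam) ?(@opM _ lam) ?Te ?delta_mul3.
  - by rewrite scalerA mulfVK.
  - by case: (se i p).
  - by case: (supp_opl (se i p) sf.1).
apply/IP/memv_suml => i _; apply: memv_suml => j _; apply: memvZ; exact/IP.
Qed.

Lemma real_simple lam : simple_module J lam (I lam) (T lam lam).
Proof.
split; first exact: vdim_gt0.
- by move=> f h /IP sf _; rewrite starE (@opM _ lam) //; case: sf.
- have [e se E] := @supp_ex lam lam 1%:M; exists e; split=> //; first exact/IP.
  move=> f /IP sf; rewrite !starE; split; apply: (supp_eq _ sf).
  + exact: supp_opl se sf.1.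
  + by rewrite (@opM _ lam) ?E ?mul1mx //; case: se.
  + exact: supp_opl sf se.1.
  + by rewrite (@opM _ lam) ?E ?mulmx1 //; case: sf.
move=> U inv; case: (eqVneq U 0%VS) => [|nU]; [by left | right].
have nu : vpick U != 0 by rewrite vpick0.
apply/eqP; rewrite eqEsubv subvf; apply/subvP => v _.
have [i ni] : exists i, vpick U i 0 != 0.
  move: nu; apply: contraPP => nex; apply/negP/negPn/eqP/matrixP => i j.
  by rewrite (ord1 j) mxE; apply/eqP/negPn/negP => ni; apply: nex; exists i.
have [f sf E] := @supp_ex lam lam ((vpick U i 0)^-1 *: (v *m delta_mx (0 : 'I_1) i)).
have -> : v = T lam lam f *m vpick U.
  rewrite E -scalemxAl -mulmxA -rowE; apply/matrixP => a b.
  by rewrite !mxE big_ord1 !mxE (ord1 b) mulrCA mulVf ?mulr1.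
by apply: inv; [exact/IP | apply: memv_pick].
Qed.

End WithFamily.

(** The ideals are the spaces [supp lam lam], their simple modules are the V_lam through T, and the
    bimodule isomorphisms are T written in columns. *)
Lemma realizes_associated : associated_datum J d.
Proof.
have [I IP] := supp_family; exists I, (fun lam => T lam lam).
split.
- split=> [lam|lam mu]; first exact: supp_minimal.
  have [f sf E] := @supp_ex lam mu (const_mx 1); exists f; first exact/(in_IFIP IP).
  move=> f0; move: E; rewrite f0 linear0 => /matrixP/(_ (Ordinal (vdim_gt0 d lam))).
  by move/(_ (Ordinal (vdim_gt0 d mu)))/eqP; rewrite !mxE eq_sym oner_eq0.
- move=> g; split=> [Kg lam f|st].
    by apply/idP/idP => /IP/(supp_translate _ _ _ Kg)/IP.
  (* If g stabilizes the ideal, gf is supported on K; for g outside K this kills T f = T(g^-1(gf)),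
     which is the identity. *)
  have [f sf E] := @supp_ex 0 0 1%:M; have := st 0 f.
  have /IP -> := sf; move=> /IP [_ e]; apply: contraNT (mx1_neq0 0) => nKg.
  by rewrite -E -[f](translateK g) e // groupV.
- exact: real_simple.
- by move=> lam g f Kg _; rewrite (real_equiv rT).
move=> lam mu; have [|th thE] := @hom_of_linear k fn _ (fun f => vec (T lam mu f)).
  by move=> c f h; rewrite linearP vec_is_linear.
exists th; split.
- move=> f /(in_IFIP IP) sf; rewrite thE => e; apply: (supp_eq sf (supp0 _ _)).
  by rewrite linear0; apply: vec_inj; rewrite e vec0.
- move=> v; have [f sf E] := @supp_ex lam mu (unvec v); exists f; first exact/(in_IFIP IP).
  by rewrite thE E unvecK.
- move=> b f /IP sb _; rewrite starE !thE tens_vec trmx1 mulmx1 (@opM _ lam) //.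
  by case: sb.
- move=> f b /(in_IFIP IP) sf _; rewrite starE !thE tens_vec mul1mx trmxK (@opM _ mu) //.
  by case: sf.
- by move=> g f Kg _; rewrite !thE (real_equiv rT) // tens_cj.
Qed.

End FromRealization.
End Associated.

(** * A Skolem-Noether theorem for functors to matrices *)

Section Intertwiners.
Variable k : fieldType.

Lemma inj_surj_inv p q (phi : 'M[k]_(p, q)) :
  (forall w : 'cV_q, phi *m w = 0 -> w = 0) ->
  (forall u : 'cV_p, exists w : 'cV_q, phi *m w = u) ->
  exists2 psi : 'M[k]_(q, p), psi *m phi = 1%:M & phi *m psi = 1%:M.
Proof.
move=> inj surj; have [w wE] := choice (fun j => surj (col j 1%:M)).
pose psi : 'M[k]_(q, p) := \matrix_(i, j) w j i 0.
have e1 : phi *m psi = 1%:M.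
  apply/matrixP => a j; have /matrixP/(_ a 0) := wE j; rewrite [in X in _ = X]mxE => <-.
  by rewrite !mxE; apply: eq_bigr => i _; rewrite mxE.
exists psi => //; apply/matrixP => a j; apply/eqP; rewrite -subr_eq0; apply/eqP.
have : col j (psi *m phi - 1%:M) = 0.
  by apply: inj; rewrite !colE mulmxA mulmxBr mulmxA e1 mul1mx mulmx1 subrr mul0mx.
by move=> /matrixP/(_ a 0); rewrite !mxE.
Qed.

Lemma inj_unitmx n (phi : 'M[k]_n) :
  (forall w : 'cV_n, phi *m w = 0 -> w = 0) -> phi \in unitmx.
Proof.
move=> inj; rewrite -unitmx_tr -row_free_unit -kermx_eq0.
apply/eqP/row_matrixP => i; rewrite row0; apply: trmx_inj; rewrite trmx0; apply: inj.
by rewrite -{1}[phi]trmxK -trmx_mul -row_mul mulmx_ker row0 trmx0.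
Qed.

(* A Skolem-Noether theorem for categories of matrices: phi sends T f e_o to T' f v,
   where e_o is a basis vector and v is fixed by the image of the projection onto it. *)
Lemma intertwiner_ex (V : vectType k) (L : Type) (P : L -> L -> V -> Prop)
    (m : L -> L -> L -> V -> V -> V) (n n' : L -> nat)
    (T : forall a b, 'Hom(V, 'M[k]_(n a, n b))) (T' : forall a b, 'Hom(V, 'M[k]_(n' a, n' b)))
    (l0 : L) (o : 'I_(n l0)) (f0 : V) :
  (forall a b (c : k) f f', P a b f -> P a b f' -> P a b (c *: f + f')) ->
  (forall a b c f h, P a b f -> P b c h -> P a c (m a b c f h)) ->
  (forall a b c f h, P a b f -> P b c h -> T a c (m a b c f h) = T a b f *m T b c h) ->
  (forall a b c f h, P a b f -> P b c h -> T' a c (m a b c f h) = T' a b f *m T' b c h) ->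
  (forall a b Y, exists2 f, P a b f & T a b f = Y) ->
  (forall a b f, P a b f -> T a b f = 0 -> T' a b f = 0) ->
  P l0 l0 f0 -> T' l0 l0 f0 != 0 ->
  exists phi : forall a, 'M[k]_(n' a, n a),
    (forall a b f, P a b f -> T' a b f *m phi b = phi a *m T a b f) /\
    (forall a (w : 'cV_(n a)), phi a *m w = 0 -> w = 0).
Proof.
move=> PL Pm TM TM' Ts Tk Pf0 nf0.
have P0 a b : P a b 0.
  have [f Pf _] := Ts a b 0; have := PL a b (-1) f f Pf Pf.
  by rewrite scaleN1r addNr.
have PS a b I (r : seq I) (F : I -> V) : (forall i, P a b (F i)) -> P a b (\sum_(i <- r) F i).
  move=> PF; elim/big_rec: _ => [|i x _ Px]; first exact: P0.
  by rewrite -[F i]scale1r; apply: PL.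
have PZ a b c f : P a b f -> P a b (c *: f).
  by move=> Pf; rewrite -[_ *: f]addr0; apply: PL.
have Teq a b f f' : P a b f -> P a b f' -> T a b f = T a b f' -> T' a b f = T' a b f'.
  move=> Pf Pf' e; apply/eqP; rewrite -subr_eq0 -linearB; apply/eqP/Tk.
    by rewrite addrC -scaleN1r; apply: PL.
  by rewrite linearB /= e subrr.
pose q a b i j := s2val (cid2 (Ts a b (delta_mx i j))).
have Pq a b i j : P a b (q a b i j) by rewrite /q; case: (cid2 _).
have Tq a b i j : T a b (q a b i j) = delta_mx i j by rewrite /q; case: (cid2 _).
set p := q l0 l0 o o.
(* Modulo the kernel of T, on which T' vanishes too, f0 is a combination of products q_io p q_oj; if
   T' killed p it would kill f0. *)
have np : T' l0 l0 p != 0.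
  apply: contra nf0 => /eqP Tp0.
  pose F i j := m l0 l0 l0 (m l0 l0 l0 (q l0 l0 i o) p) (q l0 l0 o j).
  have PF i j : P l0 l0 (F i j) by apply: (Pm) (Pq _ _ _ _); apply: Pm; apply: Pq.
  rewrite (Teq _ _ _ (\sum_i \sum_j T l0 l0 f0 i j *: F i j)) //.
  - rewrite linear_sum big1 // => i _; rewrite linear_sum big1 // => j _.
    rewrite linearZ /= /F TM' //; last by apply: Pm; apply: Pq.
    by rewrite TM' ?Tp0 ?mulmx0 ?mul0mx ?scaler0 //; apply: Pq.
  - by apply: (PS) => i; apply: PS => j; apply: PZ.
  rewrite [LHS]matrix_sum_delta linear_sum; apply: eq_bigr => i _.
  rewrite linear_sum; apply: eq_bigr => j _; rewrite linearZ /= /F TM //; last first.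
    by apply: Pm; apply: Pq.
  rewrite TM ?Tq; [ | exact: Pq | exact: Pq].
  by rewrite !mul_delta_mx.
have [s [t nst]] : exists s t, T' l0 l0 p s t != 0.
  move: np; apply: contraPP => nex; apply/negP/negPn/eqP/matrixP => s t.
  by rewrite mxE; apply/eqP/negPn/negP => nst; apply: nex; exists s, t.
pose v := col t (T' l0 l0 p).
have nv : v != 0.
  by apply: contra nst => /eqP/matrixP/(_ s 0); rewrite !mxE => ->.
have pv : T' l0 l0 p *m v = v.
  rewrite /v !colE mulmxA -TM' ?(Teq _ _ (m l0 l0 l0 p p) p) //; try exact: Pq.
    by apply: Pm; apply: Pq.
  by rewrite TM ?Tq ?mul_delta_mx //; apply: Pq.
pose phi a : 'M[k]_(n' a, n a) := \matrix_(s, i) (T' a l0 (q a l0 i o) *m v) s 0.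
have phiE a f (w : 'cV_(n a)) : P a l0 f -> T a l0 f = w *m delta_mx (0 : 'I_1) o ->
    phi a *m w = T' a l0 f *m v.
  move=> Pf ef; rewrite (Teq _ _ f (\sum_i w i 0 *: q a l0 i o)) //.
  - rewrite linear_sum mulmx_suml; apply/matrixP => s' j; rewrite (ord1 j) mxE summxE.
    by apply: eq_bigr => i _; rewrite linearZ /= -scalemxAl [RHS]mxE mxE mulrC.
  - by apply: PS => i; apply: PZ.
  rewrite ef linear_sum; apply/matrixP => s' j; rewrite mxE big_ord1 summxE.
  rewrite (bigD1 s') //= big1 ?addr0 => [|i ni]; rewrite linearZ /= Tq !mxE.
    by rewrite eqxx.
  by rewrite eq_sym (negPf ni) mulr0.
have phiq a j : phi a *m delta_mx j (0 : 'I_1) = T' a l0 (q a l0 j o) *m v.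
  by apply: phiE => //; rewrite Tq mul_delta_mx.
have inter a b f : P a b f -> T' a b f *m phi b = phi a *m T a b f.
  move=> Pf; apply/matrixP => s' j.
  suff /matrixP/(_ s' 0) : T' a b f *m (phi b *m delta_mx j (0 : 'I_1))
      = phi a *m (T a b f *m delta_mx j 0) by rewrite !mulmxA -!colE !mxE.
  rewrite phiq mulmxA -TM' //; symmetry; apply: phiE; first exact: Pm.
  by rewrite TM // Tq -mulmxA mul_delta_mx.
exists phi; split=> // a w e.
apply/matrixP => i j; rewrite (ord1 j) mxE; apply/eqP; apply: contraNT nv => nwi.
have := congr1 (mulmx (T' l0 a (q l0 a o i))) e.
rewrite mulmxA inter // mulmx0 -mulmxA Tq.
have -> : delta_mx o i *m w = w i 0 *: delta_mx o (0 : 'I_1).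
  apply/matrixP => s' j'; rewrite (ord1 j') !mxE (bigD1 i) //= big1 ?addr0 => [|l nl].
    by rewrite mxE eqxx !andbT mulrC.
  by rewrite mxE (negPf nl) andbF mul0r.
rewrite -scalemxAr phiq pv => /eqP; rewrite scaler_eq0 (negPf nwi) /=.
by move/eqP => ->.
Qed.

End Intertwiners.

(** * Uniqueness of the associated datum *)

Section Uniqueness.
Variables (k : closedFieldType) (gT : finGroupType) (A : {group gT}).
Hypotheses (char0 : [pchar k] =i pred0) (abelA : abelian A).

Notation dualA := (dual k A).
Notation fn := {ffun gT -> k^o}.
Implicit Types (f h : fn) (x g y : gT) (lam mu nu kap m : dualA).

Variables (J : twist k A) (d0 d : datum k A) (T : hom_family (vdim d0)).
Hypothesis rT : realizes J T.
Notation K0 := (stab d0).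
Notation n0 := (vdim d0).
Notation n_ := (vdim d).
Notation S := (supp T).

Section Ideals.
Variable I : dualA -> {vspace fn}.
Hypothesis famI : ideal_family J I.

Lemma translate_two_sided lam (U U' : {vspace fn}) x :
  (forall f, f \in U' <-> translate x f \in U) ->
  two_sided_ideal J lam U -> two_sided_ideal J lam U'.
Proof.
move=> UU' [F0 id]; split=> [f /UU' /F0 Ff|b f Fb /UU' Uf].
  by rewrite -[f](translateK x); apply: in_F_translate.
have [] := id (translate x b) _ (in_F_translate x Fb) Uf; rewrite !starE // => U1 U2.
by split; apply/UU'; rewrite translate_op.
Qed.

Lemma cap_two_sided lam (U U' : {vspace fn}) :
  two_sided_ideal J lam U -> two_sided_ideal J lam U' -> two_sided_ideal J lam (U :&: U').
Proof.
move=> [F0 id] [F0' id']; split=> [f|b f Fb]; rewrite ?memv_cap => /andP[Uf Uf'].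
  exact: F0.
have [U1 U2] := id b f Fb Uf; have [U1' U2'] := id' b f Fb Uf'.
by split; apply/andP.
Qed.

(* Both I lam and the ideal of functions supported on a coset of K0 are minimal,
   so they are equal as soon as their product is not zero. *)
Lemma ideal_coset lam : exists g, forall f, f \in I lam <-> S lam lam (translate g^-1%g f).
Proof.
have [idI nz minI] := famI.1 lam.
have [I0 I0P] := supp_family T.
have [_ _ min0] := supp_minimal char0 abelA rT I0P lam.
have id0 := supp_ideal char0 abelA rT I0P lam.
have nf : vpick (I lam) != 0 by rewrite vpick0; apply/eqP.
set f := vpick (I lam) in nf; have If : f \in I lam by apply: memv_pick.
have Ff : in_F (lam - lam) f by rewrite subrr; apply: (idI.1).
have [g ng] : exists g, T lam lam (translate g f) != 0.
  move: nf; apply: contraPP => nex; apply/negP/negPn/eqP/(real_inj_in rT Ff) => g.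
  by apply/eqP/negPn/negP => ng; apply: nex; exists g.
have [e se Te] := @supp_ex _ _ _ J d0 T rT lam lam 1%:M.
have [Q QP] : exists Q : {vspace fn}, forall h, h \in Q <-> translate g h \in I0 lam.
  apply: vspace_of_closed => [|c u v Qu Qv]; first by rewrite translate0 mem0v.
  by rewrite translate_linear memvD // memvZ.
have [Q' Q'P] : exists Q : {vspace fn}, forall h, h \in Q <-> translate g^-1%g h \in I lam.
  apply: vspace_of_closed => [|c u v Qu Qv]; first by rewrite translate0 mem0v.
  by rewrite translate_linear memvD // memvZ.
(* w lies in [I0 lam] and its translate by g^-1 lies in [I lam]; it is nonzero because T w = T(g
   f). *)
pose w := op (J lam) e (translate g f).
have Fe : in_F (0 : dualA) e by exact: supp_in0 se.
have nw : w != 0.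
  apply: contra ng => /eqP w0; have := congr1 (T lam lam) w0.
  by rewrite (@opM _ _ _ J d0 T rT lam lam) ?Te ?mul1mx ?linear0 => [->|]; case: se.
have I0w : w \in I0 lam.
  apply/I0P; apply: (supp_opl char0 abelA rT se).
  exact: in_F_translate.
have Iw : translate g^-1%g w \in I lam.
  rewrite translate_op translateK.
  by have [] := idI.2 (translate g^-1%g e) f (in_F_translate _ Fe) If; rewrite !starE.
have subQ : (I lam <= Q)%VS.
  apply/capv_idPl/minI; first by apply: cap_two_sided => //; apply: translate_two_sided QP id0.
    exact: capvSl.
  move=> e0; have : translate g^-1%g w \in (I lam :&: Q)%VS.
    by rewrite memv_cap Iw; apply/QP; rewrite translateKV.
  rewrite e0 memv0 => /eqP tw0; case/eqP: nw.
  by rewrite -[w](translateKV g) tw0 translate0.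
have subQ' : (I0 lam <= Q')%VS.
  apply/capv_idPl/min0; first by apply: cap_two_sided => //; apply: translate_two_sided Q'P idI.
    exact: capvSl.
  move=> e0; have : w \in (I0 lam :&: Q')%VS by rewrite memv_cap I0w; apply/Q'P.
  by rewrite e0 memv0 (negPf nw).
exists g^-1%g => h; rewrite invgK; split=> [Ih|Sh].
  by apply/I0P/QP/(subvP subQ).
by rewrite -[h](translateK g); apply/Q'P/(subvP subQ')/I0P.
Qed.

(** The product of I lam, F_(-lam) and I 0 contains a nonzero function, so T is nonzero on some
    translate of it by x. Both x gam(lam) and x gam(0) then lie in K0, and the two ideals come from
    the same coset. *)
Lemma ideal_common_coset : exists g, forall lam f,
  f \in I lam <-> S lam lam (translate g^-1%g f).
Proof.
have [gam gP] := choice ideal_coset; exists (gam 0) => lam f; rewrite gP.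
suff Kg : ((gam 0)^-1 * gam lam)%g \in K0.
  by rewrite -(supp_translate T _ _ _ Kg) -translateM mulgK.
have [h [s sP ->] nz] := famI.2 lam 0.
have [t ts nt] : exists2 t, t \in s & star J 0 (star J 0 t.1.1 t.1.2) t.2 <> 0.
  move: nz; apply: contra_notP => nex; rewrite big_seq big1 // => t ts.
  by apply: contrapT => nt; apply: nex; exists t.
have [/gP s1 Ft /gP s2] := sP t ts; rewrite !starE in nt.
have F1 : in_F (lam - lam) t.1.1.
  by rewrite -[t.1.1](translateKV (gam lam)); apply: in_F_translate; case: s1.
have F2 : in_F (0 - 0 : dualA) t.2.
  by rewrite -[t.2](translateKV (gam 0)); apply: in_F_translate; case: s2.
have F12 := op_in2 char0 abelA J F1 Ft.
have F := op_in2 char0 abelA J F12 F2.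
have [x nx] : exists x, T lam 0 (translate x (op (J 0) (op (J 0) t.1.1 t.1.2) t.2)) != 0.
  move: nt; apply: contra_notP => nex; apply: (real_inj_in rT F) => x.
  by apply/eqP/negPn/negP => nx; apply: nex; exists x.
move: nx; rewrite !translate_op (@opM _ _ _ J d0 T rT lam 0); last first.
  by rewrite -translate_op; apply: in_F_translate.
rewrite (@opM _ _ _ J d0 T rT lam lam) => [nx|]; last exact: in_F_translate.
have K1 : (x * gam lam)%g \in K0.
  apply: contraNT nx => nK; have [_ s0] := s1; have := s0 _ nK.
  by rewrite -translateM mulgK => ->; rewrite !mul0mx.
have K2 : (x * gam 0)%g \in K0.
  apply: contraNT nx => nK; have [_ s0] := s2; have := s0 _ nK.
  by rewrite -translateM mulgK => ->; rewrite !mulmx0.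
by rewrite -[gam lam](mulKg x) mulgA -invMg groupM ?groupV.
Qed.

End Ideals.

Lemma in_IFI_translate (I I' : dualA -> {vspace fn}) x lam mu f :
  (forall kap h, h \in I kap -> translate x h \in I' kap) ->
  in_IFI J lam mu (I lam) (I mu) f -> in_IFI J lam mu (I' lam) (I' mu) (translate x f).
Proof.
move=> II' [s sP ->].
exists [seq (translate x t.1.1, translate x t.1.2, translate x t.2) | t <- s].
  move=> _ /mapP[t ts ->] /=; have [s1 Ft s2] := sP t ts.
  by split; [apply: II' | apply: in_F_translate | apply: II'].
rewrite big_map translate_sum; apply: eq_bigr => t _.
by rewrite !starE !translate_op.
Qed.

(** The phi are found for each lam separately, so each has its own multiplier. The equivariant
    bimodule isomorphisms are what forces the multipliers to agree. *)
Lemma associated_iso : associated_datum J d -> datum_iso d0 d.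
Proof.
case=> I [rho [famI stabP simp conj th]].
have [g gP] := ideal_common_coset famI.
(* The given ideals become the support spaces of the translated functor, whose group is g K0
   g^-1. *)
pose T' lam mu f := T lam mu (translate g^-1%g f).
pose S' lam mu f := S lam mu (translate g^-1%g f).
have IFIP lam mu f : in_IFI J lam mu (I lam) (I mu) f <-> S' lam mu f.
  have [I0 I0P] := supp_family T.
  split=> [iI|/(in_IFIP char0 abelA rT I0P) iI].
    apply/(in_IFIP char0 abelA rT I0P); apply: in_IFI_translate iI => kap h.
    by move=> /gP/I0P.
  rewrite -[f](translateKV g); apply: in_IFI_translate iI => kap h /I0P Sh.
  by apply/gP; rewrite translateK.
have S'ex lam mu Y : exists2 f, S' lam mu f & T' lam mu f = Y.
  have [f Sf Tf] := @supp_ex _ _ _ J d0 T rT lam mu Y.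
  by exists (translate g f); rewrite /S' /T' translateK.
have S'L lam mu (c : k) f f' : S' lam mu f -> S' lam mu f' -> S' lam mu (c *: f + f').
  by move=> Sf Sf'; rewrite /S' translate_linear; apply: supp_linear.
have S'eq lam mu f f' : S' lam mu f -> S' lam mu f' -> T' lam mu f = T' lam mu f' -> f = f'.
  move=> Sf Sf' e; rewrite -[f](translateKV g) -[f'](translateKV g); congr translate.
  exact: (supp_eq rT Sf Sf').
have S'M lam mu nu f h : S' lam mu f -> S' mu nu h -> S' lam nu (op (J nu) f h).
  move=> Sf Sh; rewrite /S' translate_op.
  by apply: (supp_opl char0 abelA rT Sf); case: Sh.
have T'M lam mu nu f h : S' lam mu f -> T' lam nu (op (J nu) f h) = T' lam mu f *m T' mu nu h.
  move=> [Ff _]; rewrite /T' translate_op (@opM _ _ _ J d0 T rT lam mu) //.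
have T'lin lam mu : linear (T' lam mu).
  by move=> c f h; rewrite /T' translate_linear linearP.
have stabE x : x \in stab d <-> (x ^ g)%g \in K0.
  have shift f : translate g^-1%g (translate x f) = translate (x ^ g)%g (translate g^-1%g f).
    by rewrite -!translateM conjgE mulgA mulgK.
  rewrite stabP; split=> [st|Kx lam f].
    have [e Se Te] := S'ex 0 0 1%:M.
    have := st 0 e; have /gP -> := Se; move=> /gP [_ e0].
    apply: contraNT (mx1_neq0 d0 0) => nK; rewrite -Te /T'.
    by have := e0 (x ^ g)^-1%g; rewrite groupV shift translateK => ->.
  by apply/idP/idP => /gP Sf; apply/gP; move: Sf; rewrite shift (supp_translate T _ _ _ Kx).
have SL lam f : f \in I lam <-> S' lam lam f by exact: gP.
(* Skolem-Noether with a single object: T' is injective on I lam, so rho kills its kernel there. The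
   image of phi is a nonzero submodule of a simple module, so phi is onto. *)
have interE lam : exists phi : 'M[k]_(n_ lam, n0 lam),
    (forall f, f \in I lam -> rho lam f *m phi = phi *m T' lam lam f) /\
    exists2 psi : 'M[k]_(n0 lam, n_ lam), psi *m phi = 1%:M & phi *m psi = 1%:M.
  have [_ rhoM [e [Ie _ rhoe]] irr] := simp lam.
  have [||||||||phi [phiT phi_inj]] := @intertwiner_ex k fn unit (fun _ _ f => f \in I lam)
      (fun _ _ _ f h => op (J lam) f h) (fun=> n0 lam) (fun=> n_ lam)
      (fun _ _ => lin_hom (T'lin lam lam)) (fun _ _ => rho lam) tt
      (Ordinal (vdim_gt0 d0 lam)) e.
  - by move=> _ _ c f f' If If'; apply: memvD => //; apply: memvZ.
  - by move=> _ _ _ f h /SL Sf /SL Sh; apply/SL/(S'M _ lam).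
  - by move=> _ _ _ f h /SL Sf /SL Sh; rewrite !lin_homE (T'M _ lam).
  - by move=> _ _ _ f h If Ih; rewrite -starE rhoM.
  - move=> _ _ Y; have [f Sf Tf] := S'ex lam lam Y; exists f; first exact/SL.
    by rewrite lin_homE.
  - move=> _ _ f /SL Sf; rewrite lin_homE => Tf0.
    rewrite (S'eq lam lam f 0) ?linear0 //; last by rewrite Tf0 /T' translate0 linear0.
    by rewrite /S' translate0; apply: supp0.
  - exact: Ie.
  - by rewrite rhoe mx1_neq0.
  exists (phi tt); split=> [f If|]; first by rewrite (phiT tt tt) // lin_homE.
  apply: inj_surj_inv; first exact: phi_inj.
  have [||U UP] := @vspace_of_closed k 'cV[k]_(n_ lam)
    (fun u => exists w : 'cV_(n0 lam), phi tt *m w = u).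
  - by exists 0; rewrite mulmx0.
  - move=> c _ _ [w <-] [w' <-]; exists (c *: w + w').
    by rewrite mulmxDr -scalemxAr.
  have [f u If /UP[w <-]|U0|Uf u] := irr U.
  - by apply/UP; exists (T' lam lam f *m w); rewrite [RHS]mulmxA (phiT tt tt) // lin_homE mulmxA.
  - have : phi tt *m delta_mx (Ordinal (vdim_gt0 d0 lam)) (0 : 'I_1) = 0.
      by apply/eqP; rewrite -memv0 -U0; apply/UP; eexists.
    move/phi_inj/matrixP/(_ (Ordinal (vdim_gt0 d0 lam)) 0)/eqP.
    by rewrite !mxE !eqxx oner_eq0.
  by apply/UP; rewrite Uf memvf.
have /fin_all_exists[phi phiP] := interE.
have /fin_all_exists[psi psiP] lam : exists psi : 'M[k]_(n0 lam, n_ lam),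
    psi *m phi lam = 1%:M /\ phi lam *m psi = 1%:M.
  by have [_ [psi e1 e2]] := phiP lam; exists psi.
have phiT lam f : f \in I lam -> rho lam f *m phi lam = phi lam *m T' lam lam f.
  by have [e _] := phiP lam; apply: e.
pose act x := (g * x * g^-1)%g.
have actK x : x \in K0 -> act x \in stab d.
  by move=> Kx; apply/stabE; rewrite conjgE /act !mulgA mulVg mul1g mulgKV.
have T'act lam mu x f : x \in K0 -> T' lam mu (translate (act x) f) = cj x (T' lam mu f).
  move=> Kx; rewrite /T' -translateM /act !mulgA mulVg mul1g translateM.
  by rewrite (real_equiv rT).
have Iact lam x f : x \in K0 -> f \in I lam -> translate (act x) f \in I lam.
  by move=> Kx If; have /stabP/(_ lam f) -> := actK x Kx.
(* N satisfies the same intertwining relation as phi lam, so psi N commutes with every matrix and N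
   is a multiple of phi lam. *)
have multE lam x : exists b, x \in K0 ->
    b != 0 /\ rep d lam (act x) *m phi lam = b *: (phi lam *m rep d0 lam x).
  case: (boolP (x \in K0)) => [Kx|]; last by exists 0.
  have Kx' := actK x Kx.
  have u0 := rep_unit lam Kx; have u' := rep_unit lam Kx'.
  pose N := invmx (rep d lam (act x)) *m phi lam *m rep d0 lam x.
  have NT f : f \in I lam -> rho lam f *m N = N *m T' lam lam f.
    move=> If; have := phiT lam _ (Iact lam x f Kx If).
    rewrite conj // T'act // => e.
    have := congr1 (fun M => invmx (rep d lam (act x)) *m M *m rep d0 lam x) e.
    by rewrite /N /cj !mulmxA mulVmx // mul1mx mulmxKV.
  have [b bE] : exists b, psi lam *m N = b%:M.
    apply: scalar_mx_center => M; have [f Sf <-] := S'ex lam lam M.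
    have If : f \in I lam by apply/SL.
    rewrite -mulmxA -NT // !mulmxA; congr (_ *m _ *m _ *m _).
    rewrite -[LHS]mulmx1 -(psiP lam).2 -mulmxA [rho _ _ *m _]mulmxA phiT //.
    by rewrite !mulmxA (psiP lam).1 mul1mx.
  have eN : N = b *: phi lam.
    by rewrite -[LHS]mul1mx -(psiP lam).2 -mulmxA bE mul_mx_scalar.
  have ephi : phi lam *m rep d0 lam x = b *: (rep d lam (act x) *m phi lam).
    by rewrite scalemxAr -eN /N !mulmxA mulmxV // mul1mx.
  have nb : b != 0.
    apply/eqP => b0; have := congr1 (fun M => psi lam *m M *m invmx (rep d0 lam x)) ephi.
    rewrite b0 scale0r mulmx0 mul0mx !mulmxA (psiP lam).1 mul1mx mulmxV // => /eqP.
    by rewrite (negPf (mx1_neq0 _ _)).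
  by exists b^-1 => _; rewrite invr_eq0 nb ephi scalerA mulVf ?scale1r.
have multE' x : exists b : dualA -> k, forall lam, x \in K0 ->
    b lam != 0 /\ rep d lam (act x) *m phi lam = b lam *: (phi lam *m rep d0 lam x).
  by have [b bP] := choice (fun lam => multE lam x); exists b.
have [al alP] := choice multE'.
(* The bimodule isomorphism conjugated by phi and psi is a bimodule map w, hence a multiple of T' on
   the component, determined by its value at one matrix unit. Equivariance of T' and of the original
   map differ by al x lam / al x mu, so this ratio is 1. *)
have al_const x lam mu : x \in K0 -> al x lam = al x mu.
  move=> Kx; have [th_ [th0 _ thl thr thg]] := th lam mu.
  pose W f := unvec (th_ f).
  have [|w wE] := @hom_of_linear k fn _ (fun f => psi lam *m W f *m phi mu).
    by move=> c f h; rewrite /W linearP unvec_is_linear mulmxDr mulmxDl -scalemxAr -scalemxAl.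
  have WE f : W f = phi lam *m w f *m psi mu.
    rewrite wE !mulmxA (psiP lam).2 mul1mx -mulmxA (psiP mu).2 mulmx1 //.
  have psiT kap f : f \in I kap -> psi kap *m rho kap f = T' kap kap f *m psi kap.
    move=> If; rewrite -[LHS]mulmx1 -(psiP kap).2 -mulmxA [rho _ _ *m _]mulmxA phiT //.
    by rewrite !mulmxA (psiP kap).1 mul1mx.
  have wl b f : b \in I lam -> S' lam mu f -> w (op (J mu) b f) = T' lam lam b *m w f.
    move=> Ib /IFIP Sf; rewrite !wE /W -starE thl // -[th_ f]unvecK tens_vec !vecK.
    by rewrite trmx1 mulmx1 !mulmxA psiT.
  have wr f b : b \in I mu -> S' lam mu f -> w (op (J mu) f b) = w f *m T' mu mu b.
    move=> Ib /IFIP Sf; rewrite !wE /W -starE thr // -[th_ f]unvecK tens_vec !vecK.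
    by rewrite trmxK mul1mx -!mulmxA phiT.
  pose o := Ordinal (vdim_gt0 d0 lam); pose o' := Ordinal (vdim_gt0 d0 mu).
  have [q Sq Tq] := S'ex lam mu (delta_mx o o').
  have wc f : S' lam mu f -> w f = w q o o' *: T' lam mu f.
    move=> Sf; pose p i := s2val (cid2 (S'ex lam lam (delta_mx i o))).
    have Sp i : S' lam lam (p i) by rewrite /p; case: (cid2 _).
    have Tp i : T' lam lam (p i) = delta_mx i o by rewrite /p; case: (cid2 _).
    pose r j := s2val (cid2 (S'ex mu mu (delta_mx o' j))).
    have Sr j : S' mu mu (r j) by rewrite /r; case: (cid2 _).
    have Tr j : T' mu mu (r j) = delta_mx o' j by rewrite /r; case: (cid2 _).
    have Spq i : S' lam mu (op (J mu) (p i) q) by apply: S'M (Sp i) Sq.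
    pose F i j := op (J mu) (op (J mu) (p i) q) (r j).
    have SF i j : S' lam mu (F i j) by apply: S'M (Spq i) (Sr j).
    have S0 : S' lam mu 0 by rewrite /S' translate0; apply: supp0.
    have -> : f = \sum_i \sum_j T' lam mu f i j *: F i j.
      apply: (S'eq lam mu) => //.
        elim/big_rec: _ => // i y _ Sy; rewrite -[X in X + _]scale1r; apply: (S'L) => //.
        by elim/big_rec: _ => // j z _ Sz; apply: S'L.
      have [t tE] := hom_of_linear (T'lin lam mu); rewrite -!tE linear_sum.
      rewrite [LHS]matrix_sum_delta; apply: eq_bigr => i _; rewrite linear_sum.
      apply: eq_bigr => j _; rewrite linearZ /= [t (F i j)]tE /F (T'M _ mu) // (T'M _ lam) //.
      by rewrite Tp Tr Tq !mul_delta_mx.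
    have [t tE] := hom_of_linear (T'lin lam mu); rewrite -!tE (linear_sum w) (linear_sum t) scaler_sumr.
    apply: eq_bigr => i _; rewrite (linear_sum w) (linear_sum t) scaler_sumr.
    apply: eq_bigr => j _ /=.
    rewrite !linearZ /= [t (F i j)]tE /F wr ?wl //; try exact/SL.
    rewrite (T'M _ mu) // (T'M _ lam) // Tp Tr Tq !mul_delta_mx delta_mul3.
    by rewrite !scalerA mulrC.
  have nwq : w q != 0.
    apply/eqP => wq0; have : q = 0.
      apply: th0; first exact/IFIP.
      by rewrite -[th_ q]unvecK -/(W q) WE wq0 mulmx0 mul0mx vec0.
    move: Tq => /[swap] ->; rewrite /T' translate0 linear0 => /matrixP/(_ o o')/eqP.
    by rewrite !mxE !eqxx eq_sym oner_eq0.
  have Kx' := actK x Kx.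
  have Sq' : S' lam mu (translate (act x) q).
    have /IFIP iq := Sq.
    apply/IFIP; apply: (in_IFI_translate (I := I) (I' := I)) iq => kap h.
    exact: Iact.
  have [nal eal] := alP x lam Kx; have [nam eam] := alP x mu Kx.
  have e1 : psi lam *m rep d lam (act x) = al x lam *: (rep d0 lam x *m psi lam).
    rewrite -[LHS]mulmx1 -(psiP lam).2 -mulmxA [rep d lam _ *m _]mulmxA eal.
    by rewrite -scalemxAl -scalemxAr !mulmxA (psiP lam).1 mul1mx.
  have e2 : invmx (rep d mu (act x)) *m phi mu
      = (al x mu)^-1 *: (phi mu *m invmx (rep d0 mu x)).
    apply: (can_inj (mulKmx (rep_unit mu Kx'))); rewrite mulKVmx ?rep_unit //.
    rewrite -scalemxAr mulmxA eam -scalemxAl scalerA mulVf // scale1r.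
    by rewrite mulmxK ?rep_unit.
  have : w (translate (act x) q) = (al x lam / al x mu) *: cj x (w q).
    rewrite [LHS]wE /W thg //; last exact/IFIP.
    rewrite -[th_ q]unvecK tens_cj vecK -/(W q) /cj !mulmxA e1 -!mulmxA e2.
    rewrite -!scalemxAl -!scalemxAr scalerA; congr (_ *: _).
    by rewrite wE !mulmxA.
  have -> : w (translate (act x) q) = cj x (w q).
    have [c cE] := hom_of_linear (@cj_is_linear _ _ _ d0 lam mu x).
    by rewrite wc // T'act // [in RHS](wc q Sq) -!cE linearZ.
  move/eqP; rewrite -subr_eq0 -{1}[cj x _]scale1r -scalerBl scaler_eq0 => /orP[|].
    by rewrite subr_eq0 => /eqP e; rewrite -[RHS]mul1r e mulfVK.
  rewrite -(cj0 d0 lam mu x) => /eqP/cj_inj; move/(_ Kx) => wq0.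
  by rewrite wq0 eqxx in nwq.
exists g, phi, (fun x => al x 0); split.
- apply/setP => y; rewrite mem_conjg invgK; apply/idP/idP => [/stabE|Ky]//.
  exact/stabE.
- by move=> x Kx; case: (alP x 0 Kx).
- by move=> lam; have [_ e] := phiP lam.
by move=> lam x Kx; have [_ e] := alP x lam Kx; rewrite (al_const x 0 lam).
Qed.

End Uniqueness.

(** * Existence of a datum for a twist *)

Section Burnside.

Lemma vspace_annihilator (k : fieldType) n (U : {vspace 'rV[k]_n}) : U != fullv ->
  exists2 v : 'cV[k]_n, v != 0 & forall u, u \in U -> u *m v = 0.
Proof.
move=> nU; pose Z := \matrix_(i < \dim U) tnth (vbasis U) i.
have lt : (\dim U < n)%N.
  rewrite ltnNge; apply: contra nU => le.
  by rewrite eqEdim subvf dimvf /dim /= mul1n.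
have /rowV0Pn[w /sub_kermxP wZ nw] : kermx Z^T != 0.
  rewrite -mxrank_eq0 mxrank_ker -lt0n subn_gt0 mxrank_tr.
  exact: leq_ltn_trans (rank_leq_row _) lt.
exists w^T => [|u /coord_vbasis ->].
  by apply: contra nw => /eqP e; rewrite -[w]trmxK e trmx0.
rewrite mulmx_suml big1 // => i _; rewrite -scalemxAl.
suff -> : (vbasis U)`_i *m w^T = 0 by rewrite scaler0.
apply: trmx_inj; rewrite trmx_mul trmxK trmx0.
have := congr1 (col i) wZ; rewrite colE -mulmxA -colE -tr_row rowK (tnth_nth 0) => ->.
by apply/matrixP => a b; rewrite !mxE.
Qed.

Lemma singular_shift (k : closedFieldType) n (X : 'M[k]_n) : (0 < n)%N ->
  exists c : k, (\rank (X - c%:M)%R < n)%N.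
Proof.
move=> n0; have /closed_rootP[c] : size (char_poly X) != 1%N.
  by rewrite size_char_poly; case: n n0 X.
rewrite -eigenvalue_root_char => /eigenvalueP[v vX nv]; exists c.
rewrite ltn_neqAle rank_leq_row andbT; apply: contra nv => fX.
rewrite -(mulmx_free_eq0 v fX) mulmxBr vX mul_mx_scalar subrr.
by [].
Qed.

(* An element C R of minimal rank has rank 1: for B in S, R B C - c has a kernel
   for some c, so C (R B C - c) R = 0 by minimality and R B C is a scalar. *)
Lemma burnside (k : closedFieldType) n (S : 'M[k]_n -> Prop) :
  S 1%:M -> (forall (c : k) X Y, S X -> S Y -> S (c *: X + Y)) ->
  (forall X Y, S X -> S Y -> S (X *m Y)) ->
  (forall x : 'cV_n, x != 0 -> forall v, exists2 s, S s & s *m x = v) ->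
  forall X, S X.
Proof.
case: n S => [|n] S S1 SL SM tr X; first by rewrite [X]flatmx0 -[0](flatmx0 1%:M).
have S0 : S 0 by have := SL (-1) _ _ S1 S1; rewrite scaleN1r addNr.
pose P r := `[< exists A, [/\ S A, A != 0 & \rank A = r] >].
have exP : exists r, P r.
  exists (\rank (1%:M : 'M[k]_n.+1)); apply/asboolP; exists 1%:M; split=> //.
  by rewrite -mxrank_eq0 mxrank1.
have [r /asboolP[A [SA nA rA]] minr] := ex_minnP exP.
have r0 : (0 < r)%N by rewrite -rA lt0n mxrank_eq0.
have defA := mulmx_base A; move: (col_base A) (row_base A) defA (col_base_full A) (row_base_free A).
rewrite rA => C R defA /row_fullP[C' C'C] /row_freeP[R' RR'].
have RBC B : S B -> exists c, R *m B *m C = c%:M.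
  move=> SB; have [c rc] := singular_shift (R *m B *m C) r0; exists c.
  apply/eqP; rewrite -subr_eq0; set Y := _ - _ in rc *.
  have SY : S (C *m Y *m R).
    rewrite mulmxBr mulmxBl mul_mx_scalar -scalemxAl defA addrC -scaleNr.
    by apply: SL => //; rewrite !mulmxA defA -mulmxA defA; apply: (SM) => //; apply: SM.
  have : C *m Y *m R == 0.
    apply/negPn/negP => nY.
    have /minr : P (\rank (C *m Y *m R)) by apply/asboolP; exists (C *m Y *m R).
    rewrite leqNgt => /negP; apply; apply: leq_ltn_trans rc.
    exact: leq_trans (mxrankM_maxl _ _) (mxrankM_maxr _ _).
  move/eqP/(congr1 (fun M => C' *m M *m R')).
  by rewrite !mulmxA C'C mul1mx -mulmxA RR' mulmx1 mulmx0 mul0mx => ->.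
(* For r at least 2, transitivity gives B in S with R B C e_0 = e_1, which no scalar does. *)
have r1 : r = 1%N.
  apply/eqP; rewrite eqn_leq r0 andbT leqNgt; apply/negP => r2.
  pose e (i : 'I_r) : 'cV[k]_r := delta_mx i 0.
  have nCe : C *m e (Ordinal r0) != 0.
    apply/eqP => /(congr1 (mulmx C')); rewrite mulmxA C'C mul1mx mulmx0.
    by move=> /matrixP/(_ (Ordinal r0) 0)/eqP; rewrite !mxE !eqxx oner_eq0.
  have [B SB BC] := tr _ nCe (R' *m e (Ordinal r2)).
  have [c cE] := RBC B SB.
  have := congr1 (mulmx R) BC; rewrite !mulmxA cE RR' mul1mx mul_scalar_mx.
  move=> /matrixP/(_ (Ordinal r2) 0)/eqP; rewrite !mxE !eqxx /= mulr0 eq_sym.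
  by rewrite oner_eq0.
subst r; rewrite r1 in C R defA C' C'C R' RR' RBC.
have nC : C != 0 by apply: contra nA => /eqP C0; rewrite -defA C0 mul0mx.
have nR : R != 0 by apply: contra nA => /eqP R0; rewrite -defA R0 mulmx0.
(* U collects the rows y with c y in S for every column c. It contains all R D with D in S, and
   transitivity leaves no nonzero column annihilated by all of these. *)
have [||U UP] := @vspace_of_closed k 'rV[k]_n.+1 (fun y => forall c : 'cV_n.+1, S (c *m y)).
- by move=> c; rewrite mulmx0.
- move=> c y z Sy Sz x; rewrite mulmxDr -scalemxAr.
  exact: SL.
have URD D : S D -> R *m D \in U.
  move=> SD; apply/UP => c; have [B SB <-] := tr C nC c.
  by rewrite mulmxA; apply: (SM) SD; rewrite -mulmxA defA; apply: SM.
have Uf : U = fullv.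
  apply/eqP/negPn/negP => /vspace_annihilator[v nv Uv].
  have [i ni] : exists i, R 0 i != 0.
    move: nR; apply: contraPP => nex; apply/negP/negPn/eqP/matrixP => a i.
    by rewrite (ord1 a) mxE; apply/eqP/negPn/negP => ni; apply: nex; exists i.
  have [D SD Dv] := tr v nv (delta_mx i 0).
  have := Uv _ (URD D SD); rewrite -mulmxA Dv -colE => /matrixP/(_ 0 0)/eqP.
  by rewrite !mxE (negPf ni).
rewrite [X]matrix_sum_delta; elim/big_rec: _ => // i Y _ SY.
rewrite -[X in S (X + _)]scale1r; apply: (SL) => //.
elim/big_rec: _ => // j Z _ SZ; apply: SL => //.
rewrite -(mul_delta_mx (0 : 'I_1)).
by move: (delta_mx i 0); apply/UP; rewrite Uf memvf.
Qed.

End Burnside.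

(** * Left ideals stable under the group *)

Section InvariantIdeal.
Variables (k : closedFieldType) (gT : finGroupType) (A : {group gT}).
Hypotheses (char0 : [pchar k] =i pred0) (abelA : abelian A).

Notation dualA := (dual k A).
Notation fn := {ffun gT -> k^o}.
Implicit Types (f h : fn) (x g y : gT) (lam mu nu kap m : dualA).

(* f in F_m is the sum of the delta_y * c_y, where
   c_y = sum_z delta_z * (z . x_y) is an invariant function built from the
   translates of f with the coefficients of the inverse of J (lam - m). *)
Lemma invariant_ideal_1 (J : twist k A) lam (N : fn -> Prop) f :
  N 0 -> (forall (c : k) h h', N h -> N h' -> N (c *: h + h')) ->
  (forall g h, N h -> N (translate g h)) ->
  (forall b h, N h -> N (op (J lam) b h)) ->
  (forall m h, N h -> N (pr m h)) ->
  N f -> f != 0 -> N cst1.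
Proof.
move=> N0 NL Nt Nop Npr Nf nf.
have NS I (r : seq I) (F : I -> fn) : (forall i, N (F i)) -> N (\sum_(i <- r) F i).
  move=> NF; elim/big_rec: _ => // i h _ Nh.
  by rewrite -[F i]scale1r; apply: NL.
have NZ c h : N h -> N (c *: h) by move=> Nh; rewrite -[_ *: h]addr0; apply: NL.
have [m nm] : exists m, pr m f != 0.
  move: nf; apply: contraPP => nex; apply/negP/negPn/eqP.
  rewrite -[f](pr_sum char0 abelA) big1 // => m _.
  by apply/eqP/negPn/negP => nm; apply: nex; exists m.
move: {nf Nf} (Npr m f Nf) nm (pr_in m f); set e := pr m f => Ne ne Fe.
have tJ := (is_twistP char0 abelA J).1 (twistP J).
pose u := J (lam - m); have uu : u \is a GRing.unit by case: (tJ (lam - m)).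
pose X y : fn := \sum_p gcoef u^-1 p *: translate (p.2 * p.1^-1 * y^-1)%g e.
have NX y : N (X y) by apply: (NS) => p; apply: NZ; apply: Nt.
have XE y w : X y w = ract u^-1 (fun p => e (y * p.1 * p.2^-1 * w)%g : k) 1%g :> k.
  rewrite fn_sum; apply: eq_bigr => -[p q] _; rewrite fnZ translateE /=.
  by rewrite !invMg !invgK !mulgA invg1 !mulg1.
pose c y : fn := \sum_z op (J lam) (delta z) (translate z (X y)).
have Nc y : N (c y) by apply: (NS) => z; apply: Nop; apply: Nt.
(* Summing delta_z times z X over z makes the evaluation point cancel: only X at p_1^-1 p_2
   remains. *)
have cc y g : c y g = c y 1%g :> k.
  have cE w : c y w = \sum_p gcoef (J lam) p * (X y (p.1^-1 * p.2)%g : k) :> k.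
    rewrite fn_sum; under eq_bigr => z _ do rewrite opE.
    rewrite exchange_big; apply: eq_bigr => p _ /=; rewrite (bigD1 (w * p.1)%g) //=.
    rewrite big1 ?addr0 => [|z nz]; rewrite !ffunE.
      by rewrite eqxx mul1r invMg -!mulgA mulKg.
    by rewrite eq_sym (negPf nz) mul0r mulr0.
  by rewrite !cE.
have eE : e = \sum_y op (J lam) (delta y) (c y).
  have FX y z : in_F m (translate z (X y)).
    by apply/in_F_translate/in_F_sum => p _; apply/in_FZ/in_F_translate.
  apply/ffunP=> g; have [_ _ as_ u1 _] := tJ lam.
  (* Associativity rewrites the products with u = J(lam - m) on delta_y and delta_z; summing, u
     meets the u^-1 inside X and cst1 * e is left. *)
  transitivity (\sum_y \sum_z op (J lam) (op u (delta y) (delta z)) (translate z (X y)) g); last first.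
    rewrite fn_sum; apply: eq_bigr => y _; rewrite op_sumr fn_sum; apply: eq_bigr => z _.
    by rewrite as_.
  rewrite -[e in LHS]u1 opE; under [RHS]eq_bigr => y _ do under eq_bigr => z _ do rewrite opE.
  rewrite pair_bigA exchange_big; apply: eq_bigr => -[a b] _ /=.
  rewrite -mulr_sumr; congr (_ * _); rewrite ffunE mul1r.
  transitivity (ract (u * u^-1) (fun p => e (g * a * p.1 * p.2^-1 * a^-1 * b)%g : k) 1%g).
    by rewrite mulrV // ract1 /= invg1 !mulg1 mulgK.
  rewrite ractM {1}/ract.
  rewrite [RHS](reindex (fun p : gT * gT => (g * a * p.1, g * a * p.2)%g)) /=; last first.
    exists (fun p : gT * gT => ((g * a)^-1 * p.1, (g * a)^-1 * p.2)%g) => -[p q] _ /=.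
      by rewrite !mulKg.
    by rewrite !mulKVg.
  apply: eq_bigr => -[p q] _ /=; rewrite opE (bigD1 (p, q)) //= !ffunE !eqxx !mulr1.
  rewrite big1 ?addr0 => [|[p' q'] npq]; last first.
    rewrite !ffunE -natrM mulnb; move: npq; rewrite xpair_eqE !(inj_eq (mulgI _)) /=.
    by move/negPf ->; rewrite mulr0.
  congr (_ * _); rewrite XE; apply: eq_bigr => -[s t] _ /=; congr (_ * e _).
  by rewrite !mul1g !invMg !mulgA mulgKV.
have [y ny] : exists y, c y 1%g != 0 :> k.
  move: ne; apply: contraPP => nex; apply/negP/negPn/eqP; rewrite eE big1 // => y _.
  suff -> : c y = 0 by rewrite op0r.
  apply/ffunP=> g; rewrite fn0 cc; apply/eqP/negPn/negP => ny.
  by apply: nex; exists y.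
have -> : @cst1 k gT = (c y 1%g : k)^-1 *: c y.
  by apply/ffunP=> g; rewrite fnZ cc ffunE mulVf.
exact: NZ.
Qed.

End InvariantIdeal.

(** * Simple graded modules *)

Section GradedModules.
Variables (k : closedFieldType) (gT : finGroupType) (A : {group gT}).
Hypotheses (char0 : [pchar k] =i pred0) (abelA : abelian A).

Notation dualA := (dual k A).
Notation fn := {ffun gT -> k^o}.
Implicit Types (f h : fn) (x g y : gT) (lam mu nu kap m : dualA).

Lemma vspace_basis_mx n (U : {vspace 'cV[k]_n}) :
  exists (B : 'M[k]_(n, \dim U)) (B' : 'M[k]_(\dim U, n)),
    B' *m B = 1%:M /\ forall u, u \in U <-> exists a : 'cV_(\dim U), u = B *m a.
Proof.
pose B := \matrix_(i < n, j < \dim U) (vbasis U)`_j i 0.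
have BE (a : 'cV_(\dim U)) : B *m a = \sum_j a j 0 *: (vbasis U)`_j.
  apply/matrixP => i l; rewrite (ord1 l) mxE summxE; apply: eq_bigr => j _.
  by rewrite !mxE mulrC.
have /row_freeP[D BD] : row_free B^T.
  rewrite -kermx_eq0; apply/eqP/row_matrixP => i; rewrite row0.
  have : B *m (row i (kermx B^T))^T = 0.
    by rewrite -[B]trmxK -trmx_mul -row_mul trmxK mulmx_ker row0 trmx0.
  rewrite BE; move/freeP: (basis_free (vbasisP U)) => fr /fr e.
  by apply/matrixP => a j; have := e j; rewrite (ord1 a) !mxE.
exists B, D^T; split; first by rewrite -[B]trmxK -trmx_mul BD trmx1.
move=> u; split=> [Uu|[a ->]].
  exists (\col_j coord (vbasis U) j u); rewrite BE {1}(coord_vbasis Uu).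
  by apply: eq_bigr => j _; rewrite mxE.
rewrite BE; apply: memv_suml => j _; apply: memvZ; apply: vbasis_mem.
by rewrite mem_nth // size_tuple.
Qed.

(* A module over the category of the F_m whose part of degree lam is the image of
   the idempotent E lam. *)
Definition graded_module (J : dualA -> galg k [the finGroupType of (gT * gT)%type])
    n (M : fn -> 'M[k]_n) (E : dualA -> 'M[k]_n) :=
  [/\ \sum_lam E lam = 1%:M /\
      (forall lam mu, E lam *m E mu = if lam == mu then E lam else 0),
      linear M,
      forall nu f h, M (op (J nu) f h) *m E nu = M f *m M h *m E nu,
      forall m mu f, in_F m f -> M f *m E mu = E (mu - m) *m (M f *m E mu)
    & M cst1 = 1%:M].

Definition fn_mx (L : fn -> fn) : 'M[k]_#|gT| :=
  \matrix_(i, j) L (delta (enum_val j)) (enum_val i).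

Lemma fn_mxE (L : fn -> fn) h : linear L -> fn_mx L *m fn_col h = fn_col (L h).
Proof.
move=> lL; have [l lE] := hom_of_linear lL; apply/matrixP => i j; rewrite !mxE.
rewrite -lE [h in RHS]fn_delta linear_sum fn_sum [RHS](reindex_onto enum_val enum_rank) /=.
  apply: eq_big => [a|a _]; first by rewrite enum_valK eqxx.
  by rewrite !mxE linearZ fnZ /= lE mulrC.
by move=> a _; rewrite enum_rankK.
Qed.

Lemma fn_mx_inj (X Y : 'M[k]_#|gT|) :
  (forall h, X *m fn_col h = Y *m fn_col h) -> X = Y.
Proof.
move=> e; apply/matrixP => i j; have /matrixP/(_ i 0) := e (delta (enum_val j)).
have d : fn_col (delta (enum_val j)) = delta_mx j 0 :> 'cV[k]_#|gT|.
  apply/matrixP => a b; rewrite !mxE !ffunE (inj_eq enum_val_inj) (ord1 b).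
  by rewrite eqxx andbT.
by rewrite d -!colE !mxE.
Qed.

(** The functor represented by the object 0: its part of degree lam is F_(0 - lam), the morphisms
    from 0 to lam. It provides a nonzero module from which a minimal one is chosen. *)
Lemma regular_graded_module (J : twist k A) :
  graded_module J (fun f => fn_mx (op (J 0) f)) (fun lam => fn_mx (pr (- lam))).
Proof.
have tJ := (is_twistP char0 abelA J).1 (twistP J).
have lo nu f : linear (op (J nu) f) by move=> c h h'; rewrite opDr opZr.
have lp m : linear (pr m : fn -> fn) by move=> c h h'; rewrite prD prZ.
split.
- split=> [|lam mu]; apply: fn_mx_inj => h.
    rewrite mulmx_suml mul1mx; under eq_bigr => lam _ do rewrite fn_mxE //.
    apply/matrixP => i j; rewrite summxE !mxE -[h in RHS](pr_sum char0 abelA) fn_sum.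
    by rewrite [RHS](reindex_inj oppr_inj); apply: eq_bigr => lam _; rewrite !mxE.
  rewrite -mulmxA !fn_mxE //; case: (eqVneq lam mu) => [->|ne].
    by rewrite fn_mxE // pr_id //; apply: pr_in.
  rewrite mul0mx (pr_out (pr_in (- mu) h)) ?(inj_eq oppr_inj) //.
  by apply/matrixP => i j; rewrite !mxE ffunE.
- move=> c f h; apply: fn_mx_inj => h'; rewrite mulmxDl -scalemxAl !fn_mxE // opDl opZl.
  by apply/matrixP => i j; rewrite !mxE fnD fnZ.
- move=> nu f h; apply: fn_mx_inj => h'; rewrite -!mulmxA !fn_mxE //.
  have [_ _ as_ _ _] := tJ 0; have := as_ (- nu) f h (pr (- nu) h') (pr_in _ _).
  by rewrite opprK add0r => ->.
- move=> m mu f Ff; apply: fn_mx_inj => h; rewrite -!mulmxA !fn_mxE //.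
  congr fn_col; symmetry; apply: (pr_id char0); rewrite opprB.
  by have [_ wt _ _ _] := tJ 0; apply: wt => //; apply: pr_in.
apply: fn_mx_inj => h; rewrite fn_mxE // mul1mx; congr fn_col.
by have [_ _ _ + _] := tJ 0; apply.
Qed.

Lemma restrict_graded_module J n (M : fn -> 'M[k]_n) E w (B : 'M[k]_(n, w)) (B' : 'M[k]_(w, n)) :
  graded_module J M E -> B' *m B = 1%:M ->
  (forall f, M f *m B = B *m (B' *m (M f *m B))) ->
  (forall lam, E lam *m B = B *m (B' *m (E lam *m B))) ->
  graded_module J (fun f => B' *m M f *m B) (fun lam => B' *m E lam *m B).
Proof.
move=> [[Es Eo] ML MM Mw M1] BB MB EB.
have mulB (X : 'M[k]_n) (Y : 'M[k]_n) : Y *m B = B *m (B' *m (Y *m B)) ->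
    (B' *m X *m B) *m (B' *m Y *m B) = B' *m (X *m Y) *m B.
  by move=> e; rewrite -!mulmxA -e.
have EB' mu (X : 'M[k]_n) : X *m B = B *m (B' *m (X *m B)) ->
    (X *m E mu) *m B = B *m (B' *m ((X *m E mu) *m B)).
  move=> e; set Y := X *m E mu.
  suff [Z ->] : exists Z, Y *m B = B *m Z by rewrite [B' *m _]mulmxA BB mul1mx.
  exists ((B' *m (X *m B)) *m (B' *m (E mu *m B))).
  by rewrite mulmxA -e -[RHS]mulmxA -EB mulmxA.
split.
- split=> [|lam mu]; first by rewrite -mulmx_suml -mulmx_sumr Es mulmx1.
  rewrite mulB // Eo; case: ifP => // _.
  by rewrite mulmx0 mul0mx.
- by move=> c f h; rewrite ML mulmxDr mulmxDl -scalemxAr -scalemxAl.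
- by move=> nu f h; rewrite !mulB ?MM.
- move=> m mu f Ff; rewrite !mulB //; last exact: EB'.
  by rewrite -Mw.
by rewrite M1 mulmx1.
Qed.

Section Minimal.
Variables (J : twist k A) (n : nat) (M : fn -> 'M[k]_n) (E : dualA -> 'M[k]_n).
Hypothesis gM : graded_module J M E.
Hypothesis minM : forall w (M' : fn -> 'M[k]_w) E', graded_module J M' E' ->
  (0 < w)%N -> (n <= w)%N.
Hypothesis n0 : (0 < n)%N.

(** The algebra to which Burnside's theorem is applied. Each block may use its own f, because only
    the component of f of weight mu - lam contributes to block (lam, mu); this is what puts the
    projections E in the algebra. *)
Let gen (X : 'M[k]_n) := forall lam mu, exists f, E lam *m X *m E mu = E lam *m M f *m E mu.

(** The orbit of x is a nonzero graded submodule, and minimality of the dimension makes it the whole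
    space. *)
Lemma minimal_transitive (x : 'cV[k]_n) : x != 0 ->
  (forall c X Y, gen X -> gen Y -> gen (c *: X + Y)) ->
  (forall X Y, gen X -> gen Y -> gen (X *m Y)) -> gen 1%:M ->
  (forall f, gen (M f)) -> (forall lam, gen (E lam)) ->
  forall v, exists2 X, gen X & X *m x = v.
Proof.
move=> nx gL gMul g1 gMf gE v.
have [||U UP] := @vspace_of_closed k 'cV[k]_n (fun v => exists2 X, gen X & X *m x = v).
- exists 0; last by rewrite mul0mx.
  by rewrite -[0](addNr 1%:M) -scaleN1r; apply: gL.
- move=> c _ _ [X gX <-] [Y gY <-]; exists (c *: X + Y); first exact: gL.
  by rewrite mulmxDl -scalemxAl.
have [B [B' [BB BU]]] := vspace_basis_mx U.
have inv X : gen X -> X *m B = B *m (B' *m (X *m B)).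
  move=> gX; apply/matrixP => i j.
  suff /matrixP/(_ i 0) : X *m (B *m delta_mx j (0 : 'I_1))
      = B *m (B' *m (X *m (B *m delta_mx j 0))) by rewrite !mulmxA -!colE !mxE.
  have /UP[Y gY <-] : B *m delta_mx j (0 : 'I_1) \in U by apply/BU; eexists.
  have /BU[a ->] : X *m (Y *m x) \in U.
    by apply/UP; exists (X *m Y); [apply: gMul | rewrite mulmxA].
  by rewrite [B' *m _]mulmxA BB mul1mx.
have dU : (0 < \dim U)%N.
  rewrite lt0n dimv_eq0; apply: contra nx => /eqP U0; rewrite -memv0 -U0; apply/UP.
  by exists 1%:M; rewrite ?mul1mx.
have := minM (restrict_graded_module gM BB (fun f => inv _ (gMf f)) (fun l => inv _ (gE l))) dU.
move=> le; apply/UP; have -> : U = fullv; last exact: memvf.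
by apply/eqP; rewrite eqEdim subvf dimvf /dim /= muln1.
Qed.

(** By Burnside every matrix satisfies [gen]. Closure under products comes from summing, over the
    middle degree, the J-products of homogeneous components. *)
Lemma minimal_block_surj lam mu Y : exists f, E lam *m M f *m E mu = E lam *m Y *m E mu.
Proof.
have [[Es Eo] ML MM Mw M1] := gM; have [m mE] := hom_of_linear ML.
have M0 : M 0 = 0 by rewrite -mE linear0.
have gL c X Z : gen X -> gen Z -> gen (c *: X + Z).
  move=> gX gZ a b; have [f ef] := gX a b; have [h eh] := gZ a b.
  exists (c *: f + h); rewrite ML !mulmxDr !mulmxDl -!scalemxAr -!scalemxAl.
  by rewrite ef eh.
have idE c : E c *m E c = E c by rewrite Eo eqxx.
have blk a b h : E a *m M (pr (b - a) h) *m E b = E a *m M h *m E b.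
  rewrite -[h in RHS](pr_sum char0 abelA) -[in RHS]mE (linear_sum m) mulmx_sumr mulmx_suml.
  rewrite (bigD1 (b - a)) //= mE big1 ?addr0 // => q nq.
  rewrite mE -mulmxA (Mw q) ?mulmxA ?Eo; last exact: pr_in.
  case: eqP => [e|_]; last by rewrite !mul0mx.
  by rewrite e subKr eqxx in nq.
have gMul X Z : gen X -> gen Z -> gen (X *m Z).
  move=> gX gZ a b; have [f fE] := choice (fun c => gX a c); have [h hE] := choice (fun c => gZ c b).
  exists (\sum_c op (J b) (pr (c - a) (f c)) (pr (b - c) (h c))).
  have -> : X *m Z = \sum_c X *m E c *m Z by rewrite -mulmx_suml -mulmx_sumr Es mulmx1.
  rewrite -mE (linear_sum m) !mulmx_sumr !mulmx_suml; apply: eq_bigr => c _.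
  rewrite /= mE -[RHS]mulmxA MM -[M _ *m M _ *m E b]mulmxA (Mw (b - c)) ?subKr; last exact: pr_in.
  set f' := pr _ _; set h' := pr _ _.
  transitivity ((E a *m M f' *m E c) *m (E c *m M h' *m E b)); last first.
    by rewrite -!mulmxA [E c *m (E c *m _)]mulmxA idE.
  rewrite !blk -fE -hE.
  by rewrite -!mulmxA [E c *m (E c *m _)]mulmxA idE.
have g1 : gen 1%:M by move=> a b; exists cst1; rewrite M1.
have gMf f : gen (M f) by move=> a b; exists f.
have gE c : gen (E c).
  move=> a b; rewrite Eo; case: eqP => _.
    by exists cst1; rewrite M1 mulmx1.
  by exists 0; rewrite M0 mulmx0 !mul0mx.
have tr (x : 'cV_n) : x != 0 -> forall v, exists2 X, gen X & X *m x = v.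
  by move=> nx; apply: minimal_transitive.
have [f fE] := burnside g1 gL gMul tr Y lam mu.
by exists f.
Qed.

End Minimal.

Lemma idem_factor n (E : 'M[k]_n) : E *m E = E ->
  exists r (C : 'M[k]_(n, r)) (R : 'M[k]_(r, n)), C *m R = E /\ R *m C = 1%:M.
Proof.
move=> EE; move: (mulmx_base E) (col_base_full E) (row_base_free E).
move: (col_base E) (row_base E) => C R CR /row_fullP[C' C'C] /row_freeP[R' RR'].
exists (\rank E), C, R; split=> //.
have : C *m (R *m C) *m R = C *m R by rewrite mulmxA -mulmxA CR EE.
move/(congr1 (fun X => C' *m X *m R')); rewrite !mulmxA C'C !mul1mx.
by rewrite -!mulmxA RR' !mulmx1.
Qed.

(* A graded module of minimal dimension is simple; T consists of its graded blocks. *)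
Lemma functor_of_twist (J : twist k A) : exists (n_ : dualA -> nat) (T : hom_family n_),
  [/\ functorial J T, forall lam, T lam lam cst1 = 1%:M,
      forall lam mu Y, exists2 f, in_F (mu - lam) f & T lam mu f = Y
    & exists lam, (0 < n_ lam)%N].
Proof.
pose P n := `[< exists (M : fn -> 'M[k]_n) E, graded_module J M E /\ (0 < n)%N >].
have exP : exists n, P n.
  exists #|gT|; apply/asboolP; do 2!eexists; split; first exact: regular_graded_module.
  by apply/card_gt0P; exists 1%g.
have [n /asboolP[M [E [gM n0]]] minn] := ex_minnP exP.
have minM w (M' : fn -> 'M[k]_w) E' : graded_module J M' E' -> (0 < w)%N -> (n <= w)%N.
  by move=> gM' w0; apply: minn; apply/asboolP; exists M', E'.
have blocks := minimal_block_surj gM minM.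
have [[Es Eo] ML MM Mw M1] := gM.
have ex lam := idem_factor (etrans (Eo lam lam) (ifT _ _ (eqxx lam))).
have /fin_all_exists[n_ /fin_all_exists[C /fin_all_exists[R CRP]]] := ex.
have CR lam : C lam *m R lam = E lam by case: (CRP lam).
have RC lam : R lam *m C lam = 1%:M by case: (CRP lam).
have EC lam : E lam *m C lam = C lam by rewrite -CR -mulmxA RC mulmx1.
have RE lam : R lam *m E lam = R lam by rewrite -CR mulmxA RC mul1mx.
have [|T TE] := hom_family_ex (n_ := n_)
    (F := fun lam mu f => R lam *m M f *m C mu).
  by move=> lam mu c f h; rewrite ML mulmxDr mulmxDl -scalemxAr -scalemxAl.
have fT : functorial J T.
  split=> [lam mu m f Ff nm|lam nu f h].
    rewrite TE -EC -mulmxA [M f *m _]mulmxA (Mw m) // -RE !mulmxA.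
    rewrite -[R lam *m _ *m _]mulmxA Eo; case: eqP => [e|_].
      by rewrite e subKr eqxx in nm.
    by rewrite mulmx0 !mul0mx.
  rewrite TE -(EC nu) -mulmxA [M _ *m _]mulmxA MM -!mulmxA EC.
  rewrite -[M h *m _]mul1mx -Es mulmx_suml !mulmx_sumr; apply: eq_bigr => mu _.
  by rewrite !TE -CR !mulmxA.
exists n_, T; split=> //.
- by move=> lam; rewrite TE M1 mulmx1 RC.
- move=> lam mu Y; have [f fE] := blocks lam mu (C lam *m Y *m R mu).
  exists (pr (mu - lam) f); first exact: pr_in.
  rewrite (fun_pr char0 abelA fT) TE.
  have := congr1 (fun X => R lam *m X *m C mu) fE.
  rewrite /= !mulmxA RE -!mulmxA EC => ->.
  by rewrite !mulmxA RC mul1mx -mulmxA RC mulmx1.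
apply: contrapT => nex; have : (1%:M : 'M[k]_n) != 0 by rewrite -mxrank_eq0 mxrank1 -lt0n.
case/eqP; rewrite -Es big1 // => lam _; rewrite -CR.
have /eqP n0' : n_ lam == 0%N by rewrite -leqn0 leqNgt; apply/negP => lt; apply: nex; exists lam.
by apply/matrixP => i j; rewrite !mxE big1 // => -[l lt]; exfalso; move: lt; rewrite n0'.
Qed.

End GradedModules.

Lemma eq_mulmx_cV (k : fieldType) m n (X Y : 'M[k]_(m, n)) :
  (forall v : 'cV_n, X *m v = Y *m v) -> X = Y.
Proof.
move=> e; apply/matrixP => i j; have := e (delta_mx j 0).
by rewrite -!colE => /matrixP/(_ i 0); rewrite !mxE.
Qed.

Lemma span_mulmx (k : fieldType) n (s : seq 'M[k]_n) X Y :
  (forall P Q, P \in s -> Q \in s -> P *m Q \in <<s>>%VS) ->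
  X \in <<s>>%VS -> Y \in <<s>>%VS -> X *m Y \in <<s>>%VS.
Proof.
move=> sM /(@coord_span _ _ _ (in_tuple s)) -> /(@coord_span _ _ _ (in_tuple s)) ->.
rewrite mulmx_suml; apply: memv_suml => i _; rewrite mulmx_sumr; apply: memv_suml => j _.
by rewrite -scalemxAl -scalemxAr; apply/memvZ/memvZ/sM; apply: mem_nth.
Qed.

(** * The datum carried by a simple functor *)

Section DatumFromTwist.
Variables (k : closedFieldType) (gT : finGroupType) (A : {group gT}).
Hypotheses (char0 : [pchar k] =i pred0) (abelA : abelian A).

Notation dualA := (dual k A).
Notation fn := {ffun gT -> k^o}.
Implicit Types (f h : fn) (x g y : gT) (lam mu nu kap m : dualA).

(** A section of S over P, extended to all of V because [Ind_iso] asks for a globally defined map: a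
    partial inverse of S on Q, followed by the projection to Q. *)
Lemma hom_inverse (V W : vectType k) (P : V -> Prop) (Q : W -> Prop) (S : W -> V) :
  Q 0 -> (forall (c : k) u v, Q u -> Q v -> Q (c *: u + v)) -> linear S ->
  (forall v, P v -> exists2 w, Q w & S w = v) ->
  exists E : 'Hom(V, W), forall v, P v -> Q (E v) /\ S (E v) = v.
Proof.
move=> Q0 QL lS oS; have [U UP] := vspace_of_closed Q0 QL.
have [s sE] := hom_of_linear lS; pose p := (s \o projv U)%VF.
exists (projv U \o p^-1)%VF => v Pv; rewrite !lfunE /=.
have pE w : p w = S (projv U w) by rewrite lfunE /= sE.
split; first by apply/UP/memv_proj.
rewrite -pE limg_lfunVK //; have [w Qw <-] := oS v Pv.
by apply/memv_imgP; exists w; rewrite ?memvf // pE projv_id //; apply/UP.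
Qed.

Variables (J : twist k A) (n_ : dualA -> nat) (T : hom_family n_).
Hypothesis fT : functorial J T.
Hypothesis T1 : forall lam, T lam lam cst1 = 1%:M.
Hypothesis Ts : forall lam mu Y, exists2 f, in_F (mu - lam) f & T lam mu f = Y.
Hypothesis ex_pos : exists lam, (0 < n_ lam)%N.

Let Tpr lam mu f : T lam mu (pr (mu - lam) f) = T lam mu f.
Proof. exact: (fun_pr char0 abelA fT). Qed.

(** Functions all of whose translates are killed form a graded left ideal stable under G. Were it
    nonzero it would contain cst1, which is sent to the identity of a nonzero space. *)
Lemma functor_inj_pos mu f : (0 < n_ mu)%N ->
  (forall lam g, T lam mu (translate g f) = 0) -> f = 0.
Proof.
move=> n0 Nf; apply/eqP/negPn/negP => nf.
have : T mu mu cst1 = 0.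
  rewrite -[cst1](translate1 (V := k^o)); move: mu 1%g {n0} Nf => mu g0 Nf.
  apply: (invariant_ideal_1 char0 abelA (J := J) (lam := mu)
    (N := fun f => forall lam g, T lam mu (translate g f) = 0) _ _ _ _ _ Nf nf).
  - by move=> lam g; rewrite translate0 linear0.
  - by move=> c h h' Nh Nh' lam g; rewrite translate_linear linearP /= Nh Nh' scaler0 addr0.
  - by move=> x h Nh lam g; rewrite -translateM.
  - move=> b h Nh lam g; rewrite translate_op (fun_comp fT) big1 // => kap _.
    by rewrite Nh mulmx0.
  move=> m h Nh lam g; rewrite translate_pr; case: (eqVneq m (mu - lam)) => [->|nm].
    by rewrite Tpr Nh.
  by rewrite (fun_out fT (pr_in m _) nm).
rewrite T1 => /eqP; rewrite -mxrank_eq0 mxrank1 => /eqP e.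
by rewrite e in n0.
Qed.

(** If V_lam were 0, every function of weight mu - lam would be killed with its translates, against
    injectivity at mu; the component of delta_1 of that weight is not 0. *)
Lemma functor_pos lam : (0 < n_ lam)%N.
Proof.
have [mu n0] := ex_pos; rewrite lt0n; apply/negP => /eqP nl.
have : pr (mu - lam) (delta 1%g : fn) = 0.
  apply: (functor_inj_pos n0) => kap g; rewrite translate_pr.
  case: (eqVneq (mu - lam) (mu - kap)) => [/addrI/oppr_inj e|nm].
    subst kap; apply/matrixP => -[i lt]; exfalso; move: lt; rewrite nl.
    by [].
  by rewrite (fun_out fT (pr_in _ _) nm).
move=> /ffunP/(_ 1%g)/eqP; rewrite prE fn0 mulf_eq0 invr_eq0.
rewrite (negPf (cardG_neq0 char0 A)) (bigD1 1%g) //= mulg1 big1 ?addr0 => [|a /andP[_ na]].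
  by rewrite (dual1 (mu - lam)) invr1 mul1r /delta ffunE eqxx oner_eq0.
by rewrite mul1g /delta [X in _ * X]ffunE (negPf na) mulr0.
Qed.

Lemma functor_inj mu f : (forall lam g, T lam mu (translate g f) = 0) -> f = 0.
Proof. exact/functor_inj_pos/functor_pos. Qed.

Lemma functor_inj_in lam mu f : in_F (mu - lam) f ->
  (forall g, T lam mu (translate g f) = 0) -> f = 0.
Proof.
move=> Ff e; apply: (functor_inj (mu := mu)) => kap g.
case: (eqVneq kap lam) => [->|nk]; first exact: e.
apply: (fun_out fT (in_F_translate g Ff)); apply: contra nk.
by move=> /eqP/addrI/oppr_inj ->.
Qed.

Definition kernel_stable x := forall lam mu f, T lam mu f = 0 -> T lam mu (translate x f) = 0.

Definition kernel_stab := [set x | `[<kernel_stable x>]].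

Lemma kernel_stab_group : group_set kernel_stab.
Proof.
apply/group_setP; split=> [|x y].
  by rewrite inE; apply/asboolP => lam mu f; rewrite translate1.
rewrite !inE => /asboolP sx /asboolP sy; apply/asboolP => lam mu f f0.
by rewrite translateM; apply/sx/sy.
Qed.

Let K := Group kernel_stab_group.

(** For x in K the functor f ↦ T(x f) vanishes on the kernel of T, so Skolem-Noether yields the
    matrices pi(x). *)
Lemma kernel_intertwiner : exists pi : forall lam, gT -> 'M[k]_(n_ lam),
  (forall lam x, x \in K -> pi lam x \in unitmx) /\
  (forall lam mu x f, x \in K ->
     T lam mu (translate x f) = pi lam x *m T lam mu f *m invmx (pi mu x)).
Proof.
have ex x : exists phi : forall lam, 'M[k]_(n_ lam), x \in K ->
    (forall lam, phi lam \in unitmx) /\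
    (forall lam mu f, T lam mu (translate x f) *m phi mu = phi lam *m T lam mu f).
  case: (boolP (x \in K)) => [|_]; last by exists (fun=> 0).
  rewrite inE => /asboolP sx.
  have lT lam mu : linear (fun f => T lam mu (translate x f)).
    by move=> c f h; rewrite translate_linear linearP.
  have [||||||||phi [phiT phi_inj]] := @intertwiner_ex k fn dualA
      (fun lam mu f => in_F (mu - lam) f) (fun _ _ nu f h => op (J nu) f h) n_ n_ T
      (fun lam mu => lin_hom (lT lam mu)) 0 (Ordinal (functor_pos 0)) cst1.
  - by move=> a b c f f' Ff Ff'; apply/in_FD/Ff'/in_FZ.
  - by move=> a b c f h Ff Fh; apply: op_in2 Ff Fh.
  - by move=> a b c f h Ff Fh; apply: (fun_mull fT).
  - move=> a b c f h Ff Fh; rewrite !lin_homE translate_op; apply: (fun_mull fT).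
    exact: in_F_translate.
  - exact: Ts.
  - by move=> a b f _; rewrite lin_homE; apply: sx.
  - by rewrite subrr; apply: in_F_cst1.
  - rewrite lin_homE translate_cst1 T1 -mxrank_eq0 mxrank1 -lt0n.
    exact: functor_pos.
  exists phi => _; split=> [lam|lam mu f]; first exact/inj_unitmx/phi_inj.
  rewrite -Tpr -translate_pr -[in RHS]Tpr -(phiT lam mu); last exact: pr_in.
  by rewrite lin_homE.
have [phi phiP] := choice ex; exists (fun lam x => phi x lam).
split=> [lam x Kx|lam mu x f Kx]; have [u e] := phiP x Kx; first exact: u.
by rewrite -e mulmxK.
Qed.

Variable pi : forall lam, gT -> 'M[k]_(n_ lam).
Hypothesis pi_unit : forall lam x, x \in K -> pi lam x \in unitmx.
Hypothesis piT : forall lam mu x f, x \in K ->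
  T lam mu (translate x f) = pi lam x *m T lam mu f *m invmx (pi mu x).

Let pcj lam mu x (Y : 'M[k]_(n_ lam, n_ mu)) := pi lam x *m Y *m invmx (pi mu x).

Let pcjM lam mu x y (Y : 'M[k]_(n_ lam, n_ mu)) : x \in K -> y \in K ->
  pcj (x * y)%g Y = pcj x (pcj y Y).
Proof.
move=> Kx Ky; have [f _ <-] := Ts Y.
by rewrite /pcj -!piT ?groupM // translateM.
Qed.

Let pcj1 lam mu (Y : 'M[k]_(n_ lam, n_ mu)) : pcj 1%g Y = Y.
Proof. by have [f _ <-] := Ts Y; rewrite /pcj -piT // translate1. Qed.

(** Conjugation by pi(x) pi(y) and by pi(xy) agree on the values of T, that is on all matrices, so
    the quotient is central. *)
Lemma intertwiner_mul lam x y : x \in K -> y \in K ->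
  exists2 c : k, c != 0 & pi lam x *m pi lam y = c *: pi lam (x * y)%g.
Proof.
move=> Kx Ky; have Kxy := groupM Kx Ky.
have [M|c cE] := @scalar_mx_center k _ (invmx (pi lam (x * y)%g) *m (pi lam x *m pi lam y)).
  have := pcjM M Kx Ky; rewrite /pcj => e.
  apply: (can_inj (mulKmx (pi_unit lam Kxy))); rewrite /= !mulmxA mulmxV ?pi_unit // mul1mx.
  have := congr1 (mulmx^~ (pi lam x *m pi lam y)) e; rewrite /= !mulmxA.
  by rewrite mulmxKV ?pi_unit // mulmxKV ?pi_unit // => <-.
have e : pi lam x *m pi lam y = c *: pi lam (x * y)%g.
  by rewrite -mul_mx_scalar -cE mulKVmx // pi_unit.
exists c => //; apply/eqP => c0; have : pi lam x *m pi lam y \in unitmx by rewrite unitmx_mul !pi_unit.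
rewrite e c0 scale0r => /mxrank_unit; rewrite mxrank0 => n0.
by have := functor_pos lam; rewrite -n0.
Qed.

Lemma intertwiner_projective lam : projective_rep K (pi lam).
Proof.
split; [exact: functor_pos | by move=> g Kg; apply: pi_unit |].
have ex (p : gT * gT) : exists c : k, p.1 \in K -> p.2 \in K ->
    c != 0 /\ pi lam p.1 *m pi lam p.2 = c *: pi lam (p.1 * p.2)%g.
  case: (boolP (p.1 \in K)) => [K1|_]; last by exists 0.
  case: (boolP (p.2 \in K)) => [K2|_]; last by exists 0.
  by have [c c0 e] := intertwiner_mul lam K1 K2; exists c.
have [c cP] := choice ex; exists (fun x y => c (x, y)) => x y Kx Ky.
  by case: (cP (x, y) Kx Ky).
by case: (cP (x, y) Kx Ky).
Qed.

Lemma intertwiner_tens_linear lam mu :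
  linear_rep K (tens_rep (pi lam) (dual_rep (pi mu))).
Proof.
have tE x Y : tens_rep (pi lam) (dual_rep (pi mu)) x *m vec Y = vec (pcj x Y).
  by rewrite tens_vec trmxK.
move=> g h Kg Kh; apply: eq_mulmx_cV => v.
by rewrite -[v]unvecK -mulmxA !tE pcjM.
Qed.

(* If T f = 0 and T (g f) <> 0, multiplying f by preimages of matrix units yields an
   element of the kernel whose translate by g is mapped to 1; subtract it from 1. *)
Lemma kernel_separate1 kap g : g \notin K -> exists e,
  [/\ in_F (kap - kap) e, T kap kap e = 1%:M & T kap kap (translate g e) = 0].
Proof.
rewrite inE => /asboolP ng.
have [lam [mu [f [Ff f0 gf]]]] : exists lam mu f,
    [/\ in_F (mu - lam) f, T lam mu f = 0 & T lam mu (translate g f) != 0].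
  apply: contrapT => H; apply: ng => lam mu f f0; apply/eqP/negPn/negP => nz.
  apply: H; exists lam, mu, (pr (mu - lam) f).
  by rewrite translate_pr !Tpr; split=> //; apply: pr_in.
have [i [j nz]] : exists i j, T lam mu (translate g f) i j != 0.
  apply: contrapT => H; case/eqP: gf; apply/matrixP => i j; rewrite mxE.
  by apply/eqP/negPn/negP => nz; apply: H; exists i, j.
have [Z ZE] : exists Z, T lam mu (translate g f) = Z by eexists.
rewrite ZE in nz.
have /choice[a aP] s : exists a, in_F (lam - kap) a /\ T kap lam a = delta_mx s i.
  by have [a Fa Ta] := Ts (delta_mx s i : 'M[k]_(n_ kap, n_ lam)); exists a.
have /choice[b bP] s : exists b, in_F (kap - mu) b /\ T mu kap b = delta_mx j s.
  by have [b Fb Tb] := Ts (delta_mx j s : 'M[k]_(n_ mu, n_ kap)); exists b.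
pose t s := op (J kap) (translate g^-1%g (a s)) (op (J kap) f (translate g^-1%g (b s))).
have Fa s : in_F (lam - kap) (translate g^-1%g (a s)).
  by apply: in_F_translate; case: (aP s).
have Fb s : in_F (kap - mu) (translate g^-1%g (b s)).
  by apply: in_F_translate; case: (bP s).
pose e' := (Z i j)^-1 *: \sum_s t s.
have T0 : T kap kap e' = 0.
  rewrite linearZ linear_sum /= big1 ?scaler0 // => s _.
  by rewrite (fun_mull fT _ _ (Fa s)) (fun_mull fT _ _ Ff) f0 mul0mx mulmx0.
have Tg : T kap kap (translate g e') = 1%:M.
  rewrite translateZ translate_sum linearZ linear_sum /=.
  rewrite (eq_bigr (fun s => Z i j *: delta_mx s s)) => [|s _].
    rewrite -scaler_sumr scalerA mulVf // scale1r.
    by rewrite -[RHS]diag_const_mx diag_mx_sum_delta; apply: eq_bigr => s _; rewrite mxE scale1r.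
  case: (aP s) => Fas Ta; case: (bP s) => Fbs Tb.
  rewrite !translate_op !translateKV (fun_mull fT _ _ Fas).
  rewrite (fun_mull fT _ _ (in_F_translate _ Ff)) ZE Ta Tb mulmxA.
  exact: delta_mul3.
exists (cst1 - e'); split.
- apply: in_FD; first by rewrite subrr; apply: in_F_cst1.
  rewrite -scaleN1r; apply/in_FZ/in_FZ/in_F_sum => s _; apply: op_in2 (Fa s) _ => //.
  exact: op_in2 Ff (Fb s).
- by rewrite linearB /= T0 subr0 T1.
by rewrite -scaleN1r translateD translateZ scaleN1r linearB /= Tg translate_cst1 T1 subrr.
Qed.

(** The product of the functions separating K from each single g outside K: all factors map to 1,
    and for each such g one factor vanishes. *)
Lemma kernel_separate kap : exists e, [/\ in_F (kap - kap) e, T kap kap e = 1%:M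
  & forall g, g \notin K -> T kap kap (translate g e) = 0].
Proof.
suff [e [Fe e1 e0]] : exists e, [/\ in_F (kap - kap) e, T kap kap e = 1%:M
    & forall g, g \in enum gT -> g \notin K -> T kap kap (translate g e) = 0].
  by exists e; split=> // g; apply: e0; rewrite mem_enum.
elim: (enum gT) => [|x s [e [Fe e1 e0]]].
  by exists cst1; split=> //; rewrite subrr; apply: in_F_cst1.
case: (boolP (x \in K)) => Kx.
  exists e; split=> // g; rewrite inE => /orP[/eqP ->|]; last exact: e0.
  by rewrite Kx.
have [e' [Fe' e1' e0']] := kernel_separate1 kap Kx.
exists (op (J kap) e e'); split=> [||g].
- exact: op_in2 Fe Fe'.
- by rewrite (fun_mull fT _ _ Fe) e1 e1' mulmx1.
rewrite inE translate_op (fun_mull fT _ _ (in_F_translate _ Fe)) => /orP[/eqP ->|sg] nKg.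
  by rewrite e0' mulmx0.
by rewrite e0 // mul0mx.
Qed.

(** Multiplication by the separating e turns any preimage v of Y into one supported on K. The sum of
    the translates g v(F(g)) hits each value |K| times. *)
Lemma functor_surj lam mu (F : gT -> 'M[k]_(n_ lam, n_ mu)) :
  (forall g x, x \in K -> F (g * x)%g = pcj x^-1%g (F g)) ->
  exists2 f, in_F (mu - lam) f & forall g, T lam mu (translate g^-1%g f) = F g.
Proof.
move=> eF; have [e [Fe e1 e0]] := kernel_separate mu.
have /choice[u uP] Y : exists u, in_F (mu - lam) u /\ T lam mu u = Y.
  by have [u Fu Tu] := Ts Y; exists u.
pose v Y := op (J mu) (u Y) e.
have Fv Y : in_F (mu - lam) (v Y) by case: (uP Y) => Fu _; apply: op_in2 Fu Fe.
have Tv Y g : T lam mu (translate g (v Y)) = if g \in K then pcj g Y else 0.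
  case: (uP Y) => Fu Tu; case: (boolP (g \in K)) => Kg.
    by rewrite piT // (fun_mull fT _ _ Fu) Tu e1 mulmx1.
  by rewrite translate_op (fun_mull fT _ _ (in_F_translate _ Fu)) e0 // mulmx0.
exists ((#|K|%:R)^-1 *: \sum_g translate g (v (F g))).
  by apply/in_FZ/in_F_sum => g _; apply: in_F_translate.
move=> h; rewrite translateZ translate_sum linearZ linear_sum /=.
rewrite (reindex_inj (mulgI h)) /=.
rewrite (eq_bigr (fun x => if x \in K then F h else 0)) => [|x _]; last first.
  rewrite -translateM mulKg Tv; case: ifP => // Kx.
  by rewrite eF // -pcjM ?groupV // mulgV pcj1.
by rewrite -big_mkcond sumr_const -scaler_nat scalerA mulVf ?scale1r // (cardG_neq0 char0 K).
Qed.

(** The constant induced function Y comes from a translation invariant f, which is a multiple of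
    cst1. *)
Lemma intertwiner_commutant lam (Y : 'M[k]_(n_ lam)) :
  (forall x, x \in K -> pcj x Y = Y) -> exists c, Y = c%:M.
Proof.
move=> eY; have [|f Ff fE] := @functor_surj lam lam (fun=> Y).
  by move=> g x Kx; rewrite eY ?groupV.
have inv x : translate x f = f.
  apply/eqP; rewrite -subr_eq0; apply/eqP/(@functor_inj_in lam lam).
    by rewrite -scaleN1r; apply/in_FD/in_FZ/Ff/in_F_translate.
  move=> g; rewrite -scaleN1r translateD translateZ -translateM scaleN1r linearB /=.
  by rewrite -[g]invgK fE -[(_ * x)%g]invgK fE subrr.
exists (f 1%g); rewrite -(fE 1%g) inv -scalemx1 -T1 -linearZ; congr (T _ _ _).
by apply/ffunP=> g; rewrite fnZ /cst1 ffunE mulr1; apply: in_F_inv.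
Qed.

(* An invariant subspace U = B k^d is all of k^n: averaging the projector B B' over
   K gives a scalar which maps k^n into U and acts on U as multiplication by |K|. *)
Lemma intertwiner_irreducible lam : irreducible_rep K (pi lam).
Proof.
pose s := [seq pi lam g | g in K]; have sK g : g \in K -> pi lam g \in <<s>>%VS.
  by move=> Kg; apply/memv_span/image_f.
have s1 : 1%:M \in <<s>>%VS.
  have [c c0 e] := intertwiner_mul lam (group1 K) (group1 K).
  have -> : 1%:M = c^-1 *: pi lam 1%g; last by apply/memvZ/sK.
  have := congr1 (mulmx (invmx (pi lam 1%g))) e; rewrite mulKmx ?pi_unit //.
  rewrite mulg1 -scalemxAr mulVmx ?pi_unit // => ->.
  by rewrite scalerA mulVf // scale1r.
have sM X Y : X \in <<s>>%VS -> Y \in <<s>>%VS -> X *m Y \in <<s>>%VS.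
  apply: span_mulmx => _ _ /imageP[g Kg ->] /imageP[h Kh ->].
  by have [c _ ->] := intertwiner_mul lam Kg Kh; apply/memvZ/sK/groupM.
have sV g : g \in K -> invmx (pi lam g) \in <<s>>%VS.
  move=> Kg; have [c c0 e] := intertwiner_mul lam Kg (groupVr Kg).
  have [c' c0' e'] := intertwiner_mul lam (group1 K) (group1 K).
  have -> : invmx (pi lam g) = (c * c')^-1 *: pi lam g^-1%g; last by apply/memvZ/sK/groupVr.
  have p1 : pi lam 1%g = c'%:M.
    have := congr1 (mulmx (invmx (pi lam 1%g))) e'; rewrite mulKmx ?pi_unit //.
    by rewrite mulg1 -scalemxAr mulVmx ?pi_unit // scalemx1.
  apply: (can_inj (mulKmx (pi_unit lam Kg))).
  rewrite mulmxV ?pi_unit // -scalemxAr e mulgV p1 scale_scalar_mx scale_scalar_mx.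
  by rewrite mulVf // mulf_neq0.
apply/vspaceP => X; rewrite memvf -/s; apply/idP; move: X.
apply: (@burnside k _ (fun X => X \in <<s>>%VS)) => //.
  by move=> c X Y SX SY; apply/memvD/SY/memvZ.
move=> x x0 v; have [||U UP] := @vspace_of_closed k _
  (fun u : 'cV_(n_ lam) => exists2 X, X \in <<s>>%VS & X *m x = u).
- by exists 0; [apply: mem0v | rewrite mul0mx].
- move=> c _ _ [X SX <-] [Y SY <-]; exists (c *: X + Y); first by apply/memvD/SY/memvZ.
  by rewrite mulmxDl scalemxAl.
apply/UP; have Ux : x \in U by apply/UP; exists 1%:M; rewrite ?mul1mx.
have Us X u : X \in <<s>>%VS -> u \in U -> X *m u \in U.
  by move=> SX /UP[Y SY <-]; apply/UP; exists (X *m Y); [apply: sM | rewrite mulmxA].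
have [B [B' [BB' BU]]] := vspace_basis_mx U.
pose q := \sum_(g in K) pcj g (B *m B').
have qU u : q *m u \in U.
  rewrite mulmx_suml; apply: memv_suml => g Kg; rewrite /pcj -!mulmxA.
  by apply: (Us) (sK g Kg) _; apply/BU; eexists.
have qid u : u \in U -> q *m u = #|K|%:R *: u.
  move=> Uu; rewrite mulmx_suml (eq_bigr (fun=> u)) => [|g Kg].
    by rewrite sumr_const scaler_nat.
  have /BU[a aE] := Us _ _ (sV g Kg) Uu.
  by rewrite /pcj -!mulmxA aE (mulmxA B') BB' mul1mx -aE mulKVmx // pi_unit.
have [x' Kx'|c qE] := @intertwiner_commutant lam q.
  have [p pE] : exists p : 'Hom('M[k]_(n_ lam), 'M[k]_(n_ lam)), forall Y, p Y = pcj x' Y.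
    by apply: hom_of_linear => c Y Z; rewrite /pcj mulmxDr mulmxDl -scalemxAr -scalemxAl.
  rewrite -pE linear_sum [RHS](reindex_inj (mulgI x')) /=.
  by apply: eq_big => [g|g Kg]; [rewrite (groupMl (G := K)) | rewrite pE pcjM].
have c0 : c != 0.
  apply/eqP => c0; have := qid x Ux; rewrite qE c0 mul_scalar_mx scale0r => /esym/eqP.
  by rewrite scaler_eq0 (negPf x0) (negPf (cardG_neq0 char0 K)).
have -> : v = c^-1 *: (q *m v) by rewrite qE mul_scalar_mx scalerA mulVf // scale1r.
exact/memvZ/qU.
Qed.

(** The natural map S goes from the module induced from mu, which is F_(-mu), to the one induced
    from K; the isomorphism wanted is its inverse. *)
Lemma intertwiner_ind lam mu : exists E,
  Ind_iso K A (tens_rep (pi lam) (dual_rep (pi (lam - mu)))) (dual_mx mu) E.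
Proof.
have tE x Y : tens_rep (pi lam) (dual_rep (pi (lam - mu))) x *m vec Y = vec (pcj x Y).
  by rewrite tens_vec trmxK.
set W := tens_rep _ _ in tE *.
pose ent (F : {ffun gT -> 'cV[k]_1}) : fn := [ffun g => F g 0 0].
pose S F : {ffun gT -> 'cV[k]_(n_ lam * n_ (lam - mu))} :=
  [ffun g => vec (T lam (lam - mu) (translate g^-1%g (ent F)))].
have entP F : in_Ind A (dual_mx mu) F <-> in_F (lam - mu - lam) (ent F).
  rewrite addrAC subrr add0r; split=> FF g a Aa.
    rewrite ![ent _ _]ffunE FF // /dual_mx mul_scalar_mx mxE.
    by rewrite dual_opp dualV.
  apply/matrixP => i j; rewrite !ord1; have := FF g a Aa.
  by rewrite ![ent _ _]ffunE /dual_mx mul_scalar_mx mxE dual_opp dualV.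
have entL c u v : ent (c *: u + v) = c *: ent u + ent v.
  by apply/ffunP=> g; rewrite fnD fnZ ![ent _ _]ffunE !ffunE !mxE.
have entI : injective ent.
  move=> F F' /ffunP e; apply/ffunP=> g; apply/matrixP => i j; rewrite !ord1.
  by have := e g; rewrite !ffunE.
have entT x F : ent (translate x F) = translate x (ent F).
  by apply/ffunP=> g; rewrite !ffunE.
have SL : linear S.
  move=> c u v; apply/ffunP=> g; rewrite !ffunE entL translate_linear linearP /=.
  exact: vec_is_linear.
have Q0 : in_Ind A (dual_mx mu) 0 by move=> g a _; rewrite !ffunE mulmx0.
have QL (c : k) u v : in_Ind A (dual_mx mu) u -> in_Ind A (dual_mx mu) v ->
    in_Ind A (dual_mx mu) (c *: u + v).
  by move=> /entP Fu /entP Fv; apply/entP; rewrite entL; apply/in_FD/Fv/in_FZ.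
have S_inj F F' : in_Ind A (dual_mx mu) F -> in_Ind A (dual_mx mu) F' ->
    S F = S F' -> F = F'.
  move=> /entP FF /entP FF' e; apply/entI/eqP; rewrite -subr_eq0; apply/eqP.
  apply: (@functor_inj_in lam (lam - mu)).
    by rewrite -scaleN1r; apply: (in_FD FF); apply: in_FZ.
  move=> g; rewrite -scaleN1r translateD translateZ scaleN1r linearB /=.
  apply/eqP; rewrite subr_eq0; apply/eqP/vec_inj.
  by move/ffunP/(_ g^-1%g): e; rewrite !ffunE invgK.
have SP F : in_Ind K W (S F).
  by move=> g x Kx; rewrite ![S _ _]ffunE tE invMg translateM piT ?groupV.
have oS F : in_Ind K W F -> exists2 F', in_Ind A (dual_mx mu) F' & S F' = F.
  move=> FF; have [|f Ff fE] := @functor_surj lam (lam - mu) (fun g => unvec (F g)).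
    by move=> g x Kx; rewrite FF // -[F g]unvecK tE !vecK.
  pose F' : {ffun gT -> 'cV[k]_1} := [ffun g => (f g : k)%:M].
  have e : ent F' = f by apply/ffunP=> g; rewrite !ffunE mxE eqxx mulr1n.
  exists F'; first by apply/entP; rewrite e.
  by apply/ffunP=> g; rewrite ffunE e fE unvecK.
have [E EP] := hom_inverse Q0 QL SL oS.
have ST x F : S (translate x F) = translate x (S F).
  apply/ffunP=> g; rewrite translateE !ffunE entT -translateM.
  by rewrite invMg invgK.
exists E; split.
- by move=> F /EP[].
- move=> F /EP[_ SE] E0; rewrite -SE E0; have [p pE] := hom_of_linear SL.
  by rewrite -pE linear0.
- move=> F' QF'; exists (S F'); first exact: SP.
  by have [Q1 e] := EP _ (SP F'); apply: S_inj.
move=> h F PF; have [Q1 e] := EP _ PF.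
have PhF : in_Ind K W (translate h F).
  by move=> g x Kx; rewrite !translateE mulgA PF.
have [Q2 e2] := EP _ PhF; apply: S_inj => //.
  by move=> g a Aa; rewrite !translateE mulgA Q1.
by rewrite e2 ST e.
Qed.

Definition datum_of_intertwiner : datum k A :=
  Datum intertwiner_projective intertwiner_irreducible
    (fun lam mu => intertwiner_tens_linear (lam - mu) lam) intertwiner_ind.

Lemma datum_of_intertwiner_realizable : realizable J datum_of_intertwiner.
Proof.
exists T; split; first exact: fT.
  by move=> lam mu x f Kx; apply: piT.
by move=> mu f; apply: functor_inj.
Qed.

End DatumFromTwist.

Lemma twist_realizable (k : closedFieldType) (gT : finGroupType) (A : {group gT})
    (char0 : [pchar k] =i pred0) (abelA : abelian A) (J : twist k A) :
  exists d, realizable J d.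
Proof.
have [n_ [T [fT T1 Ts pos]]] := functor_of_twist char0 abelA J.
have [pi [pi_unit piT]] := kernel_intertwiner char0 abelA fT T1 Ts pos.
by eexists; apply: (datum_of_intertwiner_realizable char0 abelA fT T1 Ts pos pi_unit piT).
Qed.

(** * Correspondences between classes *)

Lemma class_of_eq (X : Type) (R : X -> X -> Prop) x x' :
  R x = R x' -> class_of R x = class_of R x'.
Proof. by move=> e; apply: eq_exist. Qed.

Lemma class_of_surj (X : Type) (R : X -> X -> Prop) (C : eq_classes R) :
  exists x, C = class_of R x.
Proof. by case: C => C [x e]; subst C; exists x; apply: eq_exist. Qed.

(** When Q x y holds, the class of x is the fibre of Q over y and the class of y is the fibre over
    x, so each class determines the other. That R and S are equivalence relations is implied by the
    hypotheses on fibres and totality. *)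
Lemma class_correspondence (X Y : Type) (R : X -> X -> Prop) (S : Y -> Y -> Prop)
    (Q : X -> Y -> Prop) :
  (forall x, exists y, Q x y) -> (forall y, exists x, Q x y) ->
  (forall x x' y, Q x y -> Q x' y <-> R x x') ->
  (forall x y y', Q x y -> Q x y' <-> S y y') ->
  exists (D : eq_classes R -> eq_classes S) (T : eq_classes S -> eq_classes R),
  [/\ forall x y, Q x y -> D (class_of R x) = class_of S y,
      forall x y, Q x y -> T (class_of S y) = class_of R x,
      cancel D T & cancel T D].
Proof.
move=> exY exX QR QS.
have RE x y : Q x y -> R x = Q^~ y.
  by move=> q; apply/funext => x'; apply/propext; split=> /(QR x x' y q).
have SE x y : Q x y -> S y = Q x.
  by move=> q; apply/funext => y'; apply/propext; split=> /(QS x y y' q).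
have Rc x x' y y' : Q x y -> Q x' y' ->
    class_of R x = class_of R x' -> class_of S y = class_of S y'.
  move=> q q' /(congr1 sval) /= e; apply: class_of_eq.
  by rewrite (SE x y) // (SE x y') // -[Q x y']/((Q^~ y') x) -(RE x' y') // -e; apply/(QR x x y).
have Sc x x' y y' : Q x y -> Q x' y' ->
    class_of S y = class_of S y' -> class_of R x = class_of R x'.
  move=> q q' /(congr1 sval) /= e; apply: class_of_eq.
  by rewrite (RE x y) // (RE x' y) // -(SE x' y') // -e; apply/(QS x y y).
have /choice[D DP] C : exists E, exists x y, [/\ C = class_of R x, E = class_of S y & Q x y].
  by have [x ->] := class_of_surj C; have [y q] := exY x; exists (class_of S y), x, y.
have /choice[T TP] E : exists C, exists x y, [/\ E = class_of S y, C = class_of R x & Q x y].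
  by have [y ->] := class_of_surj E; have [x q] := exX y; exists (class_of R x), x, y.
have DE x y : Q x y -> D (class_of R x) = class_of S y.
  move=> q; have [x' [y' [e -> q']]] := DP (class_of R x).
  by apply: (Rc x' x).
have TE x y : Q x y -> T (class_of S y) = class_of R x.
  move=> q; have [x' [y' [e -> q']]] := TP (class_of S y).
  by apply: (Sc x' x y' y).
exists D, T; split=> // [C|E].
  have [x ->] := class_of_surj C; have [y q] := exY x.
  by rewrite (DE _ _ q) (TE _ _ q).
have [y ->] := class_of_surj E; have [x q] := exX y.
by rewrite (TE _ _ q) (DE _ _ q).
Qed.

Section Correspondence.
Variables (k : closedFieldType) (gT : finGroupType) (A : {group gT}).
Hypotheses (char0 : [pchar k] =i pred0) (abelA : abelian A).

Lemma realizable_gaugeP (J J' : twist k A) d :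
  realizable J d -> realizable J' d <-> gauge_equiv J J'.
Proof.
move=> q; split=> [q'|[t gt e]].
  exact (gauge_of_realizations char0 abelA (twistP J) (twistP J') q q').
exact (realizable_gauge char0 abelA gt e q).
Qed.

(** Some datum realizes J, any associated datum is isomorphic to it, and realizations are
    transported along isomorphisms. *)
Lemma associated_realizable (J : twist k A) d : associated_datum J d -> realizable J d.
Proof.
move=> a; have [d0 q] := twist_realizable char0 abelA J; have [T0 r] := q.
exact (realizable_iso (associated_iso char0 abelA r a) q).
Qed.

(** Two data realizing J are compared by viewing the second as associated with J and applying the
    uniqueness theorem. *)
Lemma realizable_isoP (J : twist k A) d d' :
  realizable J d -> realizable J d' <-> datum_iso d d'.
Proof.
move=> q; split=> [[T' r']|i]; last exact (realizable_iso i q).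
have [T r] := q.
exact (associated_iso char0 abelA r (realizes_associated char0 abelA r')).
Qed.

End Correspondence.

Theorem theorem6p6 (k : closedFieldType) (gT : finGroupType) (A : {group gT})
    (char0 : [pchar k] =i pred0) (abelA : abelian A) :
  exists (D : twist_classes k A -> datum_classes k A)
         (T : datum_classes k A -> twist_classes k A),
  [/\ forall J : twist k A,
        (exists d : datum k A, associated_datum J d) /\
        (forall d : datum k A, associated_datum J d ->
          D (class_of (@gauge_equiv k gT A) J)
          = class_of (@datum_iso k gT A) d),
      forall d : datum k A,
        (exists J : twist k A, exchange_twist d J) /\
        (forall J : twist k A, exchange_twist d J ->
          T (class_of (@datum_iso k gT A) d)
          = class_of (@gauge_equiv k gT A) J),
      cancel D T
    & cancel T D].
Proof.
have [||||D [T [DE TE DK TK]]] := @class_correspondence _ _ (@gauge_equiv k gT A)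
    (@datum_iso k gT A) (fun (J : twist k A) d => realizable J d).
- exact: twist_realizable.
- exact: datum_realizable.
- by move=> J J' d; apply: realizable_gaugeP.
- by move=> J d d'; apply: realizable_isoP.
exists D, T; split=> // [J|d]; split.
- have [d [T0 r]] := twist_realizable char0 abelA J.
  by exists d; apply: (realizes_associated char0 abelA r).
- by move=> d /(associated_realizable char0 abelA); apply: DE.
- have [J q] := datum_realizable char0 abelA d.
  by exists J; apply: (realizable_exchange char0 abelA).
by move=> J /(exchange_realizable char0 abelA); apply: TE.
Qed.
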